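(* Let $X$ be a $\Sigma^0_2$ set. Then $X$ is $\mathrm{high}_2$ if and only if for all $\Sigma^0_2$ sets $Y\ge_e X$ and all $A\le_e Y$: if there is $B$ with $A\not\le_e B$ such that every $Z<_e A$ satisfies $Z\le_e B$, then there is $C\le_e Y$ with $A\not\le_e C$ such that every $Z<_e A$ satisfies $Z\le_e C$.
   Context: $\le_e$ is enumeration reducibility ($A=\Gamma(B)$ for some c.e. set $\Gamma$ of axioms $\langle x,D\rangle$, $D$ finite); $<_e$ as usual. With $(\Gamma_e)_e$ a listing of c.e. sets, $K_X=\bigoplus_e\Gamma_e(X)$ and the enumeration jump is $X'=K_X\oplus(\omega\setminus K_X)$; $0'_e=\emptyset'$, $0'''_e=\emptyset'''$. $\Sigma^0_2$ sets are those $\le_e 0'_e$; all quantifiers range over $\Sigma^0_2$ sets. $X$ is $\mathrm{high}_2$ if $X''\ge_e 0'''_e$. *)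

(* Defs.v *)
From Stdlib Require Cantor.
From mathcomp Require Import all_boot zify.
From mathcomp Require Import mathcomp_extra boolp classical_sets.

Set Implicit Arguments.
Unset Strict Implicit.
Unset Printing Implicit Defensive.

Local Open Scope classical_set_scope.

Definition npair (x y : nat) : nat := Cantor.to_nat (x, y).
Definition nfst (z : nat) : nat := (Cantor.of_nat z).1.
Definition nsnd (z : nat) : nat := (Cantor.of_nat z).2.

(* Kleene's partial recursive functions, presented as unary functions: several
   arguments are packed with [npair], so that the projections and pairing take
   the place of the projection functions and of composition with several
   functions. *)
Inductive code : Type :=
| Zero
| Succ
| Fst
| Snd
| Pair of code & code
| Comp of code & code
| Prec of code & code
| Mu of code.

(* [prec_graph f g a n y]: h(a, n) = y, where h(a, 0) = f(a) and
   h(a, n + 1) = g(a, (n, h(a, n))). *)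
Fixpoint prec_graph (f g : nat -> nat -> Prop) (a n y : nat) : Prop :=
  if n is n'.+1
  then exists2 z, prec_graph f g a n' z & g (npair a (npair n' z)) y
  else f a y.

(* [eval c x y]: the partial function coded by [c] converges on [x], with
   value [y]. *)
Fixpoint eval (c : code) : nat -> nat -> Prop :=
  match c with
  | Zero => fun x y => y = 0
  | Succ => fun x y => y = x.+1
  | Fst => fun x y => y = nfst x
  | Snd => fun x y => y = nsnd x
  | Pair f g => fun x y =>
      exists a b, [/\ eval f x a, eval g x b & y = npair a b]
  | Comp f g => fun x y => exists2 z, eval g x z & eval f z y
  | Prec f g => fun x y => prec_graph (eval f) (eval g) (nfst x) (nsnd x) y
  | Mu f => fun x y =>
      eval f (npair x y) 0 /\
      forall m, m < y -> exists k, eval f (npair x m) k.+1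
  end.

Definition dom (c : code) : set nat := [set x | exists y, eval c x y].

Definition ce (A : set nat) : Prop := exists c : code, A = dom c.

Fixpoint encode (c : code) : nat :=
  match c with
  | Zero => 0
  | Succ => 1
  | Fst => 2
  | Snd => 3
  | Pair f g => 4 * npair (encode f) (encode g) + 4
  | Comp f g => 4 * npair (encode f) (encode g) + 5
  | Prec f g => 4 * npair (encode f) (encode g) + 6
  | Mu f => 4 * encode f + 7
  end.

(* The e-th c.e. set; it is empty when [e] is not the number of a code. *)
Definition W (e : nat) : set nat := [set x | exists2 c, encode c = e & dom c x].

Lemma npair_inj x y x' y' : npair x y = npair x' y' -> x = x' /\ y = y'.
Proof. by move=> /Cantor.to_nat_inj []. Qed.

Lemma encode_inj : injective encode.
Proof.
elim=> [||||f IHf g IHg|f IHf g IHg|f IHf g IHg|f IHf]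
       [||||f' g'|f' g'|f' g'|f'] //= H; try lia;
  try (have /npair_inj[/IHf-> /IHg->] //:
         npair (encode f) (encode g) = npair (encode f') (encode g') by lia).
by have /IHf-> : encode f = encode f' by lia.
Qed.

Lemma W_encode c : W (encode c) = dom c.
Proof.
apply/seteqP; split => [x [c' /encode_inj->]//|x Hx].
by exists c.
Qed.

(* The finite set with canonical index u, namely the set of positions of the
   digit 1 in the binary expansion of u. *)
Definition canon_set (u : nat) : set nat := [set x | odd (u %/ 2 ^ x)].

(* The axiom <x, D> is the number [npair x u] with u the canonical index
   of D. *)
Definition eop (G B : set nat) : set nat :=
  [set x | exists2 u, G (npair x u) & canon_set u `<=` B].

Definition ele (A B : set nat) : Prop := exists2 G, ce G & A = eop G B.

Definition elt (A B : set nat) : Prop := ele A B /\ ~ ele B A.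

Declare Scope enum_scope.
Notation "A <=e B" := (ele A B) (at level 70, no associativity) : enum_scope.
Notation "A <e B" := (elt A B) (at level 70, no associativity) : enum_scope.
Open Scope enum_scope.

Definition join (A B : set nat) : set nat :=
  [set n | if odd n then B n./2 else A n./2].

Definition K (X : set nat) : set nat :=
  [set z | eop (W (nfst z)) X (nsnd z)].

Definition ejump (X : set nat) : set nat := join (K X) (~` K X).

Definition sigma2 (A : set nat) : Prop := A <=e ejump set0.

Definition high2 (X : set nat) : Prop :=
  ejump (ejump (ejump set0)) <=e ejump (ejump X).

(* Main.v *)
(* A is the left half of an Ahmad pair if some B is not above A but above every
   Z <e A; then B is called a right half.

   If Y is high_2 and A <=e Y is a left half, with right half B, then the ideal
   I = {e : Gamma_e(A) <=e B} is Sigma_4, hence Sigma_2 relative to Y'.  A set C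
   enumerated from Y along good stages of an approximation to Y codes
   Gamma_e(A) for e in I and only finite sets otherwise, while dumping
   elements as long as A and Gamma_j(C) agree keeps A from being reducible to C.

   Conversely, let A be the set of strings to the right of a 1-generic real
   P <=T 0'.  Such an A cannot be split: given A <=e Z0 + Z1 with Z0, Z1 <=e A,
   genericity of P yields A <=e Z0 or A <=e Z1.  It is also low, and hence, by
   the first construction below 0', a left half.  Moreover there is a uniform
   sequence Z_n <=e A such that A <=e Z_n exactly when n is in 0''' (the
   Sigma_3 half), so a right half C of A satisfies 0''' <= C''.  If X is not
   high_2 then 0' is not reducible to X, and a Posner-Robinson argument provides
   such a P whose left cut is not reducible to X; then (X + A)' <=e X', so that
   a right half of A below X + A would make X high_2. *)
Require Import Defs.
From Stdlib Require Cantor.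
From mathcomp Require Import all_boot zify.
From mathcomp Require Import mathcomp_extra boolp classical_sets.

Set Implicit Arguments.
Unset Strict Implicit.
Unset Printing Implicit Defensive.

(** Below a Sigma^0_2 set Y the obstacle is that an approximation to Y never stops making errors.
    Coding lengths and lengths of agreement are therefore measured only at the infinitely many
    stages whose guess is contained in Y, and there each of them either tends to infinity or stays
    bounded. The real P with left cut not below X is found indirectly. If all generic reals below 0'
    had their left cuts below X, so would their bitwise complements, and X would enumerate the
    initial segments of all of them. Decoding 0' in the Posner-Robinson way needs a noncomputable
    set that X enumerates together with its complement; nothing provides one at the outset. A first
    generic P0 supplies its cut as such a set, and a second generic P1, built over that cut, would
    then put 0' below X. In the coding, Z_n copies A into columns, and column k is infinite exactly
    when k witnesses that n is in the Sigma_3 set. The strategy against the e-th operator may change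
    only columns of index at least e, and near P it acts finitely often, so an infinite column keeps
    a usable copy of A. *)

Lemma nfst_npair x y : nfst (npair x y) = x.
Proof. by rewrite /nfst /npair Cantor.cancel_of_to. Qed.

Lemma nsnd_npair x y : nsnd (npair x y) = y.
Proof. by rewrite /nsnd /npair Cantor.cancel_of_to. Qed.

Lemma npairK z : npair (nfst z) (nsnd z) = z.
Proof.
rewrite /npair /nfst /nsnd -[in RHS](Cantor.cancel_to_of z).
by case: (Cantor.of_nat z).
Qed.

Lemma npair_ge x y : x <= npair x y /\ y <= npair x y.
Proof. by have := Cantor.to_nat_non_decreasing x y; rewrite /npair; lia. Qed.

Lemma nfst_le z : nfst z <= z.
Proof. by rewrite -{2}(npairK z); case: (npair_ge (nfst z) (nsnd z)). Qed.

Lemma nsnd_le z : nsnd z <= z.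
Proof. by rewrite -{2}(npairK z); case: (npair_ge (nfst z) (nsnd z)). Qed.

(** [enc] need not be onto. [dec_code] makes [dec] computable at every number, so that a search over
    [T] can be run as a search over numbers. *)
Class Enc (T : Type) := {
  enc : T -> nat;
  dec : nat -> T;
  encK : cancel enc dec;
  dec_code : exists c, forall n, eval c n (enc (dec n))
}.

Definition computable {T U : Type} {eT : Enc T} {eU : Enc U} (f : T -> U) :=
  exists c, forall x, eval c (enc x) (enc (f x)).

Definition code_id := Pair Fst Snd.

Lemma eval_id n : eval code_id n n.
Proof. by exists (nfst n), (nsnd n); split=> //; rewrite npairK. Qed.

#[global] Instance Enc_nat : Enc nat.
Proof. by exists id id => //; exists code_id => n; apply: eval_id. Defined.

Lemma eval_pair c d x a b :
  eval c x a -> eval d x b -> eval (Pair c d) x (npair a b).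
Proof. by exists a, b. Qed.

Lemma eval_comp c d x y z : eval d x y -> eval c y z -> eval (Comp c d) x z.
Proof. by exists y. Qed.

#[global] Instance Enc_prod T U (eT : Enc T) (eU : Enc U) : Enc (T * U).
Proof.
exists (fun p => npair (enc p.1) (enc p.2))
       (fun n => (dec (nfst n), dec (nsnd n))).
- by move=> [x y]; rewrite /= nfst_npair nsnd_npair !encK.
- have [c Hc] := @dec_code T eT; have [d Hd] := @dec_code U eU.
  exists (Pair (Comp c Fst) (Comp d Snd)) => n.
  by apply: eval_pair; apply: eval_comp; first exact: erefl.
Defined.

(** * Closure properties of computable functions *)

Section Basic.
Context {T U V C A : Type} {eT : Enc T} {eU : Enc U} {eV : Enc V}.
Context {eC : Enc C} {eA : Enc A}.

Lemma computable_id : computable (fun x : T => x).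
Proof. by exists code_id => x; apply: eval_id. Qed.

Lemma computable_comp (g : U -> V) (f : T -> U) :
  computable g -> computable f -> computable (fun x => g (f x)).
Proof.
move=> [c Hc] [d Hd]; exists (Comp c d) => x.
by apply: eval_comp (Hd x) (Hc _).
Qed.

Lemma computable_pair (f : T -> U) (g : T -> V) :
  computable f -> computable g -> computable (fun x => (f x, g x)).
Proof. by move=> [c Hc] [d Hd]; exists (Pair c d) => x; apply: eval_pair. Qed.

Lemma computable_fst (f : T -> U * V) :
  computable f -> computable (fun x => (f x).1).
Proof.
move=> [c Hc]; exists (Comp Fst c) => x; apply: eval_comp (Hc x) _.
by rewrite /= nfst_npair.
Qed.

Lemma computable_snd (f : T -> U * V) :
  computable f -> computable (fun x => (f x).2).
Proof.
move=> [c Hc]; exists (Comp Snd c) => x; apply: eval_comp (Hc x) _.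
by rewrite /= nsnd_npair.
Qed.

Lemma computable_const (u : U) : computable (fun _ : T => u).
Proof.
have H n : exists c, forall x, eval c x n.
  elim: n => [|n [c Hc]]; first by exists Zero.
  by exists (Comp Succ c) => x; exists n => /=.
by have [c Hc] := H (enc u); exists c => x.
Qed.

Lemma computable_enc (f : T -> U) :
  computable f -> computable (fun x => enc (f x)).
Proof. by []. Qed.

Lemma computable_dec (f : T -> nat) :
  computable f -> computable (fun x => dec (f x) : U).
Proof.
move=> [c Hc]; have [d Hd] := @dec_code U eU.
by exists (Comp d c) => x; apply: eval_comp (Hc x) (Hd _).
Qed.

Lemma computable_nfst (f : T -> nat) :
  computable f -> computable (fun x => nfst (f x)).
Proof. by move=> [c Hc]; exists (Comp Fst c) => x; eexists; [exact: Hc|]. Qed.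

Lemma computable_nsnd (f : T -> nat) :
  computable f -> computable (fun x => nsnd (f x)).
Proof. by move=> [c Hc]; exists (Comp Snd c) => x; eexists; [exact: Hc|]. Qed.

Lemma computable_npair (f g : T -> nat) :
  computable f -> computable g -> computable (fun x => npair (f x) (g x)).
Proof. by move=> [c Hc] [d Hd]; exists (Pair c d) => x; apply: eval_pair. Qed.

Lemma computable_succ (f : T -> nat) :
  computable f -> computable (fun x => (f x).+1).
Proof. by move=> [c Hc]; exists (Comp Succ c) => x; eexists; [exact: Hc|]. Qed.

(** [Prec] carries the whole input as its parameter, so [f] and [a] may depend on the context [c].
    The recursions on numbers and lists below are reduced to this one. *)
Lemma computable_iteri (n : C -> nat) (f : C -> nat -> A -> A) (a : C -> A) :
  computable n -> computable (fun p : C * (nat * A) => f p.1 p.2.1 p.2.2) ->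
  computable a -> computable (fun c => iteri (n c) (f c) (a c)).
Proof.
move=> [cn Hn] [cf Hf] [ca Ha].
exists (Comp (Prec ca cf) (Pair code_id cn)) => x.
apply: eval_comp; first exact: eval_pair (eval_id _) (Hn x).
rewrite /= nfst_npair nsnd_npair; elim: (n x) => [|k IHk] //=.
by exists (enc (iteri k (f x) (a x))); [exact: IHk | exact: (Hf (x, (k, _)))].
Qed.
End Basic.

Lemma computable_iter {C A} {eC : Enc C} {eA : Enc A}
    (n : C -> nat) (f : C -> A -> A) (a : C -> A) :
  computable n -> computable (fun p : C * A => f p.1 p.2) ->
  computable a -> computable (fun c => iter (n c) (f c) (a c)).
Proof.
move=> Hn Hf Ha.
have /funext -> : (fun c => iter (n c) (f c) (a c)) =1
         (fun c => iteri (n c) (fun _ => f c) (a c)).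
  by move=> c; elim: (n c) => //= k ->.
apply: computable_iteri => //.
apply: (computable_comp Hf (f := fun p : C * (nat * A) => (p.1, p.2.2))).
apply: computable_pair; first exact/computable_fst/computable_id.
exact/computable_snd/computable_snd/computable_id.
Qed.

Section Curried.
Context {T U V W X : Type} {eT : Enc T} {eU : Enc U} {eV : Enc V}.
Context {eW : Enc W} {eX : Enc X}.

Lemma computable_comp2 (g : U -> V -> W) (a : T -> U) (b : T -> V) :
  computable (fun p : U * V => g p.1 p.2) -> computable a -> computable b ->
  computable (fun x => g (a x) (b x)).
Proof.
move=> Hg Ha Hb; apply: (computable_comp Hg (f := fun x => (a x, b x))).
exact: computable_pair.
Qed.

Lemma computable_comp3 (g : U -> V -> W -> X) (a : T -> U) (b : T -> V)
    (c : T -> W) :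
  computable (fun p : U * V * W => g p.1.1 p.1.2 p.2) ->
  computable a -> computable b -> computable c ->
  computable (fun x => g (a x) (b x) (c x)).
Proof.
move=> Hg Ha Hb Hc.
apply: (computable_comp Hg (f := fun x => (a x, b x, c x))).
by apply: computable_pair => //; apply: computable_pair.
Qed.
End Curried.

Ltac comp_base := fail.
Ltac comp_hyp := match goal with
 | H : computable ?g |- computable (fun x => ?g (@?f x)) =>
     simple eapply (computable_comp H (f := f))
 | H : computable (fun p => ?g p.1 p.2)
   |- computable (fun x => ?g (@?a x) (@?b x)) =>
     simple eapply (computable_comp2 (a := a) (b := b) H)
 | H : computable (fun p => ?g p.1.1 p.1.2 p.2)
   |- computable (fun x => ?g (@?a x) (@?b x) (@?c x)) =>
     simple eapply (computable_comp3 (a := a) (b := b) (c := c) H)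
 end.
Ltac comp_step := first
 [ assumption
 | comp_hyp
 | simple eapply computable_id
 | simple eapply computable_const
 | simple eapply computable_fst
 | simple eapply computable_snd
 | simple eapply computable_pair
 | simple eapply computable_succ
 | simple eapply computable_nfst
 | simple eapply computable_nsnd
 | simple eapply computable_npair
 | simple eapply computable_enc
 | simple eapply computable_dec
 | simple eapply computable_iter
 | simple eapply computable_iteri
 | comp_base
 | eapply computable_pair | eapply computable_fst | eapply computable_snd ].
Ltac comp_tac := repeat (cbv beta zeta; comp_step).

Section Arith.
Context {T U : Type} {eT : Enc T} {eU : Enc U}.
Implicit Types f g : T -> nat.

Lemma computable_pred f : computable f -> computable (fun x => (f x).-1).
Proof.
move=> Hf.
have /funext -> : (fun x => (f x).-1) =1 fun x => iteri (f x) (fun i _ => i) 0.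
  by move=> x; case: (f x).
comp_tac.
Qed.

Lemma computable_addn f g :
  computable f -> computable g -> computable (fun x => f x + g x).
Proof.
move=> Hf Hg.
have /funext -> : (fun x => f x + g x) =1 fun x => iter (f x) succn (g x).
  by move=> x; elim: (f x) => //= n <-.
comp_tac.
Qed.
End Arith.

Ltac comp_base ::= first
 [ simple eapply computable_pred | simple eapply computable_addn ].

Section Arith2.
Context {T U : Type} {eT : Enc T} {eU : Enc U}.
Implicit Types f g : T -> nat.

Lemma computable_subn f g :
  computable f -> computable g -> computable (fun x => f x - g x).
Proof.
move=> Hf Hg.
have /funext -> : (fun x => f x - g x) =1 fun x => iter (g x) predn (f x).
  by move=> x; elim: (g x) => [|n /= <-]; rewrite ?subn0 ?subnS.
comp_tac.
Qed.

Lemma computable_muln f g :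
  computable f -> computable g -> computable (fun x => f x * g x).
Proof.
move=> Hf Hg.
have /funext -> : (fun x => f x * g x) =1
                  fun x => iter (f x) (fun y => g x + y) 0.
  by move=> x; elim: (f x) => //= n <-; lia.
comp_tac.
Qed.

End Arith2.

#[global] Instance Enc_bool : Enc bool.
Proof.
exists nat_of_bool (fun n => n != 0); first by case.
(* By truncated subtraction this is the indicator of [n != 0]. *)
have [c Hc] : computable (fun n : nat => 1 - (1 - n)).
  by apply: computable_subn; comp_tac; apply: computable_subn; comp_tac.
by exists c => -[|n]; [exact: (Hc 0) | exact: (Hc n.+1)].
Defined.

Section Arith3.
Context {T U : Type} {eT : Enc T} {eU : Enc U}.
Implicit Types f g : T -> nat.

Lemma computable_if (b : T -> bool) (f g : T -> U) :
  computable b -> computable f -> computable g ->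
  computable (fun x => if b x then f x else g x).
Proof.
move=> Hb Hf Hg.
have /funext -> : (fun x => if b x then f x else g x) =1
                  fun x => iter (b x) (fun _ => f x) (g x).
  by move=> x; case: (b x).
apply: computable_iter => //.
by apply: (computable_comp Hf); comp_tac.
Qed.

Lemma computable_eq0 f : computable f -> computable (fun x => f x == 0).
Proof.
move=> Hf.
have /funext -> : (fun x => f x == 0) =1
                  fun x => iter (f x) (fun _ => false) true.
  by move=> x; case: (f x).
comp_tac.
Qed.
End Arith3.

Ltac comp_base ::= first
 [ simple eapply computable_pred | simple eapply computable_addn
 | simple eapply computable_subn | simple eapply computable_muln
 | simple eapply computable_eq0 | simple eapply computable_if ].

Section Bool.
Context {T : Type} {eT : Enc T}.
Implicit Types (f g : T -> nat) (a b : T -> bool).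

Lemma computable_andb a b :
  computable a -> computable b -> computable (fun x => a x && b x).
Proof. by move=> Ha Hb; apply: (computable_if Ha Hb); comp_tac. Qed.

Lemma computable_orb a b :
  computable a -> computable b -> computable (fun x => a x || b x).
Proof. by move=> Ha Hb; apply: (computable_if Ha _ Hb); comp_tac. Qed.

Lemma computable_negb a : computable a -> computable (fun x => ~~ a x).
Proof. by move=> Ha; apply: (computable_if Ha); comp_tac. Qed.

Lemma computable_leq f g :
  computable f -> computable g -> computable (fun x => f x <= g x).
Proof. by move=> Hf Hg; apply: computable_eq0; comp_tac. Qed.

Lemma computable_eqn f g :
  computable f -> computable g -> computable (fun x => f x == g x).
Proof.
move=> Hf Hg; under eq_fun do rewrite eqn_leq.
by apply: computable_andb; apply: computable_leq.
Qed.

Lemma computable_eq {U : eqType} {eU : Enc U} (f g : T -> U) :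
  computable f -> computable g -> computable (fun x => f x == g x).
Proof.
move=> Hf Hg; under eq_fun do rewrite -(inj_eq (can_inj encK)).
by apply: computable_eqn; apply: computable_enc.
Qed.

Lemma computable_natb b : computable b -> computable (fun x => b x : nat).
Proof. by []. Qed.

Lemma computable_expn (f g : T -> nat) :
  computable f -> computable g -> computable (fun x => f x ^ g x).
Proof.
move=> Hf Hg.
have /funext -> : (fun x => f x ^ g x) =1
                  fun x => iter (g x) (fun y => f x * y) 1.
  by move=> x; elim: (g x) => //= n <-; rewrite expnS.
comp_tac.
Qed.
End Bool.

Ltac comp_base ::= first
 [ simple eapply computable_pred | simple eapply computable_addn
 | simple eapply computable_subn | simple eapply computable_muln
 | simple eapply computable_andb | simple eapply computable_orb
 | simple eapply computable_negb | simple eapply computable_leq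
 | simple eapply computable_eq0
 | simple eapply computable_eq | simple eapply computable_natb
 | simple eapply computable_expn
 | simple eapply computable_if ].

Section SeqEnc.
Context {T : Type} {eT : Enc T}.

Definition enc_seq (s : seq T) : nat :=
  foldr (fun x n => (npair (enc x) n).+1) 0 s.

(** The code of a nonempty list exceeds the code of its tail, so [n] itself is enough fuel for
    decoding [n]. *)
Fixpoint dec_seq_fuel (k n : nat) : seq T :=
  match k, n with
  | k'.+1, m.+1 => dec (nfst m) :: dec_seq_fuel k' (nsnd m)
  | _, _ => [::]
  end.

Definition dec_seq n := dec_seq_fuel n n.

Lemma dec_seq_fuel_enc k s : enc_seq s <= k -> dec_seq_fuel k (enc_seq s) = s.
Proof.
elim: s k => [|x s IHs] [|k] //=; rewrite ltnS => le_k.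
rewrite nfst_npair nsnd_npair encK IHs //.
by apply: leq_trans le_k; case: (npair_ge (enc x) (enc_seq s)).
Qed.

Lemma enc_seqK : cancel enc_seq dec_seq.
Proof. by move=> s; apply: dec_seq_fuel_enc. Qed.

(** One move between two coded stacks. Iterating it re-encodes all entries but reverses the list,
    which is why [dec_seq_code] runs it twice. *)
Definition rev_step (p : nat * nat) : nat * nat :=
  if p.1 == 0 then p
  else (nsnd p.1.-1, (npair (enc (dec (nfst p.1.-1) : T)) p.2).+1).

Lemma iter_rev_step k n acc : n <= k ->
  iter k rev_step (n, enc_seq acc) = (0, enc_seq (catrev (dec_seq_fuel k n) acc)).
Proof.
elim: k n acc => [|k IHk] [|n] acc // le_n; rewrite iterSr /rev_step /=.
  by rewrite IHk //; case: k {IHk le_n}.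
by rewrite (IHk _ (dec (nfst n) :: acc)) //; apply: leq_trans (nsnd_le _) _.
Qed.

Lemma computable_rev_step : computable rev_step.
Proof. by rewrite /rev_step; comp_tac. Qed.

Lemma dec_seq_code : exists c, forall n, eval c n (enc_seq (dec_seq n)).
Proof.
have Hs := computable_rev_step.
pose nrev n := (iter n rev_step (n, 0)).2.
have nrevE n : nrev n = enc_seq (rev (dec_seq n)).
  by rewrite /nrev (@iter_rev_step n n [::]) // -/(dec_seq n) catrevE cats0.
have [c Hc] : computable (fun n => nrev (nrev n)) by rewrite /nrev; comp_tac.
exists c => n; have := Hc n.
by rewrite nrevE nrevE enc_seqK revK.
Qed.

#[global] Instance Enc_seq : Enc (seq T).
Proof. by exists enc_seq dec_seq; [exact: enc_seqK | exact: dec_seq_code]. Defined.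

End SeqEnc.

Lemma computable_foldl {C A T} {eC : Enc C} {eA : Enc A} {eT : Enc T}
    (f : C -> A -> T -> A) (a : C -> A) (l : C -> seq T) :
  computable (fun p : C * (A * T) => f p.1 p.2.1 p.2.2) ->
  computable a -> computable l -> computable (fun c => foldl (f c) (a c) (l c)).
Proof.
move=> Hf Ha Hl.
pose step c (p : nat * A) :=
  if p.1 == 0 then p else (nsnd p.1.-1, f c p.2 (@dec T eT (nfst p.1.-1))).
have Hstep : computable (fun p : C * (nat * A) => step p.1 p.2).
  rewrite /step; comp_tac.
  apply: (computable_comp Hf (f := fun p : C * (nat * A) =>
    (p.1, (p.2.2, @dec T eT (nfst p.2.1.-1))))); comp_tac.
(* The code of the list serves as the number of rounds: it bounds the length, and [step] is
   stationary once the list is exhausted. *)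
have /funext -> : (fun c => foldl (f c) (a c) (l c)) =1
    fun c => (iter (enc (l c)) (step c) (enc (l c), a c)).2.
  move=> c; move: (leqnn (@enc_seq T eT (l c))) => /=.
  move: {2 3}(enc_seq (l c)) => k.
  elim: k (l c) (a c) => [|k IHk] [|x s] b // le_k; rewrite iterSr /step /=.
    by rewrite -(IHk [::]).
  rewrite nfst_npair nsnd_npair encK (IHk s) //.
  by move: le_k => /=; have [] := npair_ge (enc x) (enc_seq s); lia.
comp_tac.
Qed.

Section Lists.
Context {C T U A : Type} {eC : Enc C} {eT : Enc T} {eU : Enc U} {eA : Enc A}.

Lemma computable_cons (x : C -> T) (s : C -> seq T) :
  computable x -> computable s -> computable (fun c => x c :: s c).
Proof.
move=> Hx Hs; have : computable (fun c => (npair (enc (x c)) (enc (s c))).+1).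
  by comp_tac.
by move=> [c Hc]; exists c.
Qed.

Lemma computable_rev (s : C -> seq T) :
  computable s -> computable (fun c => rev (s c)).
Proof.
move=> Hs.
have /funext -> : (fun c => rev (s c)) =1
    fun c => foldl (fun a x => x :: a) [::] (s c).
  by move=> c; rewrite -[in RHS](revK (s c)) foldl_rev; elim: (rev _) => //= x l <-.
apply: computable_foldl; comp_tac.
apply: (@computable_comp _ _ _ _ _ _ (fun p : T * seq T => p.1 :: p.2)
         (fun p => (p.2.2, p.2.1))); last by comp_tac.
have [c Hc] : computable (fun p : T * seq T => (npair (enc p.1) (enc p.2)).+1).
  by comp_tac.
by exists c.
Qed.

Lemma computable_foldr (f : C -> T -> A -> A) (a : C -> A) (l : C -> seq T) :
  computable (fun p : C * (T * A) => f p.1 p.2.1 p.2.2) ->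
  computable a -> computable l -> computable (fun c => foldr (f c) (a c) (l c)).
Proof.
move=> Hf Ha Hl.
under eq_fun do rewrite -foldl_rev.
apply: computable_foldl => //; last exact: computable_rev.
by apply: (computable_comp Hf (f := fun p : C * (A * T) => (p.1, (p.2.2, p.2.1))));
  comp_tac.
Qed.

Lemma computable_behead (s : C -> seq T) :
  computable s -> computable (fun c => behead (s c)).
Proof.
move=> Hs; have : computable (fun c => nsnd (enc (s c)).-1) by comp_tac.
by move=> [c Hc]; exists c => x; have := Hc x; case: (s x) => //= y t; rewrite nsnd_npair.
Qed.

Lemma computable_head (x0 : C -> T) (s : C -> seq T) :
  computable x0 -> computable s -> computable (fun c => head (x0 c) (s c)).
Proof.
move=> Hx Hs.
have /funext -> : (fun c => head (x0 c) (s c)) =1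
    fun c => if enc (s c) == 0 then x0 c else dec (nfst (enc (s c)).-1).
  by move=> c; case: (s c) => //= y t; rewrite nfst_npair encK.
comp_tac.
Qed.
End Lists.

Ltac comp_list := first
 [ simple eapply computable_cons | simple eapply computable_rev
 | simple eapply computable_behead | simple eapply computable_head
 | simple eapply computable_foldr | simple eapply computable_foldl ].
Ltac comp_base ::= first
 [ simple eapply computable_pred | simple eapply computable_addn
 | simple eapply computable_subn | simple eapply computable_muln
 | simple eapply computable_andb | simple eapply computable_orb
 | simple eapply computable_negb | simple eapply computable_leq
 | simple eapply computable_eq0
 | simple eapply computable_eq | simple eapply computable_natb
 | simple eapply computable_expn
 | simple eapply computable_if
 | comp_list ].

Section Lists2.
Context {C T U A : Type} {eC : Enc C} {eT : Enc T} {eU : Enc U} {eA : Enc A}.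

Lemma computable_nth (x0 : C -> T) (s : C -> seq T) (i : C -> nat) :
  computable x0 -> computable s -> computable i ->
  computable (fun c => nth (x0 c) (s c) (i c)).
Proof.
move=> Hx Hs Hi.
have /funext -> : (fun c => nth (x0 c) (s c) (i c)) =1
    fun c => head (x0 c) (iter (i c) behead (s c)).
  by move=> c; elim: (i c) (s c) => [|n IHn] [|x s'] //; rewrite iterSr /= -IHn ?nth_nil.
comp_tac.
Qed.

Lemma computable_has (P : C -> T -> bool) (s : C -> seq T) :
  computable (fun p : C * T => P p.1 p.2) -> computable s ->
  computable (fun c => has (P c) (s c)).
Proof.
move=> HP Hs.
have /funext -> : (fun c => has (P c) (s c)) =1
    fun c => foldr (fun x b => P c x || b) false (s c).
  by move=> c; elim: (s c) => //= x l ->.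
comp_tac.
Qed.

Lemma computable_all (P : C -> T -> bool) (s : C -> seq T) :
  computable (fun p : C * T => P p.1 p.2) -> computable s ->
  computable (fun c => all (P c) (s c)).
Proof.
move=> HP Hs.
have /funext -> : (fun c => all (P c) (s c)) =1
    fun c => foldr (fun x b => P c x && b) true (s c).
  by move=> c; elim: (s c) => //= x l ->.
comp_tac.
Qed.

Lemma computable_count (P : C -> T -> bool) (s : C -> seq T) :
  computable (fun p : C * T => P p.1 p.2) -> computable s ->
  computable (fun c => count (P c) (s c)).
Proof.
move=> HP Hs.
have /funext -> : (fun c => count (P c) (s c)) =1
    fun c => foldr (fun x n => P c x + n) 0 (s c).
  by move=> c; elim: (s c) => //= x l ->.
comp_tac.
Qed.

Lemma computable_find (P : C -> T -> bool) (s : C -> seq T) :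
  computable (fun p : C * T => P p.1 p.2) -> computable s ->
  computable (fun c => find (P c) (s c)).
Proof.
move=> HP Hs.
have /funext -> : (fun c => find (P c) (s c)) =1
    fun c => foldr (fun x n => if P c x then 0 else n.+1) 0 (s c).
  by move=> c; elim: (s c) => //= x l ->.
comp_tac.
Qed.

Lemma computable_map (f : C -> T -> U) (s : C -> seq T) :
  computable (fun p : C * T => f p.1 p.2) -> computable s ->
  computable (fun c => map (f c) (s c)).
Proof.
move=> HP Hs.
have /funext -> : (fun c => map (f c) (s c)) =1
    fun c => foldr (fun x l => f c x :: l) [::] (s c).
  by move=> c; elim: (s c) => //= x l ->.
comp_tac.
Qed.

Lemma computable_filter (P : C -> T -> bool) (s : C -> seq T) :
  computable (fun p : C * T => P p.1 p.2) -> computable s ->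
  computable (fun c => filter (P c) (s c)).
Proof.
move=> HP Hs.
have /funext -> : (fun c => filter (P c) (s c)) =1
    fun c => foldr (fun x l => if P c x then x :: l else l) [::] (s c).
  by move=> c; elim: (s c) => //= x l ->.
comp_tac.
Qed.

Lemma computable_size (s : C -> seq T) :
  computable s -> computable (fun c => size (s c)).
Proof.
move=> Hs; have /funext -> : (fun c => size (s c)) =1
    fun c => foldr (fun _ n => n.+1) 0 (s c).
  by move=> c; elim: (s c) => //= x l ->.
comp_tac.
Qed.

Lemma computable_cat (s t : C -> seq T) :
  computable s -> computable t -> computable (fun c => s c ++ t c).
Proof.
move=> Hs Ht; have /funext -> : (fun c => s c ++ t c) =1
    fun c => foldr cons (t c) (s c).
  by move=> c; elim: (s c) => //= x l ->.
comp_tac.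
Qed.

Lemma computable_iota (m n : C -> nat) :
  computable m -> computable n -> computable (fun c => iota (m c) (n c)).
Proof.
move=> Hm Hn; have /funext -> : (fun c => iota (m c) (n c)) =1
    fun c => rev (iteri (n c) (fun i l => (m c + i) :: l) [::]).
  move=> c; elim: (n c) => [//|n' IH].
  by rewrite -[in LHS]addn1 iotaD cats1 /= rev_cons -IH.
comp_tac.
Qed.
End Lists2.

Lemma computable_mem {C : Type} {T : eqType} {eC : Enc C} {eT : Enc T}
   (x : C -> T) (s : C -> seq T) :
  computable x -> computable s -> computable (fun c => x c \in s c).
Proof.
move=> Hx Hs; have /funext -> : (fun c => x c \in s c) =1
    fun c => has (fun y => y == x c) (s c).
  by move=> c; rewrite -has_pred1.
apply: computable_has => //; comp_tac.
Qed.

Ltac comp_list ::= first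
 [ simple eapply computable_cons | simple eapply computable_rev
 | simple eapply computable_behead | simple eapply computable_head
 | simple eapply computable_nth | simple eapply computable_has
 | simple eapply computable_all | simple eapply computable_count
 | simple eapply computable_find
 | simple eapply computable_map | simple eapply computable_filter
 | simple eapply computable_size | simple eapply computable_cat
 | simple eapply computable_iota | simple eapply computable_mem
 | simple eapply computable_foldr | simple eapply computable_foldl ].

Section Lists3.
Context {C T : Type} {eC : Enc C} {eT : Enc T}.

Lemma computable_flatten (s : C -> seq (seq T)) :
  computable s -> computable (fun c => flatten (s c)).
Proof. by move=> Hs; rewrite /flatten; comp_tac. Qed.

Lemma computable_nseq (n : C -> nat) (x : C -> T) :
  computable n -> computable x -> computable (fun c => nseq (n c) (x c)).
Proof.
move=> Hn Hx; have /funext -> : (fun c => nseq (n c) (x c)) =1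
    fun c => iter (n c) (cons (x c)) [::] by [].
comp_tac.
Qed.

Lemma computable_rcons (s : C -> seq T) (x : C -> T) :
  computable s -> computable x -> computable (fun c => rcons (s c) (x c)).
Proof. by move=> Hs Hx; under eq_fun do rewrite -cats1; comp_tac. Qed.

Lemma computable_divn (f g : C -> nat) : (forall c, 0 < g c) ->
  computable f -> computable g -> computable (fun c => f c %/ g c).
Proof.
(* The quotient counts the positive multiples of [g c] that are at most [f c]. *)
move=> g_gt0 Hf Hg; have /funext -> : (fun c => f c %/ g c) =1
    fun c => count (fun i => i.+1 * g c <= f c) (iota 0 (f c)).
  move=> c; have le_div : f c %/ g c <= f c by apply: leq_div.
  have /eq_count -> : (fun i => i.+1 * g c <= f c) =1 (fun i => i < f c %/ g c).
    by move=> i; rewrite leq_divRL.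
  rewrite -[in iota 0 _](subnKC le_div) iotaD count_cat.
  rewrite (@eq_in_count _ _ predT) ?count_predT ?size_iota; last first.
    by move=> i; rewrite mem_iota /= => ->.
  rewrite (@eq_in_count _ _ pred0) ?count_pred0 ?addn0 //.
  by move=> i; rewrite mem_iota /= => /andP[H _]; lia.
comp_tac.
Qed.

Lemma computable_divnS (k : nat) (f : C -> nat) :
  computable f -> computable (fun c => f c %/ k.+1).
Proof. by move=> Hf; apply: computable_divn => //; comp_tac. Qed.

Lemma computable_odd (f : C -> nat) :
  computable f -> computable (fun c => odd (f c)).
Proof.
move=> Hf; have /funext -> : (fun c => odd (f c)) =1
    fun c => iter (f c) negb false.
  by move=> c; elim: (f c) => //= n ->.
comp_tac.
Qed.

Lemma computable_double (f : C -> nat) :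
  computable f -> computable (fun c => (f c).*2).
Proof. by move=> Hf; under eq_fun do rewrite -muln2; comp_tac. Qed.

Lemma computable_half (f : C -> nat) :
  computable f -> computable (fun c => (f c)./2).
Proof.
by move=> Hf; under eq_fun do rewrite -divn2; apply: computable_divn => //; comp_tac.
Qed.
End Lists3.

Ltac comp_list ::= first
 [ simple eapply computable_cons | simple eapply computable_rev
 | simple eapply computable_behead | simple eapply computable_head
 | simple eapply computable_nth | simple eapply computable_has
 | simple eapply computable_all | simple eapply computable_count
 | simple eapply computable_find
 | simple eapply computable_map | simple eapply computable_filter
 | simple eapply computable_size | simple eapply computable_cat
 | simple eapply computable_iota | simple eapply computable_mem
 | simple eapply computable_flatten | simple eapply computable_nseq
 | simple eapply computable_rcons | simple eapply computable_odd
 | simple eapply computable_half | simple eapply computable_double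
 | simple eapply computable_divnS
 | simple eapply computable_foldr | simple eapply computable_foldl ].

(** Enumeration reducibility without indices: by [eleP], [sigma1 B A] amounts to [A <=e B]. A
    witness n contributes the axiom with finite set [u (x, n)], and B is queried only positively.
    With B empty these are the c.e. predicates. *)
Definition sigma1 {T : Type} {eT : Enc T} (B : set nat) (P : T -> Prop) : Prop :=
  exists (r : T * nat -> bool) (u : T * nat -> seq nat),
    [/\ computable r, computable u
      & forall x, P x <->
          exists2 n, r (x, n) & forall y, y \in u (x, n) -> B y].

(** * Closure properties of relative enumerability *)

Section Sigma1.
Context {T : Type} {eT : Enc T}.
Variable B : set nat.
Implicit Types P Q : T -> Prop.

Lemma sigma1_ext P Q : (forall x, P x <-> Q x) -> sigma1 B P -> sigma1 B Q.
Proof.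
move=> PQ [r [u [Hr Hu HP]]]; exists r, u; split=> // x.
by rewrite -PQ.
Qed.

Lemma sigma1_intro {W : Type} {eW : Enc W} (r : T * W -> bool)
    (u : T * W -> seq nat) P :
  computable r -> computable u ->
  (forall x, P x <-> exists2 w, r (x, w) & forall y, y \in u (x, w) -> B y) ->
  sigma1 B P.
Proof.
move=> Hr Hu HP; exists (fun p => r (p.1, dec p.2)), (fun p => u (p.1, dec p.2)).
split; [by comp_tac | by comp_tac | move=> x].
rewrite HP; split=> [[w Hrw Huw]|[n Hrn Hun]]; last by exists (dec n).
by exists (enc w) => /=; rewrite encK.
Qed.

Lemma sigma1_dec (b : T -> bool) : computable b -> sigma1 B (fun x => b x).
Proof.
move=> Hb; apply: (@sigma1_intro nat _ (fun p => b p.1) (fun _ => [::])).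
- by comp_tac.
- by comp_tac.
- by move=> x; split=> [Hx|[]//]; exists 0.
Qed.

Lemma sigma1_base (f : T -> nat) : computable f -> sigma1 B (fun x => B (f x)).
Proof.
move=> Hf; apply: (@sigma1_intro nat _ (fun=> true) (fun p => [:: f p.1])).
- by comp_tac.
- by comp_tac.
- move=> x; split=> [Hx|[n _]]; last by apply; rewrite mem_head.
  by exists 0 => // y; rewrite inE => /eqP ->.
Qed.

Lemma sigma1_comp {U : Type} {eU : Enc U} (P : U -> Prop) (f : T -> U) :
  sigma1 B P -> computable f -> sigma1 B (fun x => P (f x)).
Proof.
move=> [r [u [Hr Hu HP]]] Hf.
exists (fun p => r (f p.1, p.2)), (fun p => u (f p.1, p.2)).
by split; [comp_tac | comp_tac | move=> x].
Qed.

Lemma sigma1_and P Q :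
  sigma1 B P -> sigma1 B Q -> sigma1 B (fun x => P x /\ Q x).
Proof.
move=> [r [u [Hr Hu HP]]] [r' [u' [Hr' Hu' HQ]]].
apply: (@sigma1_intro (nat * nat)%type _
  (fun p => r (p.1, p.2.1) && r' (p.1, p.2.2))
  (fun p => u (p.1, p.2.1) ++ u' (p.1, p.2.2))).
- by comp_tac.
- by comp_tac.
- move=> x; rewrite HP HQ; split.
    move=> [[n Hn Bn] [m Hm Bm]]; exists (n, m); first by rewrite /= Hn.
    by move=> y; rewrite mem_cat => /orP[/Bn|/Bm].
  move=> [[n m] /= /andP[Hn Hm] Bnm].
  by split; [exists n | exists m] => // y Hy; apply: Bnm; rewrite mem_cat Hy ?orbT.
Qed.

Lemma sigma1_or P Q :
  sigma1 B P -> sigma1 B Q -> sigma1 B (fun x => P x \/ Q x).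
Proof.
move=> [r [u [Hr Hu HP]]] [r' [u' [Hr' Hu' HQ]]].
apply: (@sigma1_intro (bool * nat)%type _
  (fun p => if p.2.1 then r (p.1, p.2.2) else r' (p.1, p.2.2))
  (fun p => if p.2.1 then u (p.1, p.2.2) else u' (p.1, p.2.2))).
- by comp_tac.
- by comp_tac.
- move=> x; rewrite HP HQ; split.
    by move=> [[n Hn Bn]|[n Hn Bn]]; [exists (true, n) | exists (false, n)].
  by move=> [[[] n] /= Hn Bn]; [left | right]; exists n.
Qed.

(** Nonuniform: the truth value of [p] is settled classically, leaving a constant function. *)
Lemma sigma1_const (p : Prop) : sigma1 B (fun _ : T => p).
Proof.
apply: (sigma1_ext (P := fun _ => `[< p >])); first by move=> _; split=> /asboolP.
by apply: sigma1_dec; comp_tac.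
Qed.

Lemma sigma1_ex {U : Type} {eU : Enc U} (P : T -> U -> Prop) :
  sigma1 B (fun p : T * U => P p.1 p.2) -> sigma1 B (fun x => exists y, P x y).
Proof.
move=> [r [u [Hr Hu HP]]].
apply: (@sigma1_intro (U * nat)%type _
  (fun p => r ((p.1, p.2.1), p.2.2)) (fun p => u ((p.1, p.2.1), p.2.2))).
- by comp_tac.
- by comp_tac.
- move=> x; split=> [[y /(HP (x, y)) [n Hn Bn]]|[[y n] /= Hn Bn]].
    by exists (y, n).
  by exists y; apply/(HP (x, y)); exists n.
Qed.

End Sigma1.

Section Sigma1Bounded.
Context {T : Type} {eT : Enc T}.
Variable B : set nat.

Lemma sigma1_ex2 {U : Type} {eU : Enc U} (P Q : T -> U -> Prop) :
  sigma1 B (fun p : T * U => P p.1 p.2) ->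
  sigma1 B (fun p : T * U => Q p.1 p.2) ->
  sigma1 B (fun x => exists2 y, P x y & Q x y).
Proof.
move=> HP HQ; apply: (sigma1_ext (P := fun x => exists y, P x y /\ Q x y)).
  by move=> x; split=> [[y []]|[y]]; exists y.
by apply: sigma1_ex; apply: sigma1_and.
Qed.

(** The witnesses for all [i < n x] are packed into one list [w], and the finite sets they require
    are concatenated. *)
Lemma sigma1_all_lt (P : T -> nat -> Prop) (n : T -> nat) :
  sigma1 B (fun p : T * nat => P p.1 p.2) -> computable n ->
  sigma1 B (fun x => forall i, i < n x -> P x i).
Proof.
move=> [r [u [Hr Hu HP]]] Hn.
apply: (@sigma1_intro _ _ _ (seq nat) _
  (fun p => all (fun i => r ((p.1, i), nth 0 p.2 i)) (iota 0 (n p.1)))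
  (fun p => flatten [seq u ((p.1, i), nth 0 p.2 i) | i <- iota 0 (n p.1)])).
- by comp_tac.
- by comp_tac.
- move=> x; split=> [Hx|[w /= /allP Hw Bw] i Hi].
    have /choice[f Hf] i : exists m, i < n x ->
        r ((x, i), m) /\ forall y, y \in u ((x, i), m) -> B y.
      case: (boolP (i < n x)) => [/Hx /(HP (x, i)) [m]|_]; last by exists 0.
      by exists m.
    exists (mkseq f (n x)) => /=.
      by apply/allP => i; rewrite mem_iota /= => Hi; rewrite nth_mkseq //; apply: (Hf i Hi).1.
    move=> y /flatten_mapP[i]; rewrite mem_iota /= => Hi.
    by rewrite nth_mkseq //; apply: (Hf i Hi).2.
  apply/(HP (x, i)); exists (nth 0 w i); first by apply: Hw; rewrite mem_iota.
  move=> y Hy; apply: Bw; apply/flatten_mapP; exists i => //.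
  by rewrite mem_iota.
Qed.

Lemma sigma1_all {U : eqType} {eU : Enc U} (P : T -> U -> Prop)
    (l : T -> seq U) :
  sigma1 B (fun p : T * U => P p.1 p.2) -> computable l ->
  sigma1 B (fun x => forall u, u \in l x -> P x u).
Proof.
move=> HP Hl.
apply: (sigma1_ext (P := fun x => forall i, i < size (l x) ->
          P x (nth (dec 0) (l x) i))).
  move=> x; split=> [Hx u /(nthP (@dec U eU 0))[i Hi <-]|Hx i Hi]; first exact: Hx.
  by apply: Hx; apply: mem_nth.
apply: sigma1_all_lt; last by comp_tac.
by apply: (sigma1_comp (f := fun p : T * nat => (p.1, nth (dec 0) (l p.1) p.2)) HP);
  comp_tac.
Qed.
End Sigma1Bounded.

Lemma sigma1_comp2 {T U V} {eT : Enc T} {eU : Enc U} {eV : Enc V} B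
    (P : U -> V -> Prop) (a : T -> U) (b : T -> V) :
  sigma1 B (fun p : U * V => P p.1 p.2) -> computable a -> computable b ->
  sigma1 B (fun x => P (a x) (b x)).
Proof.
move=> HP Ha Hb.
by apply: (sigma1_comp (f := fun x => (a x, b x)) HP); apply: computable_pair.
Qed.

Lemma sigma1_comp3 {T U V W} {eT : Enc T} {eU : Enc U} {eV : Enc V}
    {eW : Enc W} B
    (P : U -> V -> W -> Prop) (a : T -> U) (b : T -> V) (c : T -> W) :
  sigma1 B (fun p : U * V * W => P p.1.1 p.1.2 p.2) ->
  computable a -> computable b -> computable c ->
  sigma1 B (fun x => P (a x) (b x) (c x)).
Proof.
move=> HP Ha Hb Hc.
by apply: (sigma1_comp (f := fun x => (a x, b x, c x)) HP); comp_tac.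
Qed.

Ltac sig_extra := fail.
Ltac sig_hyp := match goal with
 | H : sigma1 ?B ?P |- sigma1 ?B (fun x => ?P (@?f x)) =>
     simple eapply (sigma1_comp (f := f) H)
 | H : sigma1 ?B (fun p => ?P p.1 p.2)
   |- sigma1 ?B (fun x => ?P (@?a x) (@?b x)) =>
     simple eapply (sigma1_comp2 (a := a) (b := b) H)
 | H : sigma1 ?B (fun p => ?P p.1.1 p.1.2 p.2)
   |- sigma1 ?B (fun x => ?P (@?a x) (@?b x) (@?c x)) =>
     simple eapply (sigma1_comp3 (a := a) (b := b) (c := c) H)
 | H : sigma1 ?B (fun x => ~ ?P x) |- sigma1 ?B (fun x => ~ ?P (@?f x)) =>
     simple eapply (sigma1_comp (P := fun y => ~ P y) (f := f) H)
 | H : sigma1 ?B (fun p => ~ ?P p.1 p.2)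
   |- sigma1 ?B (fun x => ~ ?P (@?a x) (@?b x)) =>
     simple eapply (sigma1_comp2 (P := fun y z => ~ P y z) (a := a) (b := b) H)
 end.
Ltac sig_eta := match goal with
 | |- @sigma1 ?T ?e ?B ?P => lazymatch P with
     | fun _ => _ => fail
     | _ => change (@sigma1 T e B (fun x => P x))
     end
 end.
Ltac sig_step := first
 [ assumption
 | sig_eta
 | sig_hyp
 | simple eapply sigma1_const
 | simple eapply sigma1_dec
 | sig_extra
 | simple eapply sigma1_and
 | simple eapply sigma1_or
 | simple eapply sigma1_ex2
 | simple eapply sigma1_ex
 | simple eapply sigma1_all_lt
 | simple eapply sigma1_all
 | simple eapply sigma1_base
 | comp_step ].
Ltac sig_tac := repeat (cbv beta; sig_step).

Lemma sigma1_trans {T} {eT : Enc T} (B C : set nat) (P : T -> Prop) :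
  sigma1 B C -> sigma1 C P -> sigma1 B P.
Proof.
move=> HC [r [u [Hr Hu HP]]]; apply: sigma1_ext => [x|]; first by symmetry; exact: HP.
by sig_tac.
Qed.

Lemma sigma1_set0 {T} {eT : Enc T} (B : set nat) (P : T -> Prop) :
  sigma1 set0 P -> sigma1 B P.
Proof. by apply: sigma1_trans; apply: sigma1_const. Qed.

(** * A universal enumeration *)

(* A computation is certified by a finite list of triples ((e, x), y), read as
   "code e on input x has value y", each of which is justified by other members
   of the list.  The justifying triples have smaller codes or, for [Prec], a
   smaller recursion argument, so that circular justifications cannot occur. *)
Definition justified (w : seq (nat * nat * nat)) (t : nat * nat * nat) : bool :=
  let e := t.1.1 in let x := t.1.2 in let y := t.2 in
  let d := (e - 4) %/ 4 in let f := nfst d in let g := nsnd d in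
  if e == 0 then y == 0
  else if e == 1 then y == x.+1
  else if e == 2 then y == nfst x
  else if e == 3 then y == nsnd x
  else if e == 4 * d + 4 then
    has (fun a => (a.1 == (f, x)) &&
      has (fun b => (b.1 == (g, x)) && (y == npair a.2 b.2)) w) w
  else if e == 4 * d + 5 then
    has (fun a => (a.1 == (g, x)) && ((f, a.2, y) \in w)) w
  else if e == 4 * d + 6 then
    if nsnd x == 0 then (f, nfst x, y) \in w
    else has (fun a => (a.1 == (e, npair (nfst x) (nsnd x).-1)) &&
      ((g, npair (nfst x) (npair (nsnd x).-1 a.2), y) \in w)) w
  else ((d, npair x y, 0) \in w) &&
    all (fun m => has (fun a => (a.1 == (d, npair x m)) && (0 < a.2)) w)
      (iota 0 y).

Lemma computable_justified :
  computable (fun p : seq (nat * nat * nat) * (nat * nat * nat) =>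
                justified p.1 p.2).
Proof.
rewrite /justified.
comp_tac.
Qed.

Section Justified.
Variable w : seq (nat * nat * nat).

Lemma justified_Pair f g x y : justified w (encode (Pair f g), x, y) =
  has (fun a => (a.1 == (encode f, x)) &&
    has (fun b => (b.1 == (encode g, x)) && (y == npair a.2 b.2)) w) w.
Proof.
rewrite /justified /=; set n := npair _ _.
have -> : (4 * n + 4 - 4) %/ 4 = n by lia.
do 4 (rewrite ifF; last by apply/eqP; lia).
by rewrite eqxx /n nfst_npair nsnd_npair.
Qed.

Lemma justified_Comp f g x y : justified w (encode (Comp f g), x, y) =
  has (fun a => (a.1 == (encode g, x)) && ((encode f, a.2, y) \in w)) w.
Proof.
rewrite /justified /=; set n := npair _ _.
have -> : (4 * n + 5 - 4) %/ 4 = n by lia.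
do 5 (rewrite ifF; last by apply/eqP; lia).
by rewrite eqxx /n nfst_npair nsnd_npair.
Qed.

Lemma justified_Prec f g x y : justified w (encode (Prec f g), x, y) =
  if nsnd x == 0 then (encode f, nfst x, y) \in w
  else has (fun a =>
    (a.1 == (encode (Prec f g), npair (nfst x) (nsnd x).-1)) &&
    ((encode g, npair (nfst x) (npair (nsnd x).-1 a.2), y) \in w)) w.
Proof.
rewrite /justified /=; set n := npair _ (encode g).
have -> : (4 * n + 6 - 4) %/ 4 = n by lia.
do 6 (rewrite ifF; last by apply/eqP; lia).
by rewrite eqxx /n nfst_npair nsnd_npair.
Qed.

Lemma justified_Mu f x y : justified w (encode (Mu f), x, y) =
  ((encode f, npair x y, 0) \in w) &&
    all (fun m => has (fun a => (a.1 == (encode f, npair x m)) && (0 < a.2)) w)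
      (iota 0 y).
Proof.
rewrite /justified /=; set n := encode f.
have -> : (4 * n + 7 - 4) %/ 4 = n by lia.
by do 7 (rewrite ifF; last by apply/eqP; lia).
Qed.

Lemma justified_sound : all (justified w) w ->
  forall c x y, (encode c, x, y) \in w -> eval c x y.
Proof.
move=> /allP Hw; elim=> [||||f IHf g IHg|f IHf g IHg|f IHf g IHg|f IHf] x y Hin;
  have := Hw _ Hin.
- by move=> /eqP.
- by move=> /eqP.
- by move=> /eqP.
- by move=> /eqP.
- rewrite justified_Pair => /hasP[[a1 a2] Ha /= /andP[/eqP Ea]].
  move=> /hasP[[b1 b2] Hb /= /andP[/eqP Eb /eqP ->]]; subst.
  by exists a2, b2; split; [exact: IHf | exact: IHg |].
- rewrite justified_Comp => /hasP[[a1 a2] Ha /= /andP[/eqP Ea Hb]]; subst.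
  by exists a2; [exact: IHg | exact: IHf].
- move=> _; rewrite -(npairK x) in Hin *.
  move: (nfst x) (nsnd x) Hin => a n; rewrite {x}.
  move=> Hin; rewrite /= nfst_npair nsnd_npair.
  elim: n y Hin => [|n IHn] y Hin; have := Hw _ Hin; rewrite justified_Prec;
    rewrite nfst_npair nsnd_npair /=; first exact: IHf.
  move=> /hasP[[b1 b2] Hb /= /andP[/eqP Eb Hc]]; subst.
  by exists b2; [exact: IHn | exact: IHg].
- rewrite justified_Mu => /andP[H0 /allP Hm]; split; first exact: IHf.
  move=> m Hmy; have := Hm m; rewrite mem_iota /= Hmy => /(_ isT).
  move=> /hasP[[a1 [|k]] Ha /= /andP[/eqP Ea]] // _; subst.
  by exists k; apply: IHf.
Qed.
End Justified.

(** The list occurs only positively in [justified]: every clause asks for the presence of triples.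
    Hence certificates can be concatenated. *)
Lemma justified_sub w w' t :
  {subset w <= w'} -> justified w t -> justified w' t.
Proof.
move=> ww'; have Hhas (p q : pred (nat * nat * nat)) :
    (forall a, p a -> q a) -> has p w -> has q w'.
  by move=> pq /hasP[a /ww' Ha /pq Hqa]; apply/hasP; exists a.
rewrite /justified; do 4 case: ifP => // _.
case: ifP => _.
  by apply: (Hhas) => a /andP[-> /=]; apply: (Hhas) => b.
case: ifP => _; first by apply: Hhas => a /andP[-> /ww'].
case: ifP => _.
  by case: ifP => _; [exact: ww' | apply: Hhas => a /andP[-> /ww']].
move=> /andP[/ww' -> /allP Hall]; apply/allP => m /Hall.
exact: Hhas.
Qed.

Definition certificate (w : seq (nat * nat * nat)) := all (justified w) w.

Lemma certificate_cat w w' :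
  certificate w -> certificate w' -> certificate (w ++ w').
Proof.
move=> Hw Hw'; rewrite /certificate all_cat; apply/andP; split.
  by apply: sub_all Hw => t; apply: justified_sub => a; rewrite mem_cat => ->.
by apply: sub_all Hw' => t; apply: justified_sub => a; rewrite mem_cat orbC => ->.
Qed.

Lemma certificate_cons w t :
  certificate w -> justified w t -> certificate (t :: w).
Proof.
move=> Hw Ht; have sub : {subset w <= t :: w} by move=> a; rewrite inE orbC => ->.
apply/andP; split; first exact: justified_sub Ht.
by apply: sub_all Hw => a; apply: justified_sub.
Qed.

Lemma justified_complete c x y : eval c x y ->
  exists2 w, certificate w & (encode c, x, y) \in w.
Proof.
have wrap w t : certificate w -> justified w t ->
    exists2 w', certificate w' & t \in w'.
  by move=> Hw Ht; exists (t :: w); [exact: certificate_cons | rewrite mem_head].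
elim: c x y => [||||f IHf g IHg|f IHf g IHg|f IHf g IHg|f IHf] x y /=.
- by move=> ->; apply: (wrap [::]).
- by move=> ->; apply: (wrap [::]) => //=; rewrite /justified /= eqxx.
- by move=> ->; apply: (wrap [::]) => //=; rewrite /justified /= eqxx.
- by move=> ->; apply: (wrap [::]) => //=; rewrite /justified /= eqxx.
- move=> [a [b [/IHf[w Hw Ha] /IHg[w' Hw' Hb] ->]]].
  apply: (wrap (w ++ w')); first exact: certificate_cat.
  rewrite justified_Pair; apply/hasP; exists (encode f, x, a).
    by rewrite mem_cat Ha.
  rewrite eqxx; apply/hasP; exists (encode g, x, b); last by rewrite !eqxx.
  by rewrite mem_cat Hb orbT.
- move=> [z /IHg[w Hw Ha] /IHf[w' Hw' Hb]].
  apply: (wrap (w ++ w')); first exact: certificate_cat.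
  rewrite justified_Comp; apply/hasP; exists (encode g, x, z).
    by rewrite mem_cat Ha.
  by rewrite eqxx /= mem_cat Hb orbT.
- rewrite -{3}(npairK x); move: (nfst x) (nsnd x) => a n.
  elim: n y => [|n IHn] y /=.
    move=> /IHf[w Hw Ha]; apply: (wrap w) => //.
    by rewrite justified_Prec nfst_npair nsnd_npair.
  move=> [z /IHn[w Hw Ha] /IHg[w' Hw' Hb]].
  apply: (wrap (w ++ w')); first exact: certificate_cat.
  rewrite justified_Prec nfst_npair nsnd_npair /=.
  apply/hasP; exists (encode (Prec f g), npair a n, z).
    by rewrite mem_cat Ha.
  by rewrite eqxx /= mem_cat Hb orbT.
- move=> [/IHf[w0 Hw0 H0] Hlt].
  have [w [Hw Hm]] : exists w, certificate w /\ forall m, m < y ->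
      exists k, (encode f, npair x m, k.+1) \in w.
    elim: y Hlt {w0 Hw0 H0} => [|y IHy] Hlt; first by exists [::].
    have [m lt_m|w [Hw Hm]] := IHy; first by apply: Hlt; lia.
    have [k /IHf[w' Hw' Hk]] := Hlt y (ltnSn y).
    exists (w ++ w'); split; first exact: certificate_cat.
    move=> m; rewrite ltnS leq_eqVlt => /orP[/eqP ->|/Hm[k' Hk']].
      by exists k; rewrite mem_cat Hk orbT.
    by exists k'; rewrite mem_cat Hk'.
  apply: (wrap (w0 ++ w)); first exact: certificate_cat.
  rewrite justified_Mu mem_cat H0 /=; apply/allP => m; rewrite mem_iota /= => /Hm[k Hk].
  by apply/hasP; exists (encode f, npair x m, k.+1); rewrite ?eqxx ?mem_cat ?Hk ?orbT.
Qed.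

(** Any number in a certificate can thus be read back as a code, so enumerating [W e] requires no
    test whether [e] is one. *)
Lemma encode_surj e : exists c, encode c = e.
Proof.
elim/ltn_ind: e => -[|[|[|[|e]]]] IH; first by exists Zero.
- by exists Succ.
- by exists Fst.
- by exists Snd.
pose d := e %/ 4.
have [f Hf] := IH (nfst d) ltac:(by have := nfst_le d; lia).
have [g Hg] := IH (nsnd d) ltac:(by have := nsnd_le d; lia).
have [h Hh] := IH d ltac:(lia).
have : e %% 4 < 4 by rewrite ltn_mod.
have := divn_eq e 4; rewrite -/d; case: (e %% 4) => [|[|[|[|//]]]] He _.
- by exists (Pair f g); rewrite /= Hf Hg npairK; lia.
- by exists (Comp f g); rewrite /= Hf Hg npairK; lia.
- by exists (Prec f g); rewrite /= Hf Hg npairK; lia.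
- by exists (Mu h); rewrite /= Hh; lia.
Qed.

Lemma W_sigma1 B : sigma1 B (fun p : nat * nat => W p.1 p.2).
Proof.
have Hj := computable_justified.
apply: (@sigma1_intro _ _ _ (seq (nat * nat * nat) * nat)%type _
  (fun p => all (justified p.2.1) p.2.1 && ((p.1.1, p.1.2, p.2.2) \in p.2.1))
  (fun=> [::])); try by comp_tac.
move=> [e x] /=; split=> [[c <- [y /justified_complete[w Hw Hin]]]|].
  by exists (w, y); rewrite //= -/(certificate w) Hw.
have [c Hc] := encode_surj e; rewrite -{}Hc.
move=> [[w y] /= /andP[Hw Hin] _]; exists c => //.
by exists y; apply: justified_sound Hin.
Qed.

(** * Enumeration reducibility and the jump *)

Definition canon_seq (u : nat) : seq nat :=
  [seq x <- iota 0 u | odd (u %/ 2 ^ x)].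

Lemma mem_canon_seq u x : x \in canon_seq u = odd (u %/ 2 ^ x).
Proof.
rewrite mem_filter mem_iota /= add0n; case: ltnP; rewrite ?andbT ?andbF // => le_ux.
by rewrite divn_small //; apply: leq_ltn_trans le_ux (ltn_expl _ _).
Qed.

Lemma computable_canon_seq T {eT : Enc T} (f : T -> nat) :
  computable f -> computable (fun x => canon_seq (f x)).
Proof.
move=> Hf; have H : computable (fun p : nat * nat => odd (p.1 %/ 2 ^ p.2)).
  apply: computable_odd; apply: computable_divn => [p||]; last by comp_tac.
    by rewrite expn_gt0.
  by comp_tac.
rewrite /canon_seq; apply: computable_filter; last by comp_tac.
by apply: (computable_comp (f := fun p : T * nat => (f p.1, p.2)) H); comp_tac.
Qed.

Lemma canon_subsetP u (B : set nat) :
  (canon_set u `<=` B)%classic <-> forall y, y \in canon_seq u -> B y.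
Proof.
split=> H y; first by rewrite mem_canon_seq => /H.
by move=> Hy; apply: H; rewrite mem_canon_seq.
Qed.

Lemma canon_ex (l : seq nat) : exists u, forall y, canon_set u y <-> y \in l.
Proof.
elim: l => [|x l [u Hu]].
  by exists 0 => y; rewrite /canon_set /= div0n.
have [Hx|Hx] := boolP (odd (u %/ 2 ^ x)).
  exists u => y; rewrite Hu inE; split=> [->|/orP[/eqP ->|//]]; first by rewrite orbT.
  by apply/Hu.
(* Digit x of u is 0 here, so the addition changes this digit without any carry. *)
exists (u + 2 ^ x) => y; rewrite inE.
have -> : canon_set (u + 2 ^ x) y <-> (y == x) || odd (u %/ 2 ^ y).
  rewrite /canon_set /=; case: (ltngtP y x) => [lt_yx|lt_xy|->] /=.
  - rewrite divnDr; last by rewrite dvdn_exp2l // ltnW.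
    have -> : 2 ^ x %/ 2 ^ y = 2 * 2 ^ (x - y).-1.
      have -> : x = y + (x - y).-1.+1 by lia.
      by rewrite expnD mulKn ?expn_gt0 // addKn expnS.
    by rewrite oddD oddM addbF.
  - suff -> : (u + 2 ^ x) %/ 2 ^ y = u %/ 2 ^ y by [].
    have -> : y = x + (y - x).-1.+1 by lia.
    rewrite expnD !divnMA divnDr ?dvdnn // divnn expn_gt0 expnS !divnMA.
    congr (_ %/ _); rewrite !divn2; move: (u %/ 2 ^ x) Hx => v Hv.
    by rewrite halfD (negbTE Hv) /= add0n addn0.
  - by rewrite divnDr ?dvdnn // divnn expn_gt0 oddD (negbTE Hx).
by split=> /orP[->//|H]; apply/orP; right; apply/Hu.
Qed.

Lemma ce_sigma1 (G : set nat) : ce G <-> sigma1 set0 G.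
Proof.
split=> [[c ->]|[r [u [Hr Hu HG]]]].
  by rewrite -W_encode; have H := W_sigma1 set0; sig_tac.
(* Over the empty set an axiom applies exactly when its finite set is empty. The value 0 signals
   such an n because [Mu] searches for a zero. *)
have [c Hc] : computable (fun p : nat * nat =>
    if r p && (size (u p) == 0) then 0 else 1) by comp_tac.
have {}Hc x y : eval c (npair x y) (if r (x, y) && (size (u (x, y)) == 0) then 0 else 1).
  exact: (Hc (x, y)).
have eval_fun d : forall x y y', eval d x y -> eval d x y' -> y = y'.
  elim: d => [||||f IHf g IHg|f IHf g IHg|f IHf g IHg|f IHf] x y y' /=; try by move=> -> ->.
  - move=> [a [b [Ha Hb ->]]] [a' [b' [Ha' Hb' ->]]].
    by rewrite (IHf _ _ _ Ha Ha') (IHg _ _ _ Hb Hb').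
  - by move=> [z Hz Hy] [z' Hz' Hy']; move: Hy; rewrite (IHg _ _ _ Hz Hz') => /IHf; apply.
  - elim: (nsnd x) y y' => [|n IHn] y y' /=; first exact: IHf.
    by move=> [z Hz Hy] [z' Hz' Hy']; move: Hy; rewrite (IHn _ _ Hz Hz') => /IHg; apply.
  - move=> [H0 Hlt] [H0' Hlt']; case: (ltngtP y y') => // lt_yy.
      by have [k /IHf /(_ H0)] := Hlt' _ lt_yy.
    by have [k /IHf /(_ H0')] := Hlt _ lt_yy.
exists (Mu c); apply/seteqP; split=> x /=.
  move=> /HG Hx.
  have Hex : exists n, r (x, n) && (size (u (x, n)) == 0).
    case: Hx => n Hn Hun; exists n; rewrite Hn size_eq0 /=; apply/eqP.
    by case: (u (x, n)) Hun => // y l /(_ y (mem_head _ _)).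
  exists (ex_minn Hex); case: ex_minnP => n Hn Hmin /=; split.
    by have := Hc x n; rewrite Hn.
  move=> m lt_mn; exists 0; have := Hc x m; case: ifP => // Hm.
  by have := Hmin _ Hm; lia.
move=> [n [H0 _]]; apply/HG; exists n.
  by have := eval_fun _ _ _ _ (Hc x n) H0; case: ifP => // /andP[].
have := eval_fun _ _ _ _ (Hc x n) H0; case: ifP => // /andP[_].
by rewrite size_eq0 => /eqP -> .
Qed.

Lemma sigma1_eopW {T} {eT : Enc T} (B C : set nat) (e x : T -> nat) :
  sigma1 B C -> computable e -> computable x ->
  sigma1 B (fun t => eop (W (e t)) C (x t)).
Proof.
move=> HC He Hx; have HW := W_sigma1 B.
apply: (sigma1_ext (P := fun t => exists2 u, W (e t) (npair (x t) u) &
    forall y, y \in canon_seq u -> C y)).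
  by move=> t; split=> -[u H1 /canon_subsetP H2]; exists u.
apply: sigma1_ex2; first by sig_tac.
apply: sigma1_all; first by sig_tac.
by apply: computable_canon_seq; comp_tac.
Qed.

Lemma eleP (A B : set nat) : A <=e B <-> sigma1 B A.
Proof.
split=> [[G [c ->] ->]|[r [u [Hr Hu HA]]]].
  by rewrite -W_encode; apply: sigma1_eopW; sig_tac; apply: sigma1_base; comp_tac.
exists (fun z => exists n, r (nfst z, n) &&
          all (fun y => y \in canon_seq (nsnd z)) (u (nfst z, n))).
  have Hcs : computable canon_seq by apply: computable_canon_seq; comp_tac.
  by apply/ce_sigma1; sig_tac.
apply/seteqP; split=> x; rewrite /eop /=.
  move=> /HA[n Hn Hun]; have [v Hv] := canon_ex (u (x, n)).
  exists v; last by move=> y /Hv /Hun.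
  exists n; rewrite nfst_npair nsnd_npair Hn /=.
  by apply/allP => y /Hv; rewrite mem_canon_seq.
move=> [v [n]]; rewrite nfst_npair nsnd_npair => /andP[Hn /allP Hall] Hv.
apply/HA; exists n => // y /Hall; rewrite mem_canon_seq; exact: Hv.
Qed.

Lemma ele_trans A B C : A <=e B -> B <=e C -> A <=e C.
Proof. by rewrite !eleP => AB BC; apply: sigma1_trans AB. Qed.

Lemma ele_refl A : A <=e A.
Proof. by apply/eleP; apply: sigma1_base; comp_tac. Qed.

Lemma ele_eopW A B : A <=e B <-> exists e, A = eop (W e) B.
Proof.
split=> [[G [c ->] ->]|[e ->]]; first by exists (encode c); rewrite W_encode.
by apply/eleP; apply: sigma1_eopW; comp_tac; apply: sigma1_base; comp_tac.
Qed.

Lemma sigma1_joinl A B : sigma1 (join A B) A.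
Proof.
have H : sigma1 (join A B) (fun x => join A B x.*2)
  by apply: sigma1_base; comp_tac.
by apply: sigma1_ext H => x; rewrite /join /= odd_double doubleK.
Qed.

Lemma sigma1_joinr A B : sigma1 (join A B) B.
Proof.
have H : sigma1 (join A B) (fun x => join A B x.*2.+1)
  by apply: sigma1_base; comp_tac.
by apply: sigma1_ext H => x; rewrite /join /= odd_double /= uphalf_double.
Qed.

Lemma sigma1_join A B C : sigma1 C A -> sigma1 C B -> sigma1 C (join A B).
Proof.
move=> HA HB.
apply: (sigma1_ext (P := fun n => (odd n /\ B n./2) \/ (~~ odd n /\ A n./2))).
  by move=> n; rewrite /join /=; case: (odd n); split=> [[[]|[]]|] //; [left | right].
sig_tac.
Qed.

Lemma K_sigma1 X : sigma1 X (K X).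
Proof. by apply: sigma1_eopW; comp_tac; apply: sigma1_base; comp_tac. Qed.

Lemma sigma1_K {T} {eT : Enc T} X (P : T -> Prop) : sigma1 X P ->
  exists e, forall x, P x <-> K X (npair e (enc x)).
Proof.
move=> HP.
have /eleP /ele_eopW[e He] : sigma1 X (fun n => exists2 x, @enc T eT x == n & P x).
  by sig_tac.
exists e => x; rewrite /K /= nfst_npair nsnd_npair -He.
by split=> [Hx|[y /eqP Hy]]; [exists x | rewrite -(can_inj encK Hy)].
Qed.

Lemma sigma1_jump {T} {eT : Enc T} X (P : T -> Prop) :
  sigma1 X P -> sigma1 (ejump X) P.
Proof.
move=> HP; have [e He] := sigma1_K HP.
have HK : sigma1 (ejump X) (K X) := sigma1_joinl _ _.
by apply: (sigma1_ext (P := fun x => K X (npair e (enc x)))); [move=> x; rewrite He | sig_tac].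
Qed.

Lemma sigma1_jumpN {T} {eT : Enc T} X (P : T -> Prop) :
  sigma1 X P -> sigma1 (ejump X) (fun x => ~ P x).
Proof.
move=> HP; have [e He] := sigma1_K HP.
have HK : sigma1 (ejump X) (~` K X)%classic := sigma1_joinr _ _.
by apply: (sigma1_ext (P := fun x => (~` K X)%classic (npair e (enc x))));
  [move=> x; rewrite He | sig_tac].
Qed.

(** A finite query to the jump splits into positive facts about [K X], which go into [Q], and
    negative facts, whose failure is enumerable from X and goes into [R]. Applied repeatedly, this
    yields the quantifier form over a double jump. *)
Lemma ejump_normal {T} {eT : Enc T} X (P : T -> Prop) : sigma1 (ejump X) P ->
  exists Q R : T * nat -> Prop, [/\ sigma1 X Q, sigma1 X R
    & forall x, P x <-> exists n, Q (x, n) /\ ~ R (x, n)].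
Proof.
move=> [r [u [Hr Hu HP]]]; have HK := K_sigma1 X.
exists (fun p => r p /\ forall y, y \in u p -> odd y \/ K X y./2),
       (fun p => exists2 y, y \in u p & odd y /\ K X y./2).
split; [by sig_tac | by sig_tac |] => x; rewrite HP; split=> -[n].
  move=> Hn Hun; exists n; split.
    split=> // y /Hun; rewrite /ejump /join /=; case: (odd y); first by left.
    by right.
  by move=> [y /Hun]; rewrite /ejump /join /= => H [Hodd]; move: H; rewrite Hodd.
move=> [[Hn H1] H2]; exists n => // y Hy; rewrite /ejump /join /=.
case: ifP => Hodd; last by case: (H1 _ Hy); rewrite ?Hodd.
by move=> HKy; apply: H2; exists y.
Qed.

Lemma ejump_mono X Y : X <=e Y -> ejump X <=e ejump Y.
Proof.
rewrite !eleP => XY; have HK := sigma1_trans XY (K_sigma1 X).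
by apply: sigma1_join; [apply: sigma1_jump | apply: sigma1_jumpN].
Qed.

(** Otherwise the complement of the diagonal of [K X] has an index [e], and the pair (e, e) is
    contradictory. *)
Lemma sigma1_notK X : ~ sigma1 X (fun z => ~ K X z).
Proof.
move=> H; have [e He] : exists e, forall x, ~ K X (npair x x) <-> K X (npair e (enc x)).
  apply: sigma1_K; apply: (sigma1_comp (f := fun x => npair x x) H).
  by comp_tac.
by have := He e; rewrite /=; tauto.
Qed.

(** * Good approximations of Sigma^0_2 sets *)

Lemma sigma1_stage {T} {eT : Enc T} (P : T -> Prop) : sigma1 set0 P ->
  exists p : T -> nat -> bool, [/\ computable (fun q : T * nat => p q.1 q.2),
    (forall x s t, s <= t -> p x s -> p x t) & forall x, P x <-> exists s, p x s].
Proof.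
move=> [r [u [Hr Hu HP]]].
exists (fun x s => has (fun n => r (x, n) && (size (u (x, n)) == 0)) (iota 0 s)).
split; first by comp_tac.
  move=> x s t le_st /hasP[n]; rewrite mem_iota /= add0n => lt_ns Hn.
  by apply/hasP; exists n => //; rewrite mem_iota /= add0n (leq_trans lt_ns).
move=> x; rewrite HP; split=> [[n Hn Hun]|[s /hasP[n _ /andP[Hn Hun]]]]; last first.
  by exists n => //; move: Hun; rewrite size_eq0 => /eqP ->.
exists n.+1; apply/hasP; exists n; first by rewrite mem_iota /= add0n.
by rewrite Hn; case: (u (x, n)) Hun => // y l /(_ y (mem_head _ _)).
Qed.

Definition good (Y : set nat) (Ys : nat -> seq nat) (s : nat) : Prop :=
  forall y, y \in Ys s -> Y y.

(** A good approximation: a true element is eventually present at every stage, whereas false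
    elements are guaranteed to be absent only at the infinitely many good stages. *)
Definition good_approx (Y : set nat) (Ys : nat -> seq nat) : Prop :=
  [/\ computable Ys,
    (forall y, Y y -> exists s0, forall s, s0 <= s -> y \in Ys s)
  & forall s0, exists2 s, s0 <= s & good Y Ys s].

Lemma find_gt {T} (x0 : T) (p : pred T) (l : seq T) i :
  i < size l -> (forall k, k <= i -> ~~ p (nth x0 l k)) -> i < find p l.
Proof.
move=> lt_i Hp; rewrite ltnNge; apply/negP => le_i.
have := Hp _ le_i; rewrite nth_find // has_find.
exact: leq_ltn_trans lt_i.
Qed.

(* The stages at which no smaller element enters K later on are the true
   stages of the enumeration of K. *)
Lemma jump0_approx : exists Js, good_approx (ejump set0) Js.
Proof.
have [k [Hk kmono kP]] := sigma1_stage (K_sigma1 set0).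
(* The least number below s that enters K at stage [s.+1], with default s. *)
pose a s := find (fun x => k x s.+1 && ~~ k x s) (iota 0 s).
have Ha : computable a by rewrite /a; comp_tac.
have a_le s : a s <= s by rewrite -{2}(size_iota 0 s) find_size.
(* Even positions record what has entered K. Odd positions claim non-membership only below [a s],
   where stage [s.+1] brings no new element. *)
pose J s := [seq y <- iota 0 s.*2 |
  if odd y then (y./2 < a s) && ~~ k y./2 s else k y./2 s].
exists J; split; first by rewrite /J; comp_tac.
- move=> y; rewrite /ejump /join /=; case: ifP => Hodd Hy; last first.
    have [s Hs] := (kP y./2).1 Hy.
    exists (s + y.+1) => t le_t; rewrite mem_filter Hodd mem_iota /=.
    by rewrite (kmono _ _ _ _ Hs) ?(leq_trans (leq_addr _ _) le_t) //; lia.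
  have [s0 Hs0] : exists s0, forall s, s0 <= s -> y./2 < a s.
    have [s1 Hs1] : exists s1, forall s, s1 <= s -> forall x, x <= y./2 ->
        k x s.+1 -> k x s.
      elim: (y./2) => [|n [s1 Hs1]].
        have [[s Hs]|Hn] := pselect (exists s, k 0 s).
          by exists s => t le_t x; rewrite leqn0 => /eqP -> _; apply: kmono Hs.
        by exists 0 => t _ x; rewrite leqn0 => /eqP -> Hx; case: Hn; exists t.+1.
      have [[s Hs]|Hn] := pselect (exists s, k n.+1 s).
        exists (s1 + s) => t le_t x; rewrite leq_eqVlt => /orP[/eqP ->|lt_x].
          by move=> _; apply: kmono Hs; lia.
        by apply: Hs1; lia.
      exists s1 => t le_t x; rewrite leq_eqVlt => /orP[/eqP -> Hx|lt_x].
        by case: Hn; exists t.+1.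
      by apply: Hs1; lia.
    exists (s1 + y./2.+1) => s le_s; apply: (@find_gt _ 0); first by rewrite size_iota; lia.
    move=> i le_i; rewrite nth_iota; last by lia.
    rewrite add0n; apply/negP => /andP[H1 /negP]; apply.
    by apply: Hs1 H1 => //; lia.
  exists (s0 + y.+1) => t le_t; rewrite mem_filter Hodd mem_iota /=.
  rewrite Hs0; last by lia.
  apply/andP; split; last by lia.
  by apply/negP => Ht; apply: Hy; apply/kP; exists t.
- move=> s0.
  (* A stage where [a] attains its minimum over all stages from [s0] on is good: a number below that
     minimum entering later would make [a] smaller still. *)
  have Hex : exists v, `[< exists2 s, s0 <= s & a s = v >].
    by exists (a s0); apply/asboolP; exists s0.
  case: (ex_minnP Hex) => v /asboolP[s le_s Hv] Hmin.
  exists s => // y; rewrite mem_filter => /andP[Hy _].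
  rewrite /ejump /join /=; case: ifP Hy => Hodd; last by move=> Hy; apply/kP; exists s.
  move=> /andP[lt_y Hky] /kP[t Ht].
  have [t' [le_t' Ht1 Ht2]] : exists t', [/\ s <= t', k y./2 t'.+1 & ~~ k y./2 t'].
    have le_st : s <= t.
      by rewrite leqNgt; apply/negP => lt_ts; case/negP: Hky; apply: kmono Ht; lia.
    rewrite -(subnKC le_st) in Ht; elim: (t - s) Ht => [|d IHd].
      by rewrite addn0 => Ht; case/negP: Hky.
    rewrite addnS => Ht; have [/IHd//|Hd] := boolP (k y./2 (s + d)).
    by exists (s + d); split=> //; lia.
  have : a t' <= y./2.
    rewrite leqNgt; apply/negP => lt_a; have := before_find 0 lt_a.
    by rewrite nth_iota ?add0n ?Ht1 ?Ht2 //; have := a_le s; lia.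
  have : v <= a t' by apply: Hmin; apply/asboolP; exists t' => //; lia.
  by lia.
Qed.

Section Approx.
Variables (Y : set nat) (Ys : nat -> seq nat).
Hypothesis HY : good_approx Y Ys.

Lemma computable_approx : computable Ys. Proof. by case: HY. Qed.

Lemma approx_seq (l : seq nat) : (forall y, y \in l -> Y y) ->
  exists s0, forall s, s0 <= s -> forall y, y \in l -> y \in Ys s.
Proof.
case: HY => _ H _; elim: l => [|z l IHl] Hl; first by exists 0.
have [y Hy|s1 Hs1] := IHl; first by apply: Hl; rewrite inE Hy orbT.
have [s2 Hs2] := H z (Hl _ (mem_head _ _)).
exists (s1 + s2) => s le_s y; rewrite inE => /orP[/eqP ->|Hy].
  by apply: Hs2; lia.
by apply: Hs1 => //; lia.
Qed.

Lemma sigma1_approx {T} {eT : Enc T} (P : T -> Prop) : sigma1 Y P ->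
  exists p : T -> nat -> bool, [/\ computable (fun q : T * nat => p q.1 q.2),
    (forall x, P x -> exists s0, forall s, s0 <= s -> p x s)
  & forall x s, good Y Ys s -> p x s -> P x].
Proof.
move=> [r [u [Hr Hu HP]]]; have HYs := computable_approx.
exists (fun x s => has (fun n => r (x, n) &&
  all (fun y => y \in Ys s) (u (x, n))) (iota 0 s)).
split; first by comp_tac.
  move=> x /HP[n Hn Hun]; have [s0 Hs0] := approx_seq Hun.
  exists (s0 + n.+1) => s le_s; apply/hasP; exists n.
    by rewrite mem_iota; lia.
  by rewrite Hn /=; apply/allP => y Hy; apply: Hs0 => //; lia.
move=> x s Hs /hasP[n _ /andP[Hn /allP Hun]]; apply/HP; exists n => // y Hy.
by apply: Hs; apply: Hun.
Qed.

(** Convergence to infinity along the good stages; values at other stages are arbitrary. *)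
Definition full (m : nat -> nat) : Prop :=
  forall b, exists s0, forall s, s0 <= s -> good Y Ys s -> b <= m s.

Definition bounded (m : nat -> nat) : Prop :=
  exists b, forall s, good Y Ys s -> m s <= b.

Lemma full_not_bounded m : full m -> bounded m -> False.
Proof.
move=> Hf [b Hb]; have [s0 Hs0] := Hf b.+1.
case: HY => _ _ /(_ s0)[s le_s Hs].
by have := Hs0 s le_s Hs; have := Hb s Hs; lia.
Qed.

Lemma eventually_bounded m b s0 : (forall s, m s <= s) ->
  (forall s, s0 <= s -> good Y Ys s -> m s <= b) -> bounded m.
Proof.
move=> Hm Hb; exists (s0 + b) => s Hs; case: (leqP s0 s) => [/Hb /(_ Hs)|lt_s].
  by lia.
by have := Hm s; lia.
Qed.

(** In normal form, P x asks for an n such that some n' has [Q1] without [Q2], while no v has [R1]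
    without [R2]. The number u codes n and n'. [m x u s] is the least v that looks like a
    counterexample to the second half at stage s, and it drops to 0 whenever the first half looks
    false. *)
Lemma sigma3_approx {T} {eT : Enc T} (P : T -> Prop) :
  sigma1 (ejump (ejump Y)) P ->
  exists m : T -> nat -> nat -> nat,
    [/\ computable (fun q : T * nat * nat => m q.1.1 q.1.2 q.2),
        forall x u, full (m x u) \/ bounded (m x u)
      & forall x, P x <-> exists u, full (m x u)].
Proof.
move=> /ejump_normal[Q [R [/ejump_normal[Q1 [Q2 [HQ1 HQ2 HQ]]]
  /ejump_normal[R1 [R2 [HR1 HR2 HR]]] HP]]].
have [q1 [Hq1 q1T q1F]] := sigma1_approx HQ1.
have [q2 [Hq2 q2T q2F]] := sigma1_approx HQ2.
have [r1 [Hr1 r1T r1F]] := sigma1_approx HR1.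
have [r2 [Hr2 r2T r2F]] := sigma1_approx HR2.
pose w x u s := find (fun v => r1 ((x, nfst u), v) s && ~~ r2 ((x, nfst u), v) s)
                     (iota 0 s).
have w_le x u s : w x u s <= s by rewrite -{2}(size_iota 0 s) find_size.
pose m x u s := if q1 ((x, nfst u), nsnd u) s && ~~ q2 ((x, nfst u), nsnd u) s
  then w x u s else 0.
have m_le x u s : m x u s <= s by rewrite /m; case: ifP.
pose G x u := [/\ Q1 ((x, nfst u), nsnd u), ~ Q2 ((x, nfst u), nsnd u)
                & ~ R (x, nfst u)].
have GP x : P x <-> exists u, G x u.
  rewrite HP; split=> [[n [/HQ[n' [H1 H2]] H3]]|[u [H1 H2 H3]]].
    by exists (npair n n'); rewrite /G nfst_npair nsnd_npair.
  by exists (nfst u); split=> //; apply/HQ; exists (nsnd u).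
have Gfull x u : G x u -> full (m x u).
  move=> [/q1T[s1 Hs1] H2 H3] b.
  have [s2 Hs2] : exists s2, forall s, s2 <= s -> good Y Ys s -> b <= w x u s.
    have [s2 Hs2] : exists s2, forall s, s2 <= s -> good Y Ys s -> forall v, v < b ->
        ~~ (r1 ((x, nfst u), v) s && ~~ r2 ((x, nfst u), v) s).
      elim: b => [|b [s2 Hs2]]; first by exists 0.
      have [/r2T[s3 Hs3]|nR2] := pselect (R2 ((x, nfst u), b)).
        exists (s2 + s3) => s le_s Hs v; rewrite ltnS leq_eqVlt => /orP[/eqP ->|lt_v].
          by rewrite (Hs3 s) ?andbF //; lia.
        by apply: Hs2 => //; lia.
      exists s2 => s le_s Hs v; rewrite ltnS leq_eqVlt => /orP[/eqP ->|lt_v]; last exact: Hs2.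
      apply/negP => /andP[/(r1F _ _ Hs) HR1b _]; apply: H3; apply/HR.
      by exists b.
    exists (s2 + b) => s le_s Hs; case: b Hs2 le_s => [//|b] Hs2 le_s.
    apply: (@find_gt _ 0); first by rewrite size_iota; lia.
    move=> k le_k; rewrite nth_iota ?add0n; last by lia.
    by apply: Hs2 => //; lia.
  exists (s1 + s2) => s le_s Hs; rewrite /m Hs1 ?Hs2 //=; try lia.
  rewrite ifT; first by apply: Hs2 => //; lia.
  by apply/negP => /(q2F _ _ Hs).
have nGbounded x u : ~ G x u -> bounded (m x u).
  move=> nG; have [H1|H1] := pselect (Q1 ((x, nfst u), nsnd u)); last first.
    exists 0 => s Hs; rewrite /m; case: ifP => // /andP[/(q1F _ _ Hs)].
    by [].
  have [/q2T[s0 Hs0]|H2] := pselect (Q2 ((x, nfst u), nsnd u)).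
    by apply: (@eventually_bounded _ 0 s0) => // s le_s Hs; rewrite /m Hs0 ?andbF.
  have [/HR[v [/r1T[s0 Hs0] Hv]]|H3] := pselect (R (x, nfst u)); last by case: nG.
  apply: (@eventually_bounded _ v (s0 + v.+1)) => // s le_s Hs.
  rewrite /m; case: ifP => // _; rewrite leqNgt; apply/negP => lt_v.
  have := before_find 0 lt_v; rewrite nth_iota ?add0n; last by lia.
  rewrite Hs0 /=; last by lia.
  by move=> /negbT; rewrite negbK => /(r2F _ _ Hs).
exists m; split; first by rewrite /m /w; comp_tac.
  by move=> x u; have [/Gfull|/nGbounded] := pselect (G x u); [left | right].
move=> x; rewrite GP; split=> -[u Hu]; exists u; first exact: Gfull.
by apply: contrapT => /nGbounded; apply: full_not_bounded.
Qed.
End Approx.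

(** Good stages are inherited: at a stage good for 0', only elements of Y are enumerated by the
    axioms for Y. *)
Lemma sigma2_approx Y : sigma2 Y -> exists Ys, good_approx Y Ys.
Proof.
move=> /eleP HY; have [Js HJ] := jump0_approx.
have [p [Hp pT pF]] := sigma1_approx HJ HY.
exists (fun s => [seq y <- iota 0 s | p y s]); split; first by comp_tac.
  move=> y /pT[s0 Hs0]; exists (s0 + y.+1) => s le_s.
  by rewrite mem_filter mem_iota Hs0 /=; lia.
case: HJ => _ _ Hgood s0; have [s le_s Hs] := Hgood s0.
by exists s => // y; rewrite mem_filter => /andP[/(pF _ _ Hs)].
Qed.

(** * Upper bounds of ideals below a high_2 set *)

Definition eop_sum (D : seq nat) (A : set nat) : set nat :=
  fun z => nfst z \in D /\ eop (W (nfst z)) A (nsnd z).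

Section IdealBound.
Variables (Y A : set nat) (I : nat -> Prop).
Hypotheses (HY : sigma2 Y) (HA : A <=e Y).
Hypothesis HI : sigma1 (ejump (ejump Y)) I.
Hypothesis HD : forall D, (forall e, e \in D -> I e) -> ~ A <=e eop_sum D A.

(* Column (e, u) of C codes Gamma_e(A), as far as [m e u] allows.  For every j,
   the elements of the columns of index at least j which lie below the length
   of agreement of A and Gamma_j(C) are dumped into C: if A = Gamma_j(C) then
   all these columns are full, and C is a finite join of members of the ideal. *)
Lemma ideal_bound : exists C : set nat, [/\ C <=e Y, ~ A <=e C
  & forall e, I e -> eop (W e) A <=e C].
Proof.
have [Ys HYs] := sigma2_approx HY.
have cYs := computable_approx HYs.
move/eleP: HA => sA.
have [pA [cpA pAT pAF]] := sigma1_approx HYs sA.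
have sG : sigma1 Y (fun q : nat * nat => eop (W q.1) A q.2).
  by apply: sigma1_eopW => //; comp_tac.
have [pG [cpG pGT pGF]] := sigma1_approx HYs sG.
have [m [cm mD mP]] := sigma3_approx HYs HI.
have [wst [cwst wmono wP]] := sigma1_stage (W_sigma1 set0).
have cseq : computable canon_seq by apply: computable_canon_seq; comp_tac.
pose phi j x s (L : seq nat) := has (fun v => wst (j, npair x v) s &&
  all (fun y => y \in L) (canon_seq v)) (iota 0 s).
(* [h] lists what was enumerated at each stage t < s. Stage t is believed at s only if [Ys t] is
   contained in [Ys s]; when s is good, every such t is good. *)
pose Cs s (h : seq (seq nat)) := flatten [seq
  (if all (fun y => y \in Ys s) (Ys t) then nth [::] h t else [::]) | t <- iota 0 s].
pose ell j s h := find (fun x => pA x s != phi j x s (Cs s h)) (iota 0 s).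
(* An element c consists of a column (e, u) and an entry (x, i). Bounding both x and i by [m] keeps
   the column finite when [m] is bounded; the padding i supplies copies of x beyond any finite
   amount of dumping. The last disjunct dumps on behalf of each j up to the column index. *)
pose inE c s h :=
  (pG (nfst (nfst c), nfst (nsnd c)) s &&
   ((nfst (nsnd c) < m (nfst (nfst c)) (nsnd (nfst c)) s) &&
    (nsnd (nsnd c) < m (nfst (nfst c)) (nsnd (nfst c)) s)))
  || has (fun j => c < ell j s h) (iota 0 (nfst c).+1).
pose E s h := [seq c <- iota 0 s | inE c s h].
pose H s := iteri s (fun i h => rcons h (E i h)) [::].
have cCs : computable (fun q : nat * seq (seq nat) => Cs q.1 q.2).
  by rewrite /Cs; comp_tac.
have cphi : computable (fun q : nat * nat * nat * seq nat =>
    phi q.1.1.1 q.1.1.2 q.1.2 q.2).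
  by rewrite /phi; comp_tac.
have cell : computable (fun q : nat * nat * seq (seq nat) =>
    ell q.1.1 q.1.2 q.2).
  rewrite /ell; apply: computable_find; last by comp_tac.
  apply: computable_negb; apply: computable_eq; first by comp_tac.
  apply: (computable_comp (f := fun p : nat * nat * seq (seq nat) * nat =>
    (p.1.1.1, p.2, p.1.1.2, Cs p.1.1.2 p.1.2)) cphi); comp_tac.
have cinE : computable (fun q : nat * nat * seq (seq nat) =>
    inE q.1.1 q.1.2 q.2).
  by rewrite /inE; comp_tac.
have cE : computable (fun q : nat * seq (seq nat) => E q.1 q.2).
  by rewrite /E; comp_tac.
have cH : computable H by rewrite /H; comp_tac.
have sizeH s : size (H s) = s by elim: s => //= s IHs; rewrite size_rcons IHs.
have nthH s t : t < s -> nth [::] (H s) t = E t (H t).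
  elim: s => [//|s IHs]; rewrite ltnS leq_eqVlt /= nth_rcons sizeH.
  by case: ltngtP => // [/IHs//|->].
pose Et s := E s (H s); pose CC s := Cs s (H s); pose l j s := ell j s (H s).
have memEt c s : (c \in Et s) = (c < s) && inE c s (H s).
  by rewrite mem_filter mem_iota andbC.
have memCC c s : reflect (exists t, [/\ t < s, {subset Ys t <= Ys s} & c \in Et t])
    (c \in CC s).
  apply: (iffP flatten_mapP) => [[t]|[t [lt_t sub Hc]]].
    rewrite mem_iota /= => lt_t; case: ifP => // /allP sub.
    by rewrite nthH // => Hc; exists t.
  exists t; first by rewrite mem_iota.
  by rewrite ifT ?nthH //; apply/allP.
pose C : set nat := fun c => exists2 s, c \in Et s & good Y Ys s.
have CCgood s c : good Y Ys s -> c \in CC s -> C c.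
  by move=> Hs /memCC[t [_ sub Hc]]; exists t => // y /sub; exact: Hs.
have CClim c : C c -> exists s0, forall s, s0 <= s -> c \in CC s.
  move=> [t Hc Ht]; have [s0 Hs0] := approx_seq HYs Ht.
  exists (s0 + t.+1) => s le_s; apply/memCC; exists t.
  by split=> [|y|]; [lia | apply: Hs0; lia |].
have CCseq (L : seq nat) : (forall y, y \in L -> C y) ->
    exists s0, forall s, s0 <= s -> forall y, y \in L -> y \in CC s.
  elim: L => [|z L IHL] HL; first by exists 0.
  have [y Hy|s1 Hs1] := IHL; first by apply: HL; rewrite in_cons Hy orbT.
  have [s2 Hs2] := CClim z (HL _ (mem_head _ _)).
  exists (s1 + s2) => s le_s y; rewrite in_cons => /orP[/eqP ->|Hy].
    by apply: Hs2; lia.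
  by apply: Hs1 => //; lia.
have phiT j x : eop (W j) C x ->
    exists s0, forall s, s0 <= s -> phi j x s (CC s).
  move=> [v /(wP (j, npair x v))[s1 Hs1] /canon_subsetP Hv].
  have [s2 Hs2] := CCseq _ Hv.
  exists (s1 + s2 + v.+1) => s le_s; apply/hasP; exists v; first by rewrite mem_iota; lia.
  rewrite (wmono _ _ _ _ Hs1) /=; last by lia.
  by apply/allP => y Hy; apply: Hs2 => //; lia.
have phiF j x s : good Y Ys s -> phi j x s (CC s) -> eop (W j) C x.
  move=> Hs /hasP[v _ /andP[Hw /allP Hv]]; exists v.
    by apply/(wP (j, npair x v)); exists s.
  by apply/canon_subsetP => y /Hv; exact: CCgood.
have l_le j s : l j s <= s by rewrite -{2}(size_iota 0 s) find_size.
have agree j x : (A x <-> eop (W j) C x) ->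
    exists s0, forall s, s0 <= s -> good Y Ys s -> pA x s = phi j x s (CC s).
  have [Ax|nAx] := pselect (A x) => HAj.
    have [s1 Hs1] := pAT _ Ax; have [s2 Hs2] := phiT _ _ (HAj.1 Ax).
    by exists (s1 + s2) => s le_s _; rewrite Hs1 ?Hs2 //; lia.
  exists 0 => s _ Hs; apply/idP/idP => [/(pAF _ _ Hs)//|/(phiF _ _ _ Hs)].
  by move=> /HAj.
have l_full j : A = eop (W j) C -> full Y Ys (l j).
  move=> EA b.
  have [s0 Hs0] : exists s0, forall s, s0 <= s -> good Y Ys s ->
      forall x, x < b -> pA x s = phi j x s (CC s).
    elim: b => [|b [s0 Hs0]]; first by exists 0.
    have [|s1 Hs1] := agree j b; first by rewrite -EA.
    exists (s0 + s1) => s le_s Hs x; rewrite ltnS leq_eqVlt => /orP[/eqP ->|lt_x].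
      by apply: Hs1 => //; lia.
    by apply: Hs0 => //; lia.
  exists (s0 + b) => s le_s Hs; case: b Hs0 le_s => [//|b] Hs0 le_s.
  apply: (@find_gt _ 0); first by rewrite size_iota; lia.
  move=> k le_k; rewrite nth_iota ?add0n; last by lia.
  by rewrite negbK Hs0 //; lia.
have l_bounded j : A <> eop (W j) C -> bounded Y Ys (l j).
  move=> NA; have [x Hx] : exists x, ~ (A x <-> eop (W j) C x).
    apply: contrapT => Hall; apply: NA; apply/seteqP; split=> x Hx;
      by apply: contrapT => Hn; apply: Hall; exists x; tauto.
  have [s0 Hs0] : exists s0, forall s, s0 <= s -> good Y Ys s ->
      pA x s != phi j x s (CC s).
    have [Ax|nAx] := pselect (A x).
      have [s1 Hs1] := pAT _ Ax; exists s1 => s le_s Hs; rewrite Hs1 //.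
      by apply/negP => /eqP Hphi; have := phiF j x s Hs; rewrite -Hphi => /(_ isT); tauto.
    have [|s1 Hs1] := phiT j x; first by apply: contrapT; tauto.
    exists s1 => s le_s Hs; rewrite Hs1 //; apply/negP => /eqP Hp.
    by apply: nAx; apply: (pAF x s) => //; rewrite Hp.
  apply: (@eventually_bounded _ _ _ x (s0 + x.+1)) => // s le_s Hs.
  rewrite leqNgt; apply/negP => lt_x; have := before_find 0 lt_x.
  rewrite nth_iota ?add0n; last by lia.
  by rewrite Hs0 //; lia.
have l_bounded_lt j : (forall j', j' < j -> A <> eop (W j') C) ->
    exists b, forall j' s, j' < j -> good Y Ys s -> l j' s <= b.
  elim: j => [|j IHj] Hj; first by exists 0.
  have [j' lt_j|b Hb] := IHj; first by apply: Hj; lia.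
  have [b' Hb'] := l_bounded j (Hj j (ltnSn j)).
  exists (b + b') => j' s; rewrite ltnS leq_eqVlt => /orP[/eqP ->|lt_j] Hs.
    by have := Hb' s Hs; lia.
  by have := Hb j' s lt_j Hs; lia.
have Ccol col x i : full Y Ys (m (nfst col) (nsnd col)) ->
    eop (W (nfst col)) A x -> C (npair col (npair x i)).
  move=> Hfull /(pGT (nfst col, x))[s1 Hs1].
  have [s2 Hs2] := Hfull (x + i).+1.
  case: (HYs) => _ _ /(_ (s1 + s2 + (npair col (npair x i)).+1))[s le_s Hs].
  exists s => //; rewrite memEt /inE !(nfst_npair, nsnd_npair).
  have lt_m := Hs2 s ltac:(lia) Hs.
  rewrite Hs1; last by lia.
  by apply/andP; split; [lia | apply/orP; left; lia].
have Cinv c b : (forall j' s, j' < (nfst c).+1 -> good Y Ys s -> l j' s <= b) ->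
    C c -> c < b \/ exists s, [/\ good Y Ys s,
      pG (nfst (nfst c), nfst (nsnd c)) s,
      nfst (nsnd c) < m (nfst (nfst c)) (nsnd (nfst c)) s &
      nsnd (nsnd c) < m (nfst (nfst c)) (nsnd (nfst c)) s].
  move=> Hb [s]; rewrite memEt => /andP[_ /orP[/andP[Hp /andP[H1 H2]]|/hasP[j Hj lt_c]]] Hs.
    by right; exists s.
  move: Hj lt_c; rewrite mem_iota /= -/(l j s) => lt_j lt_c.
  by left; have := Hb j s lt_j Hs; lia.
(* Goodness of a stage is a finite positive condition on Y. *)
have sC : sigma1 Y C.
  have cEt : computable Et.
    by apply: (computable_comp (f := fun s => (s, H s)) cE); comp_tac.
  by rewrite /C /good; sig_tac.
(* For the least j with A = Gamma_j(C), dumping for j fills all columns from j on, while smaller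
   indices dump only finitely much. A column below j is then finite or, up to finitely many
   elements, copies some Gamma_e(A) with e in I. So C, and with it A, lies below a finite join,
   against [HD]. *)
have noj j : A <> eop (W j) C.
  elim/ltn_ind: j => j IH EA.
  have [b Hb] := l_bounded_lt j IH.
  have [L HL] : exists L : seq nat, forall c, C c -> nfst c < j ->
      c \in L \/ full Y Ys (m (nfst (nfst c)) (nsnd (nfst c))) /\
                 eop (W (nfst (nfst c))) A (nfst (nsnd c)).
    have /choice[Lc HLc] (col : nat) : exists L : seq nat, forall c, C c -> nfst c < j ->
        nfst c = col ->
        c \in L \/ full Y Ys (m (nfst (nfst c)) (nsnd (nfst c))) /\
                 eop (W (nfst (nfst c))) A (nfst (nsnd c)).
      have [Hfull|[M HM]] := mD (nfst col) (nsnd col).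
        exists (iota 0 b) => c Cc lt_c Ec; rewrite Ec; have [||] := @Cinv c b _ Cc.
        - by move=> j' s lt_j'; apply: Hb; lia.
        - by rewrite mem_iota; left.
        - by move=> [s [Hs Hp _ _]]; right; split=> //; rewrite -Ec; apply: (pGF _ _ Hs Hp).
      exists (iota 0 b ++ [seq npair col (npair x i) | x <- iota 0 M, i <- iota 0 M]).
      move=> c Cc lt_c Ec; left; rewrite mem_cat.
      have [||] := @Cinv c b _ Cc.
      - by move=> j' s lt_j'; apply: Hb; lia.
      - by rewrite mem_iota => ->.
      - move=> [s [Hs _ H1 H2]]; rewrite Ec in H1 H2.
        apply/orP; right; apply/allpairsP; exists (nfst (nsnd c), nsnd (nsnd c)).
        have := HM s Hs; split; rewrite ?mem_iota /=; try lia.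
        by rewrite -Ec !npairK.
    exists (flatten [seq Lc col | col <- iota 0 j]) => c Cc lt_c.
    have [Hc|//] := HLc (nfst c) c Cc lt_c erefl.
      by left; apply/flatten_mapP; exists (nfst c); rewrite ?mem_iota.
    by right.
  pose F := [seq col <- iota 0 j | `[< full Y Ys (m (nfst col) (nsnd col)) >]].
  pose L' := [seq c <- L | `[< C c >]].
  pose D := [seq nfst col | col <- F].
  apply: (HD (D := D)).
    move=> e /mapP[col]; rewrite mem_filter => /andP[/asboolP Hf _] ->.
    by apply/mP; exists (nsnd col).
  apply: (@ele_trans _ C); first by rewrite EA; apply/ele_eopW; exists j.
  apply/eleP; apply: (sigma1_ext (P := fun c => (j <= nfst c \/ c \in L') \/
    (nfst c \in F /\ eop_sum D A (npair (nfst (nfst c)) (nfst (nsnd c)))))); last first.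
    by sig_tac.
  move=> c; split.
    move=> [[le_j|]|].
    - have [s0 Hs0] := l_full j EA c.+1.
      case: (HYs) => _ _ /(_ (s0 + c.+1))[s le_s Hs]; exists s => //.
      rewrite memEt; apply/andP; split; first by lia.
      apply/orP; right; apply/hasP; exists j; first by rewrite mem_iota; lia.
      by apply: Hs0 => //; lia.
    - by rewrite mem_filter => /andP[/asboolP].
    - move=> [Hin [_]]; rewrite nfst_npair nsnd_npair => HG.
      rewrite -(npairK c) -(npairK (nsnd c)); apply: Ccol => //.
      by move: Hin; rewrite mem_filter => /andP[/asboolP].
  move=> Cc; case: (leqP j (nfst c)) => lt_c; first by left; left.
  have [Hc|[Hf HG]] := HL c Cc lt_c.
    by left; right; rewrite mem_filter Hc andbT; apply/asboolP.
  have HcF : nfst c \in F.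
    by rewrite mem_filter mem_iota; apply/andP; split; [exact/asboolP | lia].
  right; split=> //; rewrite /eop_sum nfst_npair nsnd_npair; split=> //.
  by apply/mapP; exists (nfst c).
exists C; split; first by apply/eleP.
  by move=> /ele_eopW[j]; apply: noj.
move=> e /mP[u Hu]; apply/eleP.
(* By [noj], dumping into this column stays below some b. A pair is at least as large as its
   components, so the copies with i >= b are never dumped and decode Gamma_e(A) correctly. *)
have [b Hb] : exists b, forall j s, j < (npair e u).+1 -> good Y Ys s -> l j s <= b.
  by apply: l_bounded_lt => j _; apply: noj.
have sCC : sigma1 C C by apply: sigma1_base; comp_tac.
apply: (sigma1_ext (P := fun x => exists i, b <= i /\
    C (npair (npair e u) (npair x i)))); last by sig_tac.
move=> x; split=> [[i [le_b Ci]]|Hx].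
  have [||] := Cinv _ b _ Ci; rewrite ?(nfst_npair, nsnd_npair) //.
    have [_ H1] := npair_ge (npair e u) (npair x i).
    by have [_ H2] := npair_ge x i; lia.
  by move=> [s [Hs /(pGF _ _ Hs)]].
exists b; split=> //; apply: Ccol; by rewrite nfst_npair ?nsnd_npair.
Qed.
End IdealBound.

(** * Cuts of generic reals *)

Lemma computable_take {C T} {eC : Enc C} {eT : Enc T} (n : C -> nat) (s : C -> seq T) :
  computable n -> computable s -> computable (fun c => take (n c) (s c)).
Proof.
move=> Hn Hs; have /funext -> : (fun c => take (n c) (s c)) =1
    fun c => [seq nth (dec 0) (s c) i | i <- iota 0 (size (s c)) & i < n c].
  move=> c; elim: (s c) (n c) => [|x l IHl] [|k] //=.
    by rewrite -[LHS]/[::]; elim: (iota _ _).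
  congr cons; rewrite IHl (iotaDl 1 0) filter_map -map_comp.
  by congr map; apply: eq_filter.
comp_tac.
Qed.

Lemma computable_prefix {C} {T : eqType} {eC : Enc C} {eT : Enc T} (s t : C -> seq T) :
  computable s -> computable t -> computable (fun c => prefix (s c) (t c)).
Proof.
move=> Hs Ht; under eq_fun do rewrite prefixE.
apply: computable_eq => //; apply: computable_take => //; comp_tac.
Qed.

(* [rgt s q]: the string q lies lexicographically to the right of s, at a
   position where both are defined. *)
Fixpoint rgt (s q : seq bool) : bool :=
  match s, q with
  | a :: s', b :: q' => if a == b then rgt s' q' else b
  | _, _ => false
  end.

Lemma computable_rgt {C} {eC : Enc C} (s q : C -> seq bool) :
  computable s -> computable q -> computable (fun c => rgt (s c) (q c)).
Proof.
move=> Hs Hq.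
pose d c := find (fun i => nth false (s c) i != nth false (q c) i)
                 (iota 0 (size (s c))).
have Hd : computable d by rewrite /d; comp_tac.
have /funext -> : (fun c => rgt (s c) (q c)) =1
    fun c => (d c < size (s c)) && nth false (q c) (d c).
  move=> c; rewrite /d; elim: (s c) (q c) => [|a l IHl] [|b t] //=.
    by rewrite nth_nil andbF.
  rewrite (iotaDl 1 0) find_map; case: (eqVneq a b) => [->|] /=.
    by rewrite IHl ltnS.
  by [].
comp_tac.
Qed.

Ltac comp_str := first
 [ simple eapply computable_rgt | simple eapply computable_prefix
 | simple eapply computable_take ].
Ltac comp_base ::= first
 [ simple eapply computable_pred | simple eapply computable_addn
 | simple eapply computable_subn | simple eapply computable_muln
 | simple eapply computable_andb | simple eapply computable_orb
 | simple eapply computable_negb | simple eapply computable_leq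
 | simple eapply computable_eq0
 | simple eapply computable_eq | simple eapply computable_natb
 | simple eapply computable_expn
 | comp_str
 | simple eapply computable_if
 | comp_list ].

Lemma rgt_trans s t q : rgt s t -> rgt t q -> rgt s q.
Proof.
by elim: s t q => [|a s IHs] [|b t] [|c q] //=; case: a b c => [] [] [] //=; apply: IHs.
Qed.

Lemma rgt_ext s q s' q' : prefix s s' -> prefix q q' -> rgt s q -> rgt s' q'.
Proof.
elim: s q s' q' => [|a s IHs] [|b q] [|a' s'] [|b' q'] //=.
by case: a b a' b' => [] [] [] [] //=; apply: IHs.
Qed.

Lemma rgt_irr s : rgt s s = false.
Proof. by elim: s => //= a s ->; rewrite eqxx. Qed.

Lemma rgt_prefixF s q : prefix s q \/ prefix q s -> rgt s q = false.
Proof.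
elim: s q => [|a s IHs] [|b q] //=; case: a b => [] [] //=; try exact: IHs.
by case.
Qed.

Lemma rgt_asym s q : rgt s q -> rgt q s = false.
Proof. by move=> H; apply/negP => /(rgt_trans H); rewrite rgt_irr. Qed.

Lemma rgt_total s q : [|| prefix s q, prefix q s, rgt s q | rgt q s].
Proof.
elim: s q => [|a s IHs] [|b q] //=; case: a b => [] [] //=; rewrite ?orbT //; exact: IHs.
Qed.

(** The lexicographic order, a string preceding its extensions. Right cuts are closed upward in it,
    and whatever precedes an initial segment of P is outside the right cut. *)
Definition sle (q k : seq bool) := prefix q k || rgt q k.

Lemma computable_sle {C} {eC : Enc C} (s q : C -> seq bool) :
  computable s -> computable q -> computable (fun c => sle (s c) (q c)).
Proof. by move=> Hs Hq; rewrite /sle; comp_tac. Qed.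

Lemma rgt_sle t q k : rgt t q -> sle q k -> rgt t k.
Proof.
by move=> Htq /orP[Hq|]; [apply: rgt_ext Htq; rewrite ?prefix_refl | apply: rgt_trans].
Qed.

Lemma sle_prefix q k k' : sle q k -> prefix k k' -> sle q k'.
Proof.
move=> /orP[H1|H1] H2; first by rewrite /sle (prefix_trans H1 H2).
by rewrite /sle (rgt_ext (prefix_refl q) H2 H1) orbT.
Qed.

Lemma sleNrgt q k : sle q k -> rgt k q = false.
Proof. by move=> /orP[H|/rgt_asym//]; apply: rgt_prefixF; right. Qed.

Lemma rgt_flip x : rgt (rcons x false) (rcons x true).
Proof. by elim: x => //= a x ->; rewrite eqxx. Qed.

Section Cut.
Variable P : nat -> bool.

Definition pre n := mkseq P n.

Definition rcut (q : seq bool) : Prop := exists n, rgt (pre n) q.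
Definition lcut (q : seq bool) : Prop := exists n, rgt q (pre n).

Lemma size_pre n : size (pre n) = n. Proof. exact: size_mkseq. Qed.

Lemma pre_prefix m n : m <= n -> prefix (pre m) (pre n).
Proof.
move=> /subnKC <-; rewrite /pre /mkseq iotaD map_cat; exact: prefix_prefix.
Qed.

Lemma preS n : pre n.+1 = rcons (pre n) (P n).
Proof. exact: mkseqS. Qed.

Lemma rcut_ge n m q : rgt (pre n) q -> n <= m -> rgt (pre m) q.
Proof. by move=> H le_nm; apply: rgt_ext H; rewrite ?prefix_refl ?pre_prefix. Qed.

Lemma lcut_ge n m q : rgt q (pre n) -> n <= m -> rgt q (pre m).
Proof. by move=> H le_nm; apply: rgt_ext H; rewrite ?prefix_refl ?pre_prefix. Qed.

Lemma rcut_sle q k : rcut q -> sle q k -> rcut k.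
Proof. by move=> [n Hn] H; exists n; apply: rgt_sle H. Qed.

Lemma rcutN n q : sle q (pre n) -> ~ rcut q.
Proof.
move=> Hq [m Hm]; have := rcut_ge Hm (leq_addl n m).
by rewrite (sleNrgt (sle_prefix Hq (pre_prefix (leq_addr m n)))).
Qed.

Lemma prefix_pre q n : size q <= n -> prefix q (pre n) -> q = pre (size q).
Proof.
move=> le_n; rewrite prefixE => /eqP Hq.
by rewrite -{1}Hq /pre /mkseq -map_take take_iota (minn_idPl le_n).
Qed.

Lemma sle_pre q n : ~ rcut q -> size q <= n -> sle q (pre n).
Proof.
move=> nq le_n; rewrite /sle;
case/or4P: (rgt_total q (pre n)) => [->//||->|]; [|by rewrite orbT|].
  rewrite prefixE size_pre => /eqP Hq.
  have : size q = n.
    have := congr1 size Hq; rewrite size_take size_pre.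
    by case: ltnP => [|_ ->//]; rewrite ltnNge le_n.
  by move=> Hn; rewrite -Hq -Hn take_size prefix_refl.
by move=> H; case: nq; exists n.
Qed.

Lemma cut_cases q : rcut q \/ lcut q \/ q = pre (size q).
Proof.
have [H|H] := pselect (rcut q); [by left | right].
case/orP: (sle_pre H (leqnn (size q))) => [Hp|Hl]; last by left; exists (size q).
by right; apply: (@prefix_pre q (size q)).
Qed.

Definition generic : Prop := forall U : seq bool -> Prop, sigma1 set0 U ->
  exists n, U (pre n) \/ forall s, prefix (pre n) s -> ~ U s.

Lemma generic_bit b n : generic -> exists2 k, n <= k & P k = b.
Proof.
move=> gP.
have [|m] := gP (fun s => exists k, (n <= k < size s) && (nth false s k == b)).
  by sig_tac.
case=> [[k /andP[/andP[le_n lt_k] /eqP Hb]]|H].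
  by exists k => //; move: lt_k Hb; rewrite size_pre => lt_k; rewrite nth_mkseq.
(* With [n.+1] copies, position m + n carries the bit b, and it is at least n whatever m is. *)
case: (H (pre m ++ nseq n.+1 b)); first exact: prefix_prefix.
exists (m + n); rewrite size_cat size_nseq size_pre leq_addl andTb ltn_add2l ltnSn.
by rewrite nth_cat size_pre ltnNge leq_addr addKn nth_nseq ltnSn /=.
Qed.

Lemma rcut_flip k : P k = false -> rcut (rcons (pre k) true).
Proof. by move=> Hk; exists k.+1; rewrite preS Hk rgt_flip. Qed.

Lemma lcut_flip k : P k = true -> lcut (rcons (pre k) false).
Proof. by move=> Hk; exists k.+1; rewrite preS Hk rgt_flip. Qed.

Lemma generic_rcut n : generic -> exists2 q, prefix (pre n) q & rcut q.
Proof.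
move=> gP; have [k le_n Hk] := generic_bit false n gP.
exists (rcons (pre k) true); last exact: rcut_flip.
exact: prefix_trans (pre_prefix le_n) (prefix_rcons _ _).
Qed.
End Cut.

Ltac comp_str ::= first
 [ simple eapply computable_rgt | simple eapply computable_prefix
 | simple eapply computable_take | simple eapply computable_sle
 | eapply computable_rcons ].

Definition cutset (P : nat -> bool) : set nat := fun n => rcut P (dec n).
Definition lcutset (P : nat -> bool) : set nat := fun n => lcut P (dec n).
(** The decidable cut at a finite string. At an initial segment of P it is a part of [cutset P]; at
    a string left of P it contains [cutset P]. It thus approximates the cut from both sides. *)
Definition rset (q : seq bool) : set nat := fun n => rgt q (dec n).

Lemma cutset_enc P q : cutset P (enc q) <-> rcut P q.
Proof. by rewrite /cutset encK. Qed.

Lemma rset_cutset P n y : rset (pre P n) y -> cutset P y.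
Proof. by move=> H; exists n. Qed.

Lemma cutset_compact P (l : seq nat) : (forall y, y \in l -> cutset P y) ->
  exists m0, forall m, m0 <= m -> forall y, y \in l -> rset (pre P m) y.
Proof.
elim: l => [|z l IHl] Hl; first by exists 0.
have [y Hy|m1 H1] := IHl; first by apply: Hl; rewrite inE Hy orbT.
have [m2 H2] := Hl z (mem_head _ _).
exists (m1 + m2) => m le_m y; rewrite inE => /orP[/eqP ->|Hy].
  by apply: rcut_ge H2 _; lia.
by apply: H1 => //; lia.
Qed.

Lemma sigma1_rset {C} {eC : Enc C} B (q : C -> seq bool) (y : C -> nat) :
  computable q -> computable y -> sigma1 B (fun c => rset (q c) (y c)).
Proof. by move=> Hq Hy; rewrite /rset; sig_tac. Qed.

Ltac sig_extra ::= simple eapply sigma1_rset.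

Lemma rgt_cat s a b : rgt (s ++ a) (s ++ b) = rgt a b.
Proof. by elim: s => //= x s ->; rewrite eqxx. Qed.

Lemma rgt_zeros v n : true \in v -> size v <= n -> rgt (nseq n false) v.
Proof.
elim: v n => [|[] v IHv] [|n] //=; rewrite inE /= ltnS; exact: IHv.
Qed.

Lemma zeros_only v : true \notin v -> v = nseq (size v) false.
Proof. by elim: v => [|[] v IHv] //=; rewrite inE /= => /IHv <-. Qed.

Lemma preD P m n : pre P (m + n) = pre P m ++ [seq P i | i <- iota m n].
Proof. by rewrite /pre /mkseq iotaD map_cat. Qed.

(** * Generic cuts cannot be split *)

Section Nonsplitting.
Variable P : nat -> bool.
Hypothesis gP : generic P.
Let A := cutset P.

Variables (Z0 Z1 : set nat).
Hypotheses (HZ0 : Z0 <=e A) (HZ1 : Z1 <=e A) (HZ : A <=e join Z0 Z1).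

(* Write A = Phi(Z0 + Z1).  For axioms <q, D0 + D1> with q close to P, not both
   D0 and D1 can be contained in the sets Z0, Z1 of the cut at q.  If, with q
   arbitrarily close to P, D0 is contained in Z0 of the cut at q although
   D1 is contained in the true Z1, such axioms yield A <=e Z1; otherwise all
   axioms are sound for Z0 alone. *)
Lemma cut_nonsplitting : A <=e Z0 \/ A <=e Z1.
Proof.
have [r0 [u0 [Hr0 Hu0 Z0P]]] := (eleP _ _).1 HZ0.
have [r1 [u1 [Hr1 Hu1 Z1P]]] := (eleP _ _).1 HZ1.
have [r [u [Hr Hu AP]]] := (eleP _ _).1 HZ.
(* The operators that produce Z0 and Z1 from A, applied to arbitrary M. [D0 M a] and [D1 M a] say
   that the even and the odd half of the axiom [a] hold when A is replaced by M. *)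
pose psi0 (M : set nat) z := exists2 n, r0 (z, n) & forall y, y \in u0 (z, n) -> M y.
pose psi1 (M : set nat) z := exists2 n, r1 (z, n) & forall y, y \in u1 (z, n) -> M y.
pose D0 (M : set nat) (a : nat * nat) := forall y, y \in u a -> odd y \/ psi0 M y./2.
pose D1 (M : set nat) (a : nat * nat) := forall y, y \in u a -> ~~ odd y \/ psi1 M y./2.
have sD0 B (T : Type) (eT : Enc T) (a : T -> nat * nat) (k : T -> seq bool) :
    computable a -> computable k -> sigma1 B (fun t => D0 (rset (k t)) (a t)).
  move=> Ha Hk.
  by rewrite /D0 /psi0; sig_tac.
have sD1 B (T : Type) (eT : Enc T) (a : T -> nat * nat) (k : T -> seq bool) :
    computable a -> computable k -> sigma1 B (fun t => D1 (rset (k t)) (a t)).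
  move=> Ha Hk.
  by rewrite /D1 /psi1; sig_tac.
have psi0_mono M M' z : (forall y, M y -> M' y) -> psi0 M z -> psi0 M' z.
  by move=> H [n Hn Hy]; exists n => // y /Hy /H.
have psi1_mono M M' z : (forall y, M y -> M' y) -> psi1 M z -> psi1 M' z.
  by move=> H [n Hn Hy]; exists n => // y /Hy /H.
have D0_mono M M' a : (forall y, M y -> M' y) -> D0 M a -> D0 M' a.
  by move=> H HD y /HD[|/(psi0_mono _ _ _ H)]; [left | right].
have D1_mono M M' a : (forall y, M y -> M' y) -> D1 M a -> D1 M' a.
  by move=> H HD y /HD[|/(psi1_mono _ _ _ H)]; [left | right].
have D0_compact a : D0 A a -> exists m0, forall m, m0 <= m -> D0 (rset (pre P m)) a.
  rewrite /D0; elim: (u a) => [|y l IHl] HD; first by exists 0.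
  have [z Hz|m1 H1] := IHl; first by apply: HD; rewrite inE Hz orbT.
  have [Hodd|[n Hn /cutset_compact[m2 H2]]] := HD y (mem_head _ _).
    by exists m1 => m le_m z; rewrite inE => /orP[/eqP ->|]; [left | exact: H1].
  exists (m1 + m2) => m le_m z; rewrite inE => /orP[/eqP ->|].
    by right; exists n => // x Hx; apply: H2 => //; lia.
  by apply: H1; lia.
have D1_compact a : D1 A a -> exists m0, forall m, m0 <= m -> D1 (rset (pre P m)) a.
  rewrite /D1; elim: (u a) => [|y l IHl] HD; first by exists 0.
  have [z Hz|m1 H1] := IHl; first by apply: HD; rewrite inE Hz orbT.
  have [Hodd|[n Hn /cutset_compact[m2 H2]]] := HD y (mem_head _ _).
    by exists m1 => m le_m z; rewrite inE => /orP[/eqP ->|]; [left | exact: H1].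
  exists (m1 + m2) => m le_m z; rewrite inE => /orP[/eqP ->|].
    by right; exists n => // x Hx; apply: H2 => //; lia.
  by apply: H1; lia.
have {}AP x : A x <-> exists2 n, r (x, n) & D0 A (x, n) /\ D1 A (x, n).
  rewrite AP; split=> -[n Hn]; last first.
    move=> [H0 H1]; exists n => // y Hy; rewrite /join /=.
    case: ifP => Ho; first by case: (H1 y Hy); [rewrite Ho | move/Z1P].
    by case: (H0 y Hy); [rewrite Ho | move/Z0P].
  move=> Hy; exists n => //; split=> y /Hy; rewrite /join /=; case: ifP => _.
  - by left.
  - by move=> /Z0P; right.
  - by move=> /Z1P; right.
  - by left.
have sub_lft s y : lcut P s -> A y -> rset s y.
  move=> [m Hm] [n Hn]; apply: (rgt_trans (lcut_ge Hm (leq_addr n m))).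
  by apply: rcut_ge Hn (leq_addl _ _).
(* P cannot meet the set of [rho] at which a valid axiom enumerates an x with [sle (dec x) rho]:
   this axiom would also be valid for A, although x is outside A. So P avoids the set from some [i0]
   on. *)
have [i0 Hi0] : exists i0, forall rho, prefix (pre P i0) rho -> forall x n, r (x, n) ->
    D0 (rset rho) (x, n) -> D1 (rset rho) (x, n) -> ~~ sle (dec x) rho.
  have [|i [[x [n [Hn H0 H1 Hx]]]|Hi]] := gP (U := fun rho => exists x n,
     [/\ r (x, n), D0 (rset rho) (x, n), D1 (rset rho) (x, n) & sle (dec x) rho]).
  - apply: (sigma1_ext (P := fun rho => exists x n, (r (x, n) /\ D0 (rset rho) (x, n))
       /\ (D1 (rset rho) (x, n) /\ sle (dec x) rho)));
      last by repeat first [progress sig_tac | apply: sD0 | apply: sD1].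
    by move=> rho; split=> -[x [n]]; [move=> [[] ? ? []] | move=> []]; exists x, n.
  - case: (rcutN Hx); apply/AP; exists n => //.
    by split; [apply: D0_mono H0 | apply: D1_mono H1]; apply: rset_cutset.
  - exists i => rho /Hi Hrho x n Hn H0 H1; apply/negP => Hx.
    by apply: Hrho; exists x, n.
have [Hcase|Hcase] := pselect (forall m, exists kap x n, [/\ prefix (pre P m) kap,
    rcut P kap, sle (dec x) kap & [/\ r (x, n), D0 (rset kap) (x, n) & D1 A (x, n)]]).
  right; apply/eleP.
  have sZ1 : sigma1 Z1 Z1 by apply: sigma1_base; comp_tac.
  apply: (sigma1_ext (P := fun x' => exists kap x n,
     ((prefix (pre P i0) kap /\ sle (dec x) kap) /\ (r (x, n) /\ D0 (rset kap) (x, n)))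
     /\ (rgt kap (dec x') /\ forall y, y \in u (x, n) -> ~~ odd y \/ Z1 y./2)));
    last by repeat first [progress sig_tac | apply: sD0 | apply: sD1].
  move=> x'; split.
    move=> [kap [x [n [[[Hkap Hx] [Hn H0]] [Hx' H1]]]]].
    have {}H1 : D1 A (x, n) by move=> y /H1[|/Z1P]; [left | right].
    (* If [kap] were left of P, its cut would contain A and validate D1 too, against [Hi0]; if it
       were on P, a longer initial segment would validate both halves. So [kap] is right of P. *)
    suff Hk : rcut P kap by apply: (rcut_sle Hk); rewrite /sle Hx' orbT.
    have [//|[Hl|Ep]] := cut_cases P kap.
      case/negP: (Hi0 _ Hkap _ _ Hn H0 (D1_mono _ _ _ (fun y => sub_lft kap y Hl) H1)).
      exact: Hx.
    have [m0 Hm0] := D1_compact _ H1; pose m := size kap + m0.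
    have Hkm : prefix kap (pre P m) by rewrite Ep; apply: pre_prefix; rewrite leq_addr.
    have H0' : D0 (rset (pre P m)) (x, n).
      apply: D0_mono H0 => y; rewrite /rset => Hy.
      exact: rgt_ext Hkm (prefix_refl _) Hy.
    case/negP: (Hi0 _ (prefix_trans Hkap Hkm) x n Hn H0' (Hm0 _ (leq_addl _ _))).
    exact: sle_prefix Hx Hkm.
  move=> [m Hm]; have [kap [x [n [Hkap Hk Hx [Hn H0 H1]]]]] := Hcase (i0 + m).
  exists kap, x, n; split; split=> //.
  - by split=> //; apply: prefix_trans Hkap; apply: pre_prefix; rewrite leq_addr.
  - apply: rgt_ext Hm; last exact: prefix_refl.
    by apply: prefix_trans Hkap; apply: pre_prefix; rewrite leq_addl.
  - by move=> y /H1[|/Z1P]; [left | right].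
left; apply/eleP.
have [m Hcase2] : exists m, forall kap x n, prefix (pre P m) kap -> rcut P kap ->
    sle (dec x) kap -> r (x, n) -> D0 (rset kap) (x, n) -> ~ D1 A (x, n).
  apply: contrapT => Hn; apply: Hcase => m; apply: contrapT => Hm; apply: Hn; exists m.
  by move=> kap x n H1 H2 H3 H4 H5 H6; apply: Hm; exists kap, x, n.
(* P cannot meet this set: a [kap] right of an initial segment of P is in the right cut, and D1
   valid at that segment is valid for A, which [Hcase2] forbids. *)
pose U (rho : seq bool) := exists kap x n, ((prefix (pre P m) kap /\ rgt rho kap) /\
  (sle (@dec _ (@Enc_seq bool Enc_bool) x) kap /\ r (x, n))) /\
  (D0 (rset kap) (x, n) /\ D1 (rset rho) (x, n)).
have [|i [[kap [x [n [[[H1 H2] [H3 H4]] [H5 H6]]]]]|Hi]] := gP (U := U).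
- by rewrite /U; repeat first [progress sig_tac | apply: sD0 | apply: sD1].
- case: (Hcase2 kap x n) => //; first by exists i.
  by apply: D1_mono H6; apply: rset_cutset.
have {}Hi rho : prefix (pre P (m + i)) rho -> ~ U rho.
  move=> Hrho; apply: Hi; apply: prefix_trans Hrho; apply: pre_prefix.
  by rewrite leq_addl.
move: (m + i) (leq_addr i m) Hi => j le_mj Hj.
have sZ0 : sigma1 Z0 Z0 by apply: sigma1_base; comp_tac.
(* D1 is tested without Z1, at the cut of [pre P j] followed by k zeros. For large k this accepts
   every D1 that is valid for A. *)
apply: (sigma1_ext (P := fun x' => exists x n k,
   ((prefix (pre P j) (dec x) /\ rgt (dec x) (dec x')) /\
    (r (x, n) /\ D1 (rset (pre P j ++ nseq k false)) (x, n))) /\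
   forall y, y \in u (x, n) -> odd y \/ Z0 y./2));
      last by repeat first [progress sig_tac | apply: sD0 | apply: sD1].
move=> x'; split.
  move=> [x [n [k [[[Hx Hx'] [Hn H1]] H0]]]].
  have {}H0 : D0 A (x, n) by move=> y /H0[|/Z0P]; [left | right].
  suff Hk : rcut P (@dec _ (@Enc_seq bool Enc_bool) x).
    by apply: (rcut_sle Hk); rewrite /sle Hx' orbT.
  apply: contrapT => nHx.
  (* A one of P beyond j puts [pre P j] followed by enough zeros strictly left of P, so that a long
     initial segment of P can serve as [kap] in [U]. *)
  have [m0 Hm0] := D0_compact _ H0; have [k1 le_k1 Hk1] := generic_bit true j gP.
  pose n' := m0 + k1.+1 + size (@dec _ (@Enc_seq bool Enc_bool) x).
  apply: (Hj (pre P j ++ nseq (k + k1.+1) false)); first exact: prefix_prefix.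
  exists (pre P n'), x, n; split; split.
  - split; first by apply: pre_prefix; rewrite /n'; lia.
    have Hpk : prefix (pre P k1.+1) (pre P n') by apply: pre_prefix; rewrite /n'; lia.
    apply: (rgt_ext (prefix_refl _) Hpk).
    rewrite (_ : k1.+1 = j + (k1.+1 - j)); last by lia.
    rewrite preD rgt_cat; apply: rgt_zeros; last by rewrite size_map size_iota; lia.
    by apply/mapP; exists k1 => //; rewrite mem_iota; lia.
  - by split=> //; apply: sle_pre nHx _; rewrite /n' leq_addl.
  - by apply: Hm0; rewrite /n'; lia.
  - apply: D1_mono H1 => y; rewrite /rset; apply: rgt_ext; last exact: prefix_refl.
    by rewrite nseqD catA prefix_prefix.
move=> [m0 Hm0].
have [q Hq Hrq] := generic_rcut (j + m0) gP.
have /AP[n Hn [H0 H1]] : A (enc q) by apply/cutset_enc.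
have [m1 Hm1] := D1_compact _ H1.
exists (enc q), n, m1; rewrite encK; split; last by move=> y /H0[|/Z0P]; [left | right].
split; split=> //.
- by apply: prefix_trans Hq; apply: pre_prefix; rewrite leq_addr.
- apply: rgt_ext Hm0; last exact: prefix_refl.
  by apply: prefix_trans Hq; apply: pre_prefix; rewrite leq_addl.
- apply: D1_mono (Hm1 (j + m1) (leq_addl _ _)) => y; rewrite /rset.
  rewrite preD; set v := map _ _; have Hv : size v = m1 by rewrite size_map size_iota.
  have [Hin|/zeros_only] := boolP (true \in v); last by rewrite Hv => ->.
  by apply: rgt_trans; rewrite rgt_cat; apply: rgt_zeros; rewrite ?Hv.
Qed.
End Nonsplitting.

(** * Generic reals that compute 0' together with a given set *)

Definition on (P : nat -> bool) (s : seq bool) : Prop := s = pre P (size s).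

Lemma on_prefix P s t : on P t -> prefix s t -> on P s.
Proof.
move=> Ht Hs; apply: (@prefix_pre P s (size t)); last by rewrite -Ht.
exact: size_prefix.
Qed.

Lemma sigma1_path B (S : nat -> seq bool -> seq bool -> Prop)
    (tau : nat -> seq bool) :
  sigma1 B (fun p : nat * seq bool * seq bool => S p.1.1 p.1.2 p.2) ->
  (forall e t, S e (tau e) t <-> t = tau e.+1) ->
  sigma1 B (fun p : nat * seq bool => p.2 = tau p.1).
Proof.
move=> HS tauS.
apply: (sigma1_ext (P := fun p : nat * seq bool => exists l : seq (seq bool),
  ((nth [::] l 0 == tau 0) /\ (nth [::] l p.1 == p.2)) /\
  forall i, i < p.1 -> S i (nth [::] l i) (nth [::] l i.+1))); last by sig_tac.
move=> [e t] /=; split=> [[l [[/eqP H0 /eqP <-] HSl]]|->].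
  elim: e HSl => [|e IHe] HSl //.
  have He : nth [::] l e = tau e by apply: IHe => i lt_i; apply: HSl; lia.
  by have := HSl e (ltnSn e); rewrite He => /tauS.
exists (mkseq tau e.+1); rewrite !nth_mkseq //; split=> // i lt_i.
rewrite !nth_mkseq; [by apply/tauS | by [] | by lia].
Qed.

Section PosnerRobinson.
Variable H : set nat.
Hypotheses (sH : sigma1 (ejump set0) H).
Hypothesis sHN : sigma1 (ejump set0) (fun n => ~ H n).
Hypothesis HN : ~ sigma1 set0 (fun n => ~ H n).

(** P is built by finite extensions. With t the string reached at stage e, let V be the set of n
    such that some element of W_e extends t 0^n 1. V is c.e. and the complement of H is not, so V
    and H agree at some n. The least such n is coded by the block 0^n 1, an element of W_e is taken
    above it if V contains n, and the bit K(e) is appended. P together with H retraces this: the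
    block shows n, and H tells whether W_e was used. *)
Lemma posner_robinson : exists P, [/\ generic P, sigma1 (ejump set0) (on P)
  & forall X, sigma1 X H -> sigma1 X (fun n => ~ H n) -> sigma1 X (on P) ->
      ejump set0 <=e X].
Proof.
have [wst [cw wmono wP]] := sigma1_stage (W_sigma1 set0).
pose blk (t : seq bool) n := t ++ rcons (nseq n false) true.
have cblk : computable (fun p : seq bool * nat => blk p.1 p.2).
  by rewrite /blk; comp_tac.
pose sdec (y : nat) : seq bool * nat :=
  @dec _ (@Enc_prod _ _ (@Enc_seq bool Enc_bool) Enc_nat) y.
have csd : computable sdec by rewrite /sdec; comp_tac.
pose senc (s : seq bool) := @enc _ (@Enc_seq bool Enc_bool) s.
have cse : computable senc by rewrite /senc; comp_tac.
(* [y] codes a string and a stage by which it has appeared in W_e. [least] singles out one [y], so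
   the choice can be repeated computably. *)
pose test (p : nat * seq bool) n y := prefix (blk p.2 n) (sdec y).1 &&
  wst (p.1, senc (sdec y).1) (sdec y).2.
have ctest : computable (fun q : nat * seq bool * nat * nat =>
    test q.1.1 q.1.2 q.2) by rewrite /test; comp_tac.
pose least p n y := test p n y && all (fun y' => ~~ test p n y') (iota 0 y).
have cleast : computable (fun q : nat * seq bool * nat * nat =>
    least q.1.1 q.1.2 q.2) by rewrite /least; comp_tac.
pose V p n := exists y, test p n y.
have leastP p n : V p n -> exists y, least p n y.
  move=> Vn; case: (ex_minnP Vn) => y Hy Hmin; exists y; rewrite /least Hy /=.
  apply/allP => y'; rewrite mem_iota /= => lt_y; apply/negP => /Hmin.
  by rewrite add0n in lt_y; lia.
have least_uniq p n y y' : least p n y -> least p n y' -> y = y'.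
  move=> /andP[Hy /allP Ly] /andP[Hy' /allP Ly']; case: (ltngtP y y') => // lt_y.
    by have := Ly' y; rewrite mem_iota /= add0n lt_y Hy => /(_ isT).
  by have := Ly y'; rewrite mem_iota /= add0n lt_y Hy' => /(_ isT).
pose agr p n := (V p n /\ H n) \/ (~ V p n /\ ~ H n).
pose dis p n := (V p n /\ ~ H n) \/ (~ V p n /\ H n).
have agr_dis p n : dis p n <-> ~ agr p n.
  by rewrite /dis /agr; have := pselect (V p n); have := pselect (H n); tauto.
pose out p n (t' : seq bool) := (V p n /\ exists2 y, least p n y & t' = (sdec y).1) \/
  (~ V p n /\ t' = blk p.2 n).
pose bitK e (b : bool) := (b /\ K set0 e) \/ (~~ b /\ ~ K set0 e).
pose Step (p : nat * seq bool) (t' : seq bool) := exists n b s,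
  ((agr p n /\ forall n', n' < n -> dis p n') /\ (out p n s /\ bitK p.1 b)) /\
  t' = rcons s b.
have agr_ex p : exists n, agr p n /\ forall n', n' < n -> dis p n'.
  have Hex : exists n, `[< agr p n >].
    (* If V and H disagreed everywhere, the complement of H would be V. *)
    apply: contrapT => Hno; apply: HN.
    apply: (sigma1_ext (P := V p)); last by rewrite /V; sig_tac.
    move=> n; have : dis p n by apply/agr_dis => Hn; apply: Hno; exists n; apply/asboolP.
    by rewrite /dis; tauto.
  case: (ex_minnP Hex) => n /asboolP Hn Hmin; exists n; split=> // n' lt_n'.
  by apply/agr_dis => /asboolP /Hmin; lia.
have agr_uniq p n n' : agr p n -> (forall k, k < n -> dis p k) ->
    agr p n' -> (forall k, k < n' -> dis p k) -> n = n'.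
  move=> H1 H2 H3 H4; case: (ltngtP n n') => // lt_n.
    by have /agr_dis := H4 _ lt_n.
  by have /agr_dis := H2 _ lt_n.
have StepEx p : exists t, Step p t.
  have [n [Hn Hlt]] := agr_ex p.
  have [b Hb] : exists b : bool, bitK p.1 b.
    by have [Hk|Hk] := pselect (K set0 p.1); [exists true; left | exists false; right].
  have [s Hs] : exists s, out p n s.
    have [Hv|Hv] := pselect (V p n); last by exists (blk p.2 n); right.
    by have [y Hy] := leastP _ _ Hv; exists (sdec y).1; left; split=> //; exists y.
  by exists (rcons s b), n, b, s.
have StepUniq p t t' : Step p t -> Step p t' -> t = t'.
  move=> [n [b [s [[[H1 H2] [Hs Hb]] ->]]]] [n' [b' [s' [[[H1' H2'] [Hs' Hb']] ->]]]].
  have En := agr_uniq p n n' H1 H2 H1' H2'; subst n'.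
  have -> : b = b'.
    by case: b b' Hb Hb' => [] []; rewrite /bitK //=; move=> [[]|[]] // ? ? [[]|[]].
  have -> // : s = s'.
  case: Hs Hs' => [[Hv [y Hy ->]]|[Hv ->]] [[Hv' [y' Hy' ->]]|[Hv' ->]] //.
  by rewrite (least_uniq _ _ _ _ Hy Hy').
have /choice[f Hf] : forall p, exists t, Step p t by [].
pose tau' e : seq bool := iteri e (fun i t => f (i, t)) [::].
have tauS e : tau' e.+1 = f (e, tau' e) by [].
have tauP e t : Step (e, tau' e) t <-> t = tau' e.+1.
  by rewrite tauS; split=> [H1|->]; [apply: StepUniq (Hf _) | exact: Hf].
move: tau' tauS tauP => tau _ tauP.
have tauE e : Step (e, tau e) (tau e.+1) by apply/tauP.
have out_blk p n s : out p n s -> prefix (blk p.2 n) s.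
  by move=> [[_ [y /andP[/andP[Hp _] _] ->]]|[_ ->]] //; exact: prefix_refl.
have blk_prefix t n : prefix t (blk t n) by apply: prefix_prefix.
have tau_step e : prefix (tau e) (tau e.+1) /\ size (tau e) < size (tau e.+1).
  have [n [b [s [[_ [/out_blk Hs _]] ->]]]] := tauE e.
  have Hp : prefix (tau e) s := prefix_trans (blk_prefix (tau e) n) Hs.
  split; first exact: prefix_trans Hp (prefix_rcons _ _).
  by rewrite size_rcons ltnS size_prefix.
have tau_mono e e' : e <= e' -> prefix (tau e) (tau e').
  move=> /subnKC <-; elim: (e' - e) => [|d IHd]; first by rewrite addn0 prefix_refl.
  by rewrite addnS; apply: prefix_trans IHd (tau_step _).1.
have tau_size e : e <= size (tau e).
  by elim: e => // e IHe; apply: leq_ltn_trans IHe (tau_step e).2.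
pose P i := nth false (tau i.+1) i.
have tau_on e : on P (tau e).
  apply: (@eq_from_nth _ false); first by rewrite size_pre.
  move=> i lt_i; rewrite nth_mkseq // /P.
  have Hnth e1 e2 : e1 <= e2 -> i < size (tau e1) ->
      nth false (tau e1) i = nth false (tau e2) i.
    by move=> /tau_mono /prefixP[v ->] lt1; rewrite nth_cat lt1.
  by case: (leqP e i.+1) => [/Hnth /(_ lt_i)//|/ltnW /Hnth /(_ (tau_size _))].
have onP s : on P s <-> exists2 e, prefix s (tau e) & True.
  split=> [Hs|[e Hs _]]; last exact: on_prefix (tau_on e) Hs.
  exists (size s) => //; rewrite (tau_on (size s)) {1}Hs.
  exact/pre_prefix/tau_size.
have sK : sigma1 (ejump set0) (K set0) := sigma1_jump (K_sigma1 set0).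
have sKN : sigma1 (ejump set0) (fun z => ~ K set0 z) := sigma1_jumpN (K_sigma1 set0).
have sV0 : sigma1 set0 (fun q : nat * seq bool * nat => V q.1 q.2) by rewrite /V; sig_tac.
have sV := sigma1_jump sV0; have sVN := sigma1_jumpN sV0.
have sagr : sigma1 (ejump set0) (fun q : nat * seq bool * nat => agr q.1 q.2).
  by rewrite /agr; sig_tac.
have sdis : sigma1 (ejump set0) (fun q : nat * seq bool * nat => dis q.1 q.2).
  by rewrite /dis; sig_tac.
have sout : sigma1 (ejump set0)
    (fun q : nat * seq bool * nat * seq bool => out q.1.1 q.1.2 q.2).
  apply: (sigma1_ext (P := fun q : nat * seq bool * nat * seq bool =>
   (V q.1.1 q.1.2 /\ exists2 y, least q.1.1 q.1.2 y & q.2 == (sdec y).1) \/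
   (~ V q.1.1 q.1.2 /\ q.2 == blk q.1.1.2 q.1.2))); last by sig_tac.
  move=> [[p n] t'] /=; split=> [[[Hv [y Hy /eqP E]]|[Hv /eqP E]]|].
  - by left; split=> //; exists y.
  - by right.
  - by move=> [[Hv [y Hy ->]]|[Hv ->]]; [left; split=> //; exists y | right].
have sbit : sigma1 (ejump set0) (fun q : nat * bool => bitK q.1 q.2).
  by rewrite /bitK; sig_tac.
have stau : sigma1 (ejump set0) (fun p : nat * seq bool => p.2 = tau p.1).
  apply: (sigma1_path (S := fun e t t' => Step (e, t) t')) => //.
  apply: (sigma1_ext (P := fun q : nat * seq bool * seq bool => exists n b s,
    ((agr q.1 n /\ forall n', n' < n -> dis q.1 n') /\ (out q.1 n s /\ bitK q.1.1 b)) /\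
    q.2 == rcons s b)); last by sig_tac.
  move=> [[e t] t'] /=.
  by split=> -[n [b [s [H1 H2]]]]; exists n, b, s; split=> //; apply/eqP.
have eq_on s t : on P s -> on P t -> size s = size t -> s = t.
  by move=> Hs Ht E; rewrite Hs E -Ht.
have Kbit e : K set0 e <-> exists s, tau e.+1 = rcons s true.
  have [n [b [s [[_ [_ Hb]] ->]]]] := tauE e; case: b Hb => Hb.
    by split=> _; [exists s | case: Hb => -[]].
  split=> [HK|[s' /rcons_inj[]//]]; case: Hb => -[] //.
exists P; split.
- move=> U sU.
  have [e He] : exists e, forall s, U s <-> W e (senc s).
    have [c Hc] : ce (fun n => exists s, (senc s == n) /\ U s).
      by apply/ce_sigma1; sig_tac.
    exists (encode c) => s; rewrite W_encode -Hc; split=> [Us|[t [/eqP Ht]]].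
      by exists s.
    by move: (can_inj (@encK _ (@Enc_seq bool Enc_bool)) Ht) => ->.
  have [n [b [s [[[_ _] [Hout _]] Etau]]]] := tauE e.
  have on_s : on P s by apply: on_prefix (tau_on e.+1) _; rewrite Etau prefix_rcons.
  exists (size s); rewrite -on_s.
  case: Hout => [[_ [y /andP[/andP[_ Hw] _] Es]]|[nV Es]].
    by left; apply/He; rewrite Es; apply/(wP (e, _)); exists (sdec y).2.
  right=> t Ht /He /(wP (e, senc t))[i Hi]; apply: nV.
  exists (@enc _ (@Enc_prod _ _ (@Enc_seq bool Enc_bool) Enc_nat) (t, i)).
  rewrite /test /sdec encK /= -[blk _ _]Es; apply/andP; split; first exact: Ht.
  exact: Hi.
- apply: (sigma1_ext (P := fun s => exists e t, prefix s t /\ t = tau e)); last first.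
    apply: sigma1_ex; apply: sigma1_ex; apply: sigma1_and; first by sig_tac.
    by apply: (sigma1_comp (f := fun q : seq bool * nat * seq bool => (q.1.2, q.2)) stau);
      comp_tac.
  move=> s; rewrite onP; split=> [[e [t [Hp Et]]]|[e Hp _]]; first by exists e; rewrite -?Et.
  by exists e, (tau e).
- move=> X xH xHN xon; apply/eleP; apply: sigma1_join.
    by apply: sigma1_set0; apply: K_sigma1.
  (* The step relation as seen from X: questions about V are replaced by questions about H, which
     agree at the n in use, and the correct n and final bit are recognized by lying on P. *)
  pose S' e t t' := exists n, on P (blk t n) /\
    ((~ H n /\ exists b, (t' == rcons (blk t n) b) /\ on P t') \/
     (H n /\ exists y b, ((least (e, t) n y) /\ (t' == rcons (sdec y).1 b)) /\ on P t')).
  have xtau : sigma1 X (fun p : nat * seq bool => p.2 = tau p.1).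
    apply: (sigma1_path (S := S')); first by rewrite /S'; sig_tac.
    move=> e t'.
    have [n [b [s [[[Hagr Hdis] [Hout Hb]] Etau]]]] := tauE e.
    have on_s : on P s by apply: on_prefix (tau_on e.+1) _; rewrite Etau prefix_rcons.
    have on_blk := on_prefix on_s (out_blk _ _ _ Hout).
    split=> [[n' [on_blk' Hcase]]|->]; last first.
      exists n; split=> //; case: Hagr => [[HV Hn]|[HV Hn]].
        right; split=> //; case: Hout => [[_ [y Hy Es]]|[]//].
        by exists y, b; rewrite -Es Etau; split=> //; rewrite -Etau.
      left; split=> //; case: Hout => [[]//|[_ Es]].
      by exists b; rewrite Etau -Es; split=> //; rewrite -Etau.
    (* Both blocks lie on P, so either number counts the zeros of P between t and the next one. *)
    have En : n' = n.
      move: on_blk on_blk'; rewrite /on /blk /= !size_cat !size_rcons !size_nseq.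
      move: (tau e) => t E1 E2.
      have Hnth k : nth false (t ++ rcons (nseq k false) true) (size t + k) = true.
        by rewrite nth_cat ltnNge leq_addr addKn nth_rcons size_nseq ltnn eqxx.
      have Hlt k i : i < k -> nth false (t ++ rcons (nseq k false) true) (size t + i) = false.
        move=> lt_i; rewrite nth_cat ltnNge leq_addr addKn nth_rcons size_nseq lt_i.
        by rewrite nth_nseq lt_i.
      case: (ltngtP n' n) => // lt_n.
        have := Hlt n n' lt_n; rewrite E1 nth_mkseq; last by lia.
        by have := Hnth n'; rewrite E2 nth_mkseq; [move=> -> | lia].
      have := Hlt n' n lt_n; rewrite E2 nth_mkseq; last by lia.
      by have := Hnth n; rewrite E1 nth_mkseq; [move=> -> | lia].
    subst n'; case: Hcase => [[Hn [b' [/eqP Et on_t]]]|[Hn [y [b' [[Hy /eqP Et] on_t]]]]].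
      apply: (eq_on _ _ on_t (tau_on _)); rewrite Et Etau !size_rcons.
      case: Hout => [[HV _]|[_ ->]] //; by case: Hagr => -[].
    apply: (eq_on _ _ on_t (tau_on _)); rewrite Et Etau !size_rcons.
    case: Hout => [[_ [y' Hy' ->]]|[HV _]]; last by case: Hagr => -[].
    by rewrite (least_uniq _ _ _ _ Hy Hy').
  apply: (sigma1_ext (P := fun e => exists s t, (t == rcons s false) /\ t = tau e.+1)).
    move=> e; rewrite /setC /= Kbit; split=> [[s [t [/eqP -> <-]]] [s' /rcons_inj[]//]|HK].
    have [n [b [s [_ Etau]]]] := tauE e; exists s, (tau e.+1); split=> //.
    by rewrite Etau; case: b Etau => // Etau; case: HK; exists s.
  apply: sigma1_ex; apply: sigma1_ex; apply: sigma1_and; first by sig_tac.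
  by apply: (sigma1_comp (f := fun q : nat * seq bool * seq bool => (q.1.1.+1, q.2)) xtau);
    comp_tac.
Qed.
End PosnerRobinson.

(** * Coding a Sigma_3 set into the degrees below a generic cut *)

(** For the empty set every stage is good, so [full] and [bounded] become plain convergence to
    infinity and boundedness. *)
Lemma set0_approx : good_approx set0 (fun _ => [::]).
Proof. by split=> [|//|s0]; [comp_tac | exists s0]. Qed.

Lemma prefix_rconsP (T : eqType) (c x : seq T) b :
  prefix c (rcons x b) -> c = rcons x b \/ prefix c x.
Proof.
elim: x c => [|y x IHx] [|d c] //=; try by right.
  by rewrite andbC => /andP[]; case: c => // _ /eqP ->; left.
by move=> /andP[/eqP -> /IHx[->|->]]; [left | right; rewrite eqxx].
Qed.

Lemma prefix_both (T : eqType) (s t c : seq T) :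
  prefix s c -> prefix t c -> size s <= size t -> prefix s t.
Proof.
rewrite !prefixE => /eqP Hs /eqP Ht le_st.
by rewrite -{1}Ht take_takel // Hs.
Qed.

(** Raising a value never moves it to the left, which is why [raises] demands that c is not already
    right of x0. Membership of a value in the cut can then only be gained. *)
Lemma rgt_raise c x t : ~~ rgt (rcons x false) c -> rgt t c -> rgt t (rcons x true).
Proof.
move=> Hc Htc; case/or4P: (rgt_total (rcons x false) c) => [Hp|Hp|H|H].
- apply: (rgt_trans Htc).
  exact: rgt_ext Hp (prefix_refl _) (rgt_flip x).
- have [Ec|Hx] := prefix_rconsP Hp.
    by apply: (rgt_trans Htc); rewrite Ec rgt_flip.
  apply: rgt_ext (prefix_refl _) _ Htc; exact: prefix_trans Hx (prefix_rcons _ _).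
- by rewrite H in Hc.
- exact: rgt_trans Htc (rgt_trans H (rgt_flip x)).
Qed.

Lemma rcut_rgt P q n : rcut P q -> prefix (pre P n) q \/ rgt (pre P n) q.
Proof.
move=> Hq; case/or4P: (rgt_total (pre P n) q) => H; [by left | | by right | ].
  by case: (@rcutN P n q) => //; rewrite /sle H.
by case: (@rcutN P n q) => //; rewrite /sle H orbT.
Qed.

(* An action ((e, tau), x, v) answers the axiom <x, D_v> of Gamma_e: it raises
   the values t_z, z in D_v, to the right of x0, so that the axiom becomes
   false for reals extending x0. *)
Definition action : Type := nat * seq bool * seq bool * nat.

Section Coding.
Variables (wst : nat * nat -> nat -> bool) (m : nat -> nat -> nat -> nat).
Hypothesis cw : computable (fun q : (nat * nat) * nat => wst q.1 q.2).
Hypothesis wP : forall p, W p.1 p.2 <-> exists s, wst p s.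
Hypothesis wmono : forall p s t, s <= t -> wst p s -> wst p t.
Hypothesis cm : computable (fun q : nat * nat * nat => m q.1.1 q.1.2 q.2).

Definition str_of_nat (n : nat) : seq bool := dec n.
Definition action_of_nat (n : nat) : action := dec n.
Definition nat_of_action (a : action) : nat := enc a.
Definition nat_of_str (s : seq bool) : nat := enc s.

Lemma nat_of_strK s : str_of_nat (nat_of_str s) = s. Proof. exact: encK. Qed.
Lemma nat_of_actionK a : action_of_nat (nat_of_action a) = a. Proof. exact: encK. Qed.

Definition raises (a : action) (z : nat) (c : seq bool) : bool :=
  [&& z \in canon_seq a.2, a.1.1.1 <= nfst z, prefix a.1.1.2 c
    & ~~ rgt (rcons a.1.2 false) c].

(** An element z of column [nfst z] stands for a string, initially the one coded by [nfst (nsnd z)];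
    [nsnd (nsnd z)] is padding. The list [h] has the newest action first. *)
Definition tvalue (z : nat) (h : seq action) : seq bool :=
  foldr (fun a c => if raises a z c then rcons a.1.2 true else c)
        (str_of_nat (nfst (nsnd z))) h.

(** Elements are released as [m] grows: eventually all of a column whose [m] tends to infinity, but
    only finitely many of one whose [m] is bounded. *)
Definition alive (n z s : nat) : bool :=
  has (fun t => nsnd z < m n (nfst z) t) (iota 0 s).

(** Each element of D_v must already be right of tau, or extend tau in a column that e may change.
    The last two clauses allow one action per pair (e, tau), and none at a tau extending an earlier
    x0 of the same e. *)
Definition acts (n s : nat) (h : seq action) (a : action) : bool :=
  [&& wst (a.1.1.1, npair (nat_of_str a.1.2) a.2) s, prefix a.1.1.2 a.1.2,
      all (fun z => alive n z s &&
        (rgt a.1.1.2 (tvalue z h) ||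
         ((a.1.1.1 <= nfst z) && prefix a.1.1.2 (tvalue z h)))) (canon_seq a.2),
      all (fun b : action => b.1.1 != a.1.1) h
    & all (fun b : action =>
        ~~ ((b.1.1.1 == a.1.1.1) && prefix (rcons b.1.2 false) a.1.1.2)) h].

(** Stage i considers the action coded by [nfst i], so each action is considered infinitely
    often. *)
Definition hist (n s : nat) : seq action :=
  iteri s (fun i h => if acts n i h (action_of_nat (nfst i)) then action_of_nat (nfst i) :: h
                      else h) [::].

Lemma computable_hist : computable (fun p : nat * nat => hist p.1 p.2).
Proof.
have cseq : computable canon_seq by apply: computable_canon_seq; comp_tac.
have csv : computable str_of_nat by rewrite /str_of_nat; comp_tac.
have cac : computable action_of_nat by rewrite /action_of_nat; comp_tac.
have csc : computable nat_of_str by rewrite /nat_of_str; comp_tac.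
have craise : computable (fun q : action * nat * seq bool => raises q.1.1 q.1.2 q.2).
  by rewrite /raises /action; comp_tac.
have ctval : computable (fun q : nat * seq action => tvalue q.1 q.2).
  by rewrite /tvalue; comp_tac.
have calive : computable (fun q : nat * nat * nat => alive q.1.1 q.1.2 q.2).
  by rewrite /alive; comp_tac.
have cacts : computable (fun q : (nat * nat) * seq action * action =>
    acts q.1.1.1 q.1.1.2 q.1.2 q.2).
  by rewrite /acts /action; comp_tac.
rewrite /hist; comp_tac.
apply: (computable_comp (f := fun q : nat * nat * (nat * seq action) =>
  (q.1.1, q.2.1, q.2.2, action_of_nat (nfst q.2.1))) cacts); comp_tac.
Qed.

Lemma computable_tvalue : computable (fun q : nat * seq action => tvalue q.1 q.2).
Proof.
have cseq : computable canon_seq by apply: computable_canon_seq; comp_tac.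
have csv : computable str_of_nat by rewrite /str_of_nat; comp_tac.
by rewrite /tvalue /raises /action; comp_tac.
Qed.

Lemma computable_alive :
  computable (fun q : nat * nat * nat => alive q.1.1 q.1.2 q.2).
Proof. by rewrite /alive; comp_tac. Qed.

Lemma alive_mono n z s t : s <= t -> alive n z s -> alive n z t.
Proof.
move=> le_st /hasP[k]; rewrite mem_iota /= => lt_k Hk; apply/hasP; exists k => //.
by rewrite mem_iota /=; lia.
Qed.

Lemma tvalue_rgt t z h1 h2 : rgt t (tvalue z h2) -> rgt t (tvalue z (h1 ++ h2)).
Proof.
move=> Ht; elim: h1 => //= a h1 IH; case: ifP => // /and4P[_ _ _ Hr].
exact: rgt_raise Hr IH.
Qed.

Lemma hist_cat n s t : s <= t -> exists h, hist n t = h ++ hist n s.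
Proof.
move=> /subnKC <-; elim: (t - s) => [|d [h Hh]]; first by exists [::]; rewrite addn0.
rewrite addnS /= -/(hist n (s + d)) Hh; case: ifP => _; last by exists h.
by exists (action_of_nat (nfst (s + d)) :: h).
Qed.

Lemma hist_sub n s t a : s <= t -> a \in hist n s -> a \in hist n t.
Proof. by move=> /(hist_cat n)[h ->]; rewrite mem_cat orbC => ->. Qed.

Lemma tvalue_mono t z n s s' : s <= s' -> rgt t (tvalue z (hist n s)) ->
  rgt t (tvalue z (hist n s')).
Proof. by move=> /(hist_cat n)[h ->]; apply: tvalue_rgt. Qed.

Lemma hist_acts n s a : a \in hist n s ->
  exists2 s', s' < s & acts n s' (hist n s') a.
Proof.
elim: s => //= s IHs; rewrite -/(hist n s); case: ifP => [Ha|_ /IHs[s' lt_s' H]]; last first.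
  by exists s' => //; lia.
rewrite inE => /orP[/eqP ->|/IHs[s' lt_s' H]]; first by exists s.
by exists s' => //; lia.
Qed.

Lemma acts_hist n s a : action_of_nat (nfst s) = a -> acts n s (hist n s) a ->
  a \in hist n s.+1.
Proof. by move=> Ea Ha; rewrite /= -/(hist n s) Ea Ha mem_head. Qed.

(** An element that the action did not raise was right of tau, hence of x0, or was already right of
    x0; later raises preserve this by [rgt_raise]. *)
Lemma hist_spec n s a z : a \in hist n s -> z \in canon_seq a.2 ->
  alive n z s && rgt (rcons a.1.2 false) (tvalue z (hist n s)).
Proof.
move=> Ha Hz; elim: s Ha => //= s IHs; rewrite -/(hist n s).
have Hold : a \in hist n s -> alive n z s.+1 /\
    rgt (rcons a.1.2 false) (tvalue z (hist n s)).
  by move=> /IHs /andP[Hal ->]; split=> //; apply: alive_mono Hal.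
case: ifP => [Hacts|_ /Hold[-> ->]//].
rewrite inE => /orP[/eqP Ea|/Hold[-> Hr]]; last first.
  by apply: (@tvalue_rgt _ _ [:: action_of_nat (nfst s)]).
subst a; case/and5P: Hacts => _ Hpx /allP /(_ z Hz) /andP[Hal Hr] _ _.
rewrite (alive_mono _ Hal) //=.
have Hpx' b := prefix_trans Hpx (prefix_rcons (action_of_nat (nfst s)).1.2 b).
case: ifP => [_|Hn]; first exact: rgt_flip.
case/orP: Hr => [Hr|/andP[He Hp]].
  exact: rgt_ext (Hpx' false) (prefix_refl _) Hr.
by apply: contraFT Hn => Hnr; apply/and4P.
Qed.

Section Positive.
Variable P : nat -> bool.
Hypothesis gP : generic P.
Variable n : nat.

Definition coded (z : nat) : Prop :=
  exists s, alive n z s /\ rcut P (tvalue z (hist n s)).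

Lemma codedP z : coded z -> exists s0, forall s, s0 <= s ->
  alive n z s /\ rcut P (tvalue z (hist n s)).
Proof.
move=> [s0 [Hal [k Hk]]]; exists s0 => s le_s; split; first exact: alive_mono Hal.
by exists k; apply: tvalue_mono Hk.
Qed.

Definition met e (rho : seq bool) : Prop :=
  exists s a, (a \in hist n s) /\ ((a.1.1.1 == e) /\ (rho == rcons a.1.2 false)).

Lemma sigma1_met e : sigma1 set0 (met e).
Proof.
have ch := computable_hist; rewrite /met.
have ch2 : computable (hist n).
  by apply: (computable_comp (f := fun s => (n, s)) ch); comp_tac.
by rewrite /action in ch2 *; sig_tac.
Qed.

(** If P passed through x0, then x would be on P and so outside the cut, while the axiom for x would
    hold of the coded set. *)
Lemma coded_sound e a s i : cutset P = eop (W e) coded -> a \in hist n s ->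
  a.1.1.1 = e -> ~ prefix (rcons a.1.2 false) (pre P i).
Proof.
move=> EA Ha Ee Hp.
have Hx : prefix a.1.2 (pre P i) := prefix_trans (prefix_rcons _ _) Hp.
apply: (@rcutN P i a.1.2); first by rewrite /sle Hx.
rewrite -(nat_of_strK a.1.2) -[rcut _ _]/(cutset P _) EA; exists a.2.
  have [s' _ /and5P[Hw _ _ _ _]] := hist_acts Ha.
  by rewrite -Ee; apply/(wP (a.1.1.1, _)); exists s'.
apply/canon_subsetP => z Hz; have /andP[Hal Hr] := hist_spec Ha Hz.
exists s; split=> //; exists i; exact: rgt_ext Hp (prefix_refl _) Hr.
Qed.

(** Columns below e release finitely many elements, and the coded ones among them are right of a
    fixed initial segment of P. For x in the cut close enough to P, the axiom that puts x into
    Gamma_e then permits an action, whose x0 lies where genericity excluded it. *)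
Lemma coded_negative : (forall k, exists b, forall s, m n k s <= b) ->
  ~ cutset P <=e coded.
Proof.
move=> Hb /ele_eopW[e EA].
have [i Hi] : exists i, forall rho, prefix (pre P i) rho -> ~ met e rho.
  have [i [[s [a [Ha [/eqP Ee /eqP Er]]]]|Hi]] := gP (sigma1_met e); last by exists i.
  by case: (coded_sound (i := i) EA Ha Ee); rewrite -Er prefix_refl.
have [b Hbe] : exists b, forall k s, k < e -> m n k s <= b.
  elim: {EA Hi} e => [|e [b He]]; first by exists 0.
  have [b' Hb'] := Hb e; exists (b + b') => k s; rewrite ltnS leq_eqVlt.
  by move=> /orP[/eqP ->|lt_k]; [have := Hb' s | have := He k s lt_k]; lia.
have Hlist (l : seq nat) : exists m0 s0, forall z s, z \in l -> coded z -> s0 <= s ->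
    rgt (pre P m0) (tvalue z (hist n s)).
  elim: l => [|z l [m0 [s0 IH]]]; first by exists 0, 0.
  have [[s1 [_ [m1 H1]]]|Hz] := pselect (coded z).
    exists (m0 + m1), (s0 + s1) => z' s; rewrite inE => /orP[/eqP -> _ le_s|Hz' Hc le_s].
      apply: rcut_ge (leq_addl _ _); apply: tvalue_mono H1; lia.
    by apply: rcut_ge (IH z' s Hz' Hc _) (leq_addr _ _); lia.
  by exists m0, s0 => z' s; rewrite inE => /orP[/eqP ->|]; [ | exact: IH].
have [m0 [s0 Hs0]] := Hlist [seq npair k v | k <- iota 0 e, v <- iota 0 b].
pose M := i + m0; have [x Hx Hrx] := generic_rcut M gP.
have [v Hv HD] : eop (W e) coded (nat_of_str x).
  by rewrite -EA /cutset -[dec _]/(str_of_nat _) nat_of_strK.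
have [s1 Hs1] := (wP (e, npair (nat_of_str x) v)).1 Hv.
have [s2 Hs2] : exists s2, forall s, s2 <= s -> forall z, z \in canon_seq v ->
    alive n z s /\ rcut P (tvalue z (hist n s)).
  move/canon_subsetP: HD; elim: (canon_seq v) => [|z l IHl] HD; first by exists 0.
  have [z' Hz'|t1 H1] := IHl; first by apply: HD; rewrite inE Hz' orbT.
  have [t2 H2] := codedP (HD z (mem_head _ _)).
  exists (t1 + t2) => s le_s z'; rewrite inE => /orP[/eqP ->|Hz'].
    by apply: H2; lia.
  by apply: H1 => //; lia.
pose a : action := (e, pre P M, x, v).
(* A stage that considers [a] and is late enough for all three bounds. *)
pose s := npair (nat_of_action a) (s0 + s1 + s2).
have le_s : s0 + s1 + s2 <= s by case: (npair_ge (nat_of_action a) (s0 + s1 + s2)).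
have Hia : prefix (pre P i) (pre P M) by apply: pre_prefix; rewrite leq_addr.
have nmet c t : c \in hist n t -> c.1.1.1 = e -> ~ prefix (pre P i) (rcons c.1.2 false).
  by move=> Hc Ec Hp; apply: (Hi _ Hp); exists t, c; rewrite Ec !eqxx.
have Hacts : acts n s (hist n s) a.
  apply/and5P; split=> /=.
  - by apply: wmono Hs1; lia.
  - exact: Hx.
  - apply/allP => z Hz; have [|Hal Hr] := Hs2 s _ z Hz; first by lia.
    rewrite Hal /=; case: (leqP e (nfst z)) => Hle.
      by case: (rcut_rgt M Hr) => ->; rewrite ?orbT.
    apply/orP; left; apply: rcut_ge (leq_addl i m0).
    apply: Hs0; [ | by exists s | by lia].
    apply/allpairsP; exists (nfst z, nsnd z); split; rewrite ?mem_iota /= ?npairK //.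
    by move: Hal => /hasP[t _]; have := Hbe (nfst z) t Hle; lia.
  - apply/allP => c Hc; apply/negP => /eqP Ec.
    have [s' _ /and5P[_ Hp _ _ _]] := hist_acts Hc.
    apply: (nmet c s Hc); first by rewrite Ec.
    rewrite Ec in Hp.
    exact: prefix_trans Hia (prefix_trans Hp (prefix_rcons _ _)).
  - apply/allP => c Hc; apply/negP => /andP[/eqP Ec Hp].
    exact: (coded_sound EA Hc Ec Hp).
have Ha : a \in hist n s.+1.
  by apply: acts_hist Hacts; rewrite nfst_npair nat_of_actionK.
apply: (nmet a s.+1 Ha erefl).
exact: prefix_trans Hia (prefix_trans Hx (prefix_rcons _ _)).
Qed.

(** A tau compatible with [pre P M] is one of finitely many initial segments of P, each used once,
    or it extends [pre P M]. In the latter case genericity helps: either P passes through some x0,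
    which blocks further actions beyond it, or no x0 extends [pre P M], although such an action
    would create one. *)
Lemma acts_finite e : exists M s0, forall s a c, s0 <= s -> acts n s (hist n s) a ->
  action_of_nat (nfst s) = a ->
  a.1.1.1 = e -> prefix (pre P M) c -> ~ prefix a.1.1.2 c.
Proof.
have once t : exists s0, forall s a, s0 <= s -> acts n s (hist n s) a ->
    action_of_nat (nfst s) = a -> a.1.1 <> (e, t).
  have [[s [a [Ha Ca Ea]]]|Hno] := pselect (exists s a, [/\ acts n s (hist n s) a,
      action_of_nat (nfst s) = a & a.1.1 = (e, t)]).
    exists s.+1 => s' a' le_s /and5P[_ _ _ /allP Honce _] _ Ea'.
    have := Honce a (hist_sub le_s (acts_hist Ca Ha)).
    by rewrite Ea Ea' eqxx.
  by exists 0 => s a _ Ha Ca Ea; apply: Hno; exists s, a.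
have Hshort M : exists s0, forall s a, s0 <= s -> acts n s (hist n s) a ->
    action_of_nat (nfst s) = a -> forall i, i < M -> a.1.1 <> (e, pre P i).
  elim: M => [|M [s0 IH]]; first by exists 0.
  have [s1 H1] := once (pre P M).
  exists (s0 + s1) => s a le_s Ha Ca i; rewrite ltnS leq_eqVlt => /orP[/eqP ->|lt_i].
    by apply: H1 Ha Ca; lia.
  by apply: (IH s a _ Ha Ca i lt_i); lia.
have [M [s0 Hlong]] : exists M s0, forall s a, s0 <= s -> acts n s (hist n s) a ->
    action_of_nat (nfst s) = a ->
    a.1.1.1 = e -> ~ prefix (pre P M) a.1.1.2.
  have [M [[s0 [a0 [Ha0 [/eqP E0 /eqP Er]]]]|HM]] := gP (sigma1_met e).
    exists M, s0 => s a le_s /and5P[_ _ _ _ /allP Hbl] _ Ea Hp.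
    by have := Hbl a0 (hist_sub le_s Ha0); rewrite E0 Ea eqxx -Er Hp.
  exists M, 0 => s a _ Ha Ca Ea Hp; case/and5P: (Ha) => _ Hpx _ _ _.
  apply: (HM (rcons a.1.2 false)).
    exact: prefix_trans Hp (prefix_trans Hpx (prefix_rcons _ _)).
  by exists s.+1, a; rewrite Ea !eqxx; split=> //; apply: acts_hist.
have [s1 Hs1] := Hshort M.
exists M, (s0 + s1) => s a c le_s Ha Ca Ea HMc Hc.
have [Hle|Hlt] := leqP M (size a.1.1.2).
  apply: (Hlong s a) => //; first by lia.
  by apply: prefix_both HMc Hc _; rewrite size_pre.
have le_t : size a.1.1.2 <= M by lia.
apply: (Hs1 s a ltac:(lia) Ha Ca (size a.1.1.2) Hlt).
rewrite [LHS]surjective_pairing Ea; congr pair.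
apply: (@prefix_pre P _ M) => //.
by apply: prefix_both Hc HMc _; rewrite size_pre.
Qed.

(** Only strategies e <= k change column k, and by [acts_finite] they stop near P at some stage
    [s0]. Elements with v >= [v0] are not alive before [s0], so those whose string extends [pre P M]
    keep it forever and copy the cut near P. *)
Lemma coded_positive k : (forall b, exists s0, forall s, s0 <= s -> b <= m n k s) ->
  cutset P <=e coded.
Proof.
move=> Hfull.
have [M [s0 HM]] : exists M s0, forall s a c, s0 <= s -> acts n s (hist n s) a ->
    action_of_nat (nfst s) = a ->
    a.1.1.1 <= k -> prefix (pre P M) c -> ~ prefix a.1.1.2 c.
  have [M [s0 HM]] : exists M s0, forall e s a c, e < k.+1 -> s0 <= s ->
      acts n s (hist n s) a -> action_of_nat (nfst s) = a ->
      a.1.1.1 = e -> prefix (pre P M) c -> ~ prefix a.1.1.2 c.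
    elim: k.+1 => [|k' [M [s0 IH]]]; first by exists 0, 0.
    have [M' [s1 H1]] := acts_finite k'.
    exists (M + M'), (s0 + s1) => e s a c; rewrite ltnS leq_eqVlt.
    move=> /orP[/eqP ->|lt_e] le_s Ha Ca Ea Hc.
      apply: (H1 s) => //; first by lia.
      by apply: prefix_trans Hc; apply: pre_prefix; rewrite leq_addl.
    apply: (IH e s) => //; first by lia.
    by apply: prefix_trans Hc; apply: pre_prefix; rewrite leq_addr.
  by exists M, s0 => s a c le_s Ha Ca Ea; apply: HM Ha Ca erefl.
have [v0 Hv0] : exists v0, forall t, t < s0 -> m n k t <= v0.
  elim: {HM} s0 => [|s0 [v0 IH]]; first by exists 0.
  exists (v0 + m n k s0) => t; rewrite ltnS leq_eqVlt => /orP[/eqP ->|/IH]; lia.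
have tvalE v s : v0 <= v -> prefix (pre P M) (str_of_nat (nfst v)) ->
    tvalue (npair k v) (hist n s) = str_of_nat (nfst v).
  move=> le_v Hp; elim: s => [|s IHs] /=; first by rewrite nsnd_npair.
  rewrite -/(hist n s); case: ifP => Hacts; last exact: IHs.
  rewrite /= IHs; case: ifP => // /and4P[Hin He Hpre _].
  rewrite nfst_npair in He; case: (leqP s0 s) => [le_s|lt_s].
    by case: (HM s _ (str_of_nat (nfst v)) le_s Hacts erefl He).
  case/and5P: Hacts => _ _ /allP /(_ _ Hin) /andP[/hasP[t + +] _] _ _.
  rewrite mem_iota nfst_npair nsnd_npair /= => lt_t lt_v.
  by have := Hv0 t ltac:(lia); lia.
have sc : sigma1 coded coded by apply: sigma1_base; comp_tac.
have csv : computable str_of_nat by rewrite /str_of_nat; comp_tac.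
apply/eleP; apply: (sigma1_ext (P := fun x' => exists v,
  ((v0 <= v /\ prefix (pre P M) (str_of_nat (nfst v))) /\
   rgt (str_of_nat (nfst v)) (str_of_nat x')) /\
  coded (npair k v))); last by sig_tac.
move=> x'; split=> [[v [[[le_v Hp] Hr] [s [_]]]]|[m1 Hm1]].
  by rewrite tvalE // => Hq; apply: (rcut_sle Hq); rewrite /sle Hr orbT.
have [q Hq Hrq] := generic_rcut (M + m1) gP.
have HMq : prefix (pre P M) q.
  by apply: prefix_trans Hq; apply: pre_prefix; rewrite leq_addr.
pose v := npair (nat_of_str q) v0.
have Ev : str_of_nat (nfst v) = q by rewrite nfst_npair nat_of_strK.
have le_v : v0 <= v by case: (npair_ge (nat_of_str q) v0).
exists v; rewrite Ev; split; first split=> //.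
  apply: rgt_ext Hm1; last exact: prefix_refl.
  by apply: prefix_trans Hq; apply: pre_prefix; rewrite leq_addl.
have [s1 Hs1] := Hfull v.+1.
exists s1.+1; split; last by rewrite tvalE ?Ev.
apply/hasP; exists s1; first by rewrite mem_iota /=; lia.
by rewrite nfst_npair nsnd_npair; apply: Hs1.
Qed.
End Positive.
End Coding.

(** * Right halves of Ahmad pairs *)

(** The existence of a difference is enumerable from B', hence its negation from B''. *)
Lemma sigma1_iff {T} {eT : Enc T} B (a b : T -> nat -> Prop) :
  sigma1 B (fun p : T * nat => a p.1 p.2) ->
  sigma1 B (fun p : T * nat => b p.1 p.2) ->
  sigma1 (ejump (ejump B)) (fun t => forall x, a t x <-> b t x).
Proof.
move=> Ha Hb; have Ha' := sigma1_jump Ha; have Hb' := sigma1_jump Hb.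
have Na := sigma1_jumpN Ha; have Nb := sigma1_jumpN Hb.
have Hd : sigma1 (ejump B) (fun t => exists x, (a t x /\ ~ b t x) \/ (~ a t x /\ b t x)).
  by sig_tac.
apply: sigma1_ext (sigma1_jumpN Hd) => t; split=> [Hn x|Hx [x]]; last first.
  by have := Hx x; tauto.
apply: contrapT => Hx; apply: Hn; exists x.
by have := pselect (a t x); have := pselect (b t x); tauto.
Qed.

Lemma ele_eopP A B : A <=e B <-> exists i, forall x, A x <-> eop (W i) B x.
Proof.
rewrite ele_eopW; split=> -[i Hi]; exists i; first by rewrite -Hi.
by apply/seteqP; split=> x /Hi.
Qed.

Lemma eop_sum_cons e D A : eop_sum (e :: D) A <=e join (eop (W e) A) (eop_sum D A).
Proof.
have H1 := sigma1_joinl (eop (W e) A) (eop_sum D A).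
have H2 := sigma1_joinr (eop (W e) A) (eop_sum D A).
apply/eleP; apply: (sigma1_ext (P := fun z =>
   (nfst z == e /\ eop (W e) A (nsnd z)) \/ eop_sum D A z)); last by sig_tac.
move=> z; rewrite /eop_sum inE; split.
  by move=> [[/eqP -> H]|[-> H]]; rewrite ?eqxx ?orbT.
by move=> [/orP[/eqP <-|->] H]; [left; rewrite eqxx | right].
Qed.

Lemma ele_join A B C : A <=e C -> B <=e C -> join A B <=e C.
Proof. by rewrite !eleP; apply: sigma1_join. Qed.

Lemma eop_sum_nil A : eop_sum [::] A <=e set0.
Proof.
apply/eleP; apply: (sigma1_ext (P := fun=> False)); last exact: sigma1_const.
by move=> z; rewrite /eop_sum; split=> // -[].
Qed.

Lemma set0_ele A : set0 <=e A.
Proof. by apply/eleP; apply: sigma1_const. Qed.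

Lemma eop_sum_ele D A B : (forall e, e \in D -> eop (W e) A <=e B) ->
  eop_sum D A <=e B.
Proof.
elim: D => [|e D IHD] HD; first exact: ele_trans (eop_sum_nil _) (set0_ele _).
apply: ele_trans (eop_sum_cons _ _ _) _; apply: ele_join; first by apply: HD; rewrite mem_head.
by apply: IHD => e' He'; apply: HD; rewrite inE He' orbT.
Qed.

Lemma high2_right_half Y A B : sigma2 Y -> high2 Y -> sigma2 A -> A <=e Y ->
  sigma2 B -> ~ A <=e B -> (forall Z, sigma2 Z -> Z <e A -> Z <=e B) ->
  exists C, [/\ sigma2 C, C <=e Y, ~ A <=e C
    & forall Z, sigma2 Z -> Z <e A -> Z <=e C].
Proof.
move=> sY hY sA AY sB nAB AB.
(* A and B are below 0', so the double jump of 0' enumerates the ideal, and high_2-ness passes this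
   to Y''. *)
have sI : sigma1 (ejump (ejump Y)) (fun e => eop (W e) A <=e B).
  apply: sigma1_trans; first by apply/eleP; exact: hY.
  apply: (sigma1_ext (P := fun e => exists i, forall x,
      eop (W e) A x <-> eop (W i) B x)); first by move=> e; rewrite ele_eopP.
  move/eleP: sA => sA; move/eleP: sB => sB.
  apply: sigma1_ex; apply: (sigma1_iff (a := fun p x => eop (W p.1) A x)
    (b := fun p x => eop (W p.2) B x)); by apply: sigma1_eopW => //; comp_tac.
have [D HD|C [CY nAC HC]] := ideal_bound sY AY sI.
  by move=> AD; apply: nAB; apply: ele_trans AD _; apply: eop_sum_ele.
exists C; split=> //; first exact: ele_trans CY sY.
move=> Z sZ ZA; have ZB := AB Z sZ ZA; case: ZA => /ele_eopW[e Ze] _.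
by rewrite Ze; apply: HC; rewrite -Ze.
Qed.

(** * A generic real whose left cut avoids X, and the jump of its right cut *)

Lemma sigma1_rcut B P : sigma1 B (on P) -> sigma1 B (rcut P).
Proof.
move=> Hon; apply: (sigma1_ext (P := fun q => exists s, on P s /\ rgt s q)); last by sig_tac.
move=> q; split=> [[s [-> Hq]]|[n Hq]]; first by exists (size s).
by exists (pre P n); rewrite /on size_pre.
Qed.

Lemma sigma1_lcut B P : sigma1 B (on P) -> sigma1 B (lcut P).
Proof.
move=> Hon; apply: (sigma1_ext (P := fun q => exists s, on P s /\ rgt q s)); last by sig_tac.
move=> q; split=> [[s [Hs Hq]]|[n Hq]]; first by exists (size s); rewrite -Hs.
by exists (pre P n); rewrite /on size_pre.
Qed.

Lemma not_rcut P q : ~ rcut P q <-> lcut P q \/ on P q.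
Proof.
split=> [Hq|]; first by have [//|[]] := cut_cases P q; [left | right].
move=> [[n Hn]|->]; first by apply: (@rcutN P n); rewrite /sle Hn orbT.
by apply: (@rcutN P (size q)); rewrite /sle prefix_refl.
Qed.

Lemma sigma1_not_rcut B P : sigma1 B (on P) -> sigma1 B (fun q => ~ rcut P q).
Proof.
move=> Hon; have Hl := sigma1_lcut Hon.
apply: (sigma1_ext (P := fun q => lcut P q \/ on P q)); last by sig_tac.
by move=> q; rewrite not_rcut.
Qed.

Lemma sigma1_cutset B P : sigma1 B (cutset P) <-> sigma1 B (rcut P).
Proof.
split=> H.
  by apply: (sigma1_ext (P := fun q => cutset P (enc q))); [exact: cutset_enc | sig_tac].
by rewrite /cutset; sig_tac.
Qed.

Lemma sigma1_lcutset B P : sigma1 B (lcutset P) <-> sigma1 B (lcut P).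
Proof.
split=> H; last by rewrite /lcutset; sig_tac.
apply: (sigma1_ext (P := fun q => lcutset P (enc q))); last by sig_tac.
by move=> q; rewrite /lcutset encK.
Qed.

(** Otherwise the strings left of some string outside the cut form a c.e. set. P does not meet it,
    yet changing a one of P to zero produces members arbitrarily close to P. *)
Lemma generic_not_rcut P : generic P -> ~ sigma1 set0 (fun n => ~ cutset P n).
Proof.
move=> gP sN.
have [|n [[q [Hq Hr]]|Hn]] := gP (fun s => exists q, ~ cutset P (enc q) /\ rgt s q).
- apply: sigma1_ex; apply: sigma1_and; last by sig_tac.
  by apply: (sigma1_comp (f := fun p : seq bool * seq bool => enc p.2) sN); comp_tac.
- by apply: Hq; apply/cutset_enc; exists n.
- have [k le_n Hk] := generic_bit true n gP.
  apply: (Hn (rcons (pre P k) false)).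
    exact: prefix_trans (pre_prefix P le_n) (prefix_rcons _ _).
  exists (pre P k.+1); split; last by rewrite preS Hk rgt_flip.
  rewrite cutset_enc; apply/not_rcut; right; by rewrite /on size_pre.
Qed.

Lemma generic_rcut_not_ce P : generic P -> ~ cutset P <=e set0.
Proof.
move=> gP /eleP /sigma1_cutset /gP[n [|Hn]].
  by apply: (@rcutN P n); rewrite /sle prefix_refl.
by have [q Hq] := generic_rcut n gP; apply: Hn.
Qed.

(** Complementing the bits exchanges the two cuts, so a bound on the left cuts of all generic reals
    bounds their right cuts as well. *)
Definition flip (P : nat -> bool) := fun i => ~~ P i.

Lemma pre_flip P n : pre (flip P) n = [seq ~~ b | b <- pre P n].
Proof. by rewrite /pre /mkseq -map_comp. Qed.

Lemma negb_mapK : involutive (map negb).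
Proof. by move=> s; rewrite -map_comp map_id_in // => b _ /=; rewrite negbK. Qed.

Lemma rgt_negb s t : rgt (map negb s) (map negb t) = rgt t s.
Proof. by elim: s t => [|a s IHs] [|b t] //=; case: a b => [] [] /=. Qed.

Lemma generic_flip P : generic P -> generic (flip P).
Proof.
move=> gP U sU.
have [|n Hn] := gP (fun s => U (map negb s)); first by sig_tac.
exists n; rewrite pre_flip; case: Hn => [HU|Hn]; [by left | right => s Hs HU].
apply: (Hn (map negb s)); last by rewrite negb_mapK.
move: Hs => /prefixP[t ->]; rewrite map_cat negb_mapK; exact: prefix_prefix.
Qed.

Lemma on_flip P s : on (flip P) s <-> on P (map negb s).
Proof.
rewrite /on pre_flip size_map; split=> [{1}->|Hs]; first by rewrite negb_mapK.
by rewrite -Hs negb_mapK.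
Qed.

Lemma lcut_flipP P q : lcut (flip P) q <-> rcut P (map negb q).
Proof.
have E n : rgt q (pre (flip P) n) = rgt (pre P n) (map negb q).
  by rewrite pre_flip -{1}(negb_mapK q) rgt_negb.
by split=> -[n Hn]; exists n; move: Hn; rewrite E.
Qed.

Lemma sigma1_on B P : sigma1 B (lcut P) -> sigma1 B (rcut P) -> sigma1 B (on P).
Proof.
move=> Hl Hr; apply: (sigma1_ext (P := fun s => forall i, i < size s ->
  (nth false s i /\ lcut P (rcons (take i s) false)) \/
  (~~ nth false s i /\ rcut P (rcons (take i s) true)))); last by sig_tac.
move=> s; split=> [Hs|Hs i lt_i].
  have Hk k : k <= size s -> take k s = pre P k.
    elim: k => [|k IHk] lt_k; first by rewrite take0.
    rewrite (take_nth false) // IHk; last by lia.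
    rewrite preS; congr rcons; have := Hs k lt_k; rewrite IHk; last by lia.
    case: (nth false s k) => [[[_ [n Hn]]|[]//]|[[]//|[_ [n Hn]]]];
      case EP : (P k) => //.
      have := @lcut_ge P n (n + k.+1) _ Hn (leq_addr _ _).
      have : prefix (rcons (pre P k) false) (pre P (n + k.+1)).
        by rewrite -EP -preS; apply: pre_prefix; rewrite leq_addl.
      by move=> Hp; rewrite rgt_prefixF //; left.
    have := @rcut_ge P n (n + k.+1) _ Hn (leq_addr _ _).
    have : prefix (rcons (pre P k) true) (pre P (n + k.+1)).
      by rewrite -EP -preS; apply: pre_prefix; rewrite leq_addl.
    by move=> Hp; rewrite rgt_prefixF //; right.
  by rewrite /on -Hk // take_size.
have -> : take i s = pre P i.
  by rewrite Hs /pre /mkseq -map_take take_iota (minn_idPl (ltnW lt_i)).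
have -> : nth false s i = P i by rewrite Hs nth_mkseq.
by case EP : (P i); [left; split=> //; apply: lcut_flip | right; split=> //; apply: rcut_flip].
Qed.

Lemma generic_exists X : ~ ejump set0 <=e X -> exists P,
  [/\ generic P, sigma1 (ejump set0) (on P) & ~ lcutset P <=e X].
Proof.
move=> nX; apply: contrapT => Hno.
have Hall P : generic P -> sigma1 (ejump set0) (on P) -> sigma1 X (lcut P).
  move=> gP sP; apply/sigma1_lcutset/eleP; apply: contrapT => Hn.
  by apply: Hno; exists P.
have Hon P : generic P -> sigma1 (ejump set0) (on P) -> sigma1 X (on P).
  move=> gP sP; apply: sigma1_on; first exact: Hall.
  have Hf : sigma1 X (lcut (flip P)).
    apply: Hall; first exact: generic_flip.
    by apply: (sigma1_ext (P := fun s => on P (map negb s)));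
      [move=> s; rewrite on_flip | sig_tac].
  apply: (sigma1_ext (P := fun s => lcut (flip P) (map negb s))); last by sig_tac.
  by move=> s; rewrite lcut_flipP negb_mapK.
have [P0 [g0 s0 _]] := posner_robinson (sigma1_jump (K_sigma1 set0))
  (sigma1_jumpN (K_sigma1 set0)) (@sigma1_notK set0).
have cutN B : sigma1 B (on P0) -> sigma1 B (fun n => ~ cutset P0 n).
  by move=> /sigma1_not_rcut H; rewrite /cutset; sig_tac.
have cutP B : sigma1 B (on P0) -> sigma1 B (cutset P0).
  by move=> /sigma1_rcut /sigma1_cutset.
(* The cut of [P0] is not co-c.e., and X enumerates both it and its complement, as decoding 0' from
   [P1] requires. *)
have [P1 [g1 s1 H1]] := posner_robinson (cutP _ s0) (cutN _ s0) (generic_not_rcut g0).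
by apply: nX; apply: H1; [apply: cutP | apply: cutN |]; apply: Hon.
Qed.

(** A string q left of P with z outside [K (join X (rset q))] certifies that z is outside the K of
    the join with the cut; X' can find such q, as the left cut is below 0'. If some z lacked a
    certificate, the left cut would be the set of q with z in [K (join X (rset q))], since the cut
    at any other q is part of the right cut; then it would be below X. *)
Lemma cut_jump X P : sigma1 (ejump set0) (on P) -> ~ lcutset P <=e X ->
  ejump (join X (cutset P)) <=e ejump X.
Proof.
move=> sP nX.
have X0 : sigma1 (ejump X) (ejump set0).
  by apply/eleP; apply: ejump_mono; apply: set0_ele.
have sl := sigma1_trans X0 (sigma1_lcut sP).
have sr : sigma1 (ejump X) (cutset P).
  exact: sigma1_trans X0 ((sigma1_cutset _ _).2 (sigma1_rcut sP)).
have sX : sigma1 X X by apply: sigma1_base; comp_tac.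
pose Kq z q := K (join X (rset q)) z.
have K_mono (M M' : set nat) z : (forall y, M y -> M' y) ->
    K (join X M) z -> K (join X M') z.
  move=> MM' [u Hu Hc]; exists u => // y /Hc; rewrite /join /=; case: ifP => // _.
  exact: MM'.
have sKq : sigma1 X (fun p : nat * seq bool => Kq p.1 p.2).
  have HW := W_sigma1 X.
  have cseq : computable canon_seq by apply: computable_canon_seq; comp_tac.
  apply: (sigma1_ext (P := fun p : nat * seq bool =>
    exists2 u, W (nfst p.1) (npair (nsnd p.1) u) & forall y, y \in canon_seq u ->
      (odd y /\ rset p.2 y./2) \/ (~~ odd y /\ X y./2))); last by sig_tac.
  move=> [z q]; rewrite /Kq /K /eop /=; split=> -[u Hu Hy]; exists u => //.
    apply/canon_subsetP => y /Hy; rewrite /join /=.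
    by case: (odd y) => -[[]|[]].
  move=> y; move/canon_subsetP: Hy => H /H; rewrite /join /=.
  by case: (odd y); [left | right].
have sKqN := sigma1_jumpN sKq.
apply/eleP; apply: sigma1_join.
  apply: sigma1_trans (K_sigma1 _); apply: sigma1_join => //; exact: sigma1_jump.
apply: (sigma1_ext (P := fun z => exists q, lcut P q /\ ~ Kq z q)); last by sig_tac.
move=> z; split.
  move=> [q [Hq HK]]; apply: contra_not HK; apply: K_mono => y [n Hn].
  have [k Hk] := Hq; apply: rgt_trans (lcut_ge Hk (leq_addr n k)) _.
  exact: rcut_ge Hn (leq_addl _ _).
move=> HK; apply: contrapT => Hno; apply: nX; apply/eleP; apply/sigma1_lcutset.
apply: (sigma1_ext (P := fun q => Kq z q)); last by sig_tac.
move=> q; split=> [HKq|Hq]; last first.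
  by apply: contrapT => HKq; apply: Hno; exists q.
have [Hq|[//|Hq]] := cut_cases P q; case: HK; apply: K_mono HKq => y Hy.
  by apply: (rcut_sle Hq); rewrite /sle Hy orbT.
by exists (size q); rewrite -Hq.
Qed.

Lemma right_half_high2 X :
  (forall Y : set nat, sigma2 Y -> X <=e Y ->
   forall A : set nat, sigma2 A -> A <=e Y ->
   (exists B : set nat,
      [/\ sigma2 B, ~ (A <=e B)
        & forall Z : set nat, sigma2 Z -> Z <e A -> Z <=e B]) ->
   (exists C : set nat,
      [/\ sigma2 C, C <=e Y, ~ (A <=e C)
        & forall Z : set nat, sigma2 Z -> Z <e A -> Z <=e C])) ->
  sigma2 X -> high2 X.
Proof.
move=> Hyp sX; apply: contrapT => nh.
have nX : ~ ejump set0 <=e X by move=> H; apply: nh; do 2 apply: ejump_mono.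
have [P [gP sP nP]] := generic_exists nX.
pose A := cutset P; have sA : sigma2 A by apply/eleP/sigma1_cutset/sigma1_rcut.
(* Lowness is the case of an empty X: the left cut is not c.e., being not even below X. *)
have Alow : ejump A <=e ejump set0.
  apply: (@ele_trans _ (ejump (join set0 A))).
    by apply: ejump_mono; apply/eleP; apply: sigma1_joinr.
  apply: cut_jump => // H; apply: nP; exact: ele_trans H (set0_ele _).
have sAA : sigma1 A A by apply: sigma1_base; comp_tac.
(* By lowness, A <=e Gamma_e(A) is enumerable from 0'', so its negation is enumerable from 0'''. *)
have sI : sigma1 (ejump (ejump (ejump set0))) (fun e => ~ A <=e eop (W e) A).
  apply: sigma1_jumpN; apply: sigma1_trans; first exact/eleP/ejump_mono/Alow.
  apply: (sigma1_ext (P := fun e => exists i, forall x,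
      A x <-> eop (W i) (eop (W e) A) x)); first by move=> e; rewrite ele_eopP.
  apply: sigma1_ex; apply: (sigma1_iff (a := fun p x => A x)
    (b := fun p x => eop (W p.2) (eop (W p.1) A) x)); first by sig_tac.
  have HW := W_sigma1 A.
  apply: (sigma1_ext (P := fun q : nat * nat * nat => exists2 u,
    W q.1.2 (npair q.2 u) & forall y, y \in canon_seq u -> eop (W q.1.1) A y)).
    by move=> q; split=> -[u H1 /canon_subsetP H2]; exists u.
  apply: sigma1_ex2; first by sig_tac.
  apply: sigma1_all; first by apply: sigma1_eopW => //; comp_tac.
  by apply: computable_canon_seq; comp_tac.
(* Nonsplitting peels off one member of the join at a time; the empty join is excluded because A is
   not c.e. *)
have HD D : (forall e, e \in D -> ~ A <=e eop (W e) A) -> ~ A <=e eop_sum D A.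
  have eA e : eop (W e) A <=e A by apply/ele_eopW; exists e.
  elim: D => [|e D IHD] HD AD.
    by apply: (generic_rcut_not_ce gP); apply: ele_trans AD (eop_sum_nil _).
  have [||||] := @cut_nonsplitting P gP (eop (W e) A) (eop_sum D A) => //.
  - by apply: eop_sum_ele.
  - exact: ele_trans AD (eop_sum_cons _ _ _).
  - by apply: HD; rewrite mem_head.
  - by apply: IHD => e' He'; apply: HD; rewrite inE He' orbT.
(* The set called Y in [ideal_bound] is 0' here, whose double jump is the 0''' of [sI]. *)
have [B [sB nAB HB]] := ideal_bound (ele_refl _) sA sI HD.
pose Y := join X A; have sY : sigma2 Y by apply: ele_join.
have AY : A <=e Y by apply/eleP; apply: sigma1_joinr.
have [||C [sC CY nAC HC]] := Hyp Y sY _ A sA AY.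
- by apply/eleP; apply: sigma1_joinl.
- exists B; split=> // Z sZ [/ele_eopW[e Ze] nAZ]; rewrite Ze; apply: HB.
  by rewrite -Ze.
apply: nh; apply: (@ele_trans _ (ejump (ejump Y))); last first.
  by apply: ejump_mono; apply: cut_jump.
pose S := K (ejump (ejump set0)).
have [m [cm mD mP]] := sigma3_approx set0_approx (K_sigma1 (ejump (ejump set0))).
have [wst [cw wmono wP]] := sigma1_stage (W_sigma1 set0).
pose Z n := coded wst m P n.
have sZ : sigma1 A (fun p : nat * nat => Z p.1 p.2).
  have ch := computable_hist cw cm; have ct := computable_tvalue.
  have ca := computable_alive cm.
  apply: (sigma1_ext (P := fun p : nat * nat => exists s, alive m p.1 p.2 s /\
     A (enc (tvalue p.2 (hist wst m p.1 s))))); last by sig_tac.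
  by move=> [n z]; split=> -[s [Hal Hs]]; exists s; split=> //; apply/cutset_enc.
have ZA n : Z n <=e A.
  by apply/eleP; apply: (sigma1_comp (f := fun z => (n, z)) sZ); comp_tac.
have SZ n : ~ S n <-> Z n <=e C.
  split=> [nS|ZC /mP[k Hk]]; last first.
    apply: nAC; apply: ele_trans ZC; apply: (coded_positive cw cm gP (k := k)).
    by move=> b; have [s0 Hs0] := Hk b; exists s0 => s le_s; apply: Hs0.
  apply: HC; first exact: ele_trans (ZA n) sA.
  split=> //; apply: (coded_negative cw wP wmono cm gP) => k.
  have [Hf|[b Hb]] := mD n k; first by case: nS; apply/mP; exists k.
  by exists b => s; apply: Hb.
(* The positive half of 0''' is below Y'' by monotonicity. For the negative half, non-membership of
   n becomes Z_n <=e C, enumerable from Y'' because C and, uniformly in n, Z_n are below Y. *)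
apply/eleP; apply: sigma1_join.
  apply: sigma1_trans (K_sigma1 _).
  by apply/eleP; do 2 apply: ejump_mono; apply: set0_ele.
apply: (sigma1_ext (P := fun n => exists i, forall z, Z n z <-> eop (W i) C z)).
  by move=> n; rewrite -ele_eopP -SZ.
apply: sigma1_ex; apply: (sigma1_iff (a := fun p z => Z p.1 z)
    (b := fun p z => eop (W p.2) C z)).
  have sZY : sigma1 Y (fun p : nat * nat => Z p.1 p.2).
    by apply: sigma1_trans sZ; apply: sigma1_joinr.
  by sig_tac.
by move/eleP: CY => CY; apply: sigma1_eopW => //; comp_tac.
Qed.

Theorem theorem5p16 (X : set nat) (hX : sigma2 X) :
  high2 X <->
  (forall Y : set nat, sigma2 Y -> X <=e Y ->
   forall A : set nat, sigma2 A -> A <=e Y ->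
   (exists B : set nat,
      [/\ sigma2 B, ~ (A <=e B)
        & forall Z : set nat, sigma2 Z -> Z <e A -> Z <=e B]) ->
   (exists C : set nat,
      [/\ sigma2 C, C <=e Y, ~ (A <=e C)
        & forall Z : set nat, sigma2 Z -> Z <e A -> Z <=e C])).
Proof.
split=> [hiX Y sY XY A sA AY [B [sB nAB HB]]|Hyp]; last exact: right_half_high2.
apply: (@high2_right_half Y A B) => //.
by apply: ele_trans hiX _; do 2 apply: ejump_mono.
Qed.
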